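(* Let $F=\{t_1,\ldots,t_N\}$ be an arbitrary finite subset of $[-1,1]$. Then there exists a matrix $\mathfrak{A}=\{a_{k,n}\}$ of inverse values of poles for $[-1,1]$ such that every point of $F$ is an accumulation point of the corresponding poles $\{1/a_{k,n}\}$ and such that, for the matrix $\mathfrak{M}$ whose $n$-th row consists of the zeros in $[-1,1]$ of $$\varpi_n(x)=\cos\Bigl(\pi\sum_{k=1}^n\omega\bigl(1/a_{k,n},\,[-1,x],\,\overline{\mathbb{C}}\setminus[-1,1]\bigr)\Bigr),\quad x\in[-1,1],$$ there is a constant $C>0$, independent of $n$, with $$\lambda_n(\mathfrak{M},\mathfrak{A})\le C\log n\quad\text{for all } n\ge2.$$
   Context: Harmonic measure: for a domain $B\subset\overline{\mathbb{C}}$ whose boundary consists of finitely many disjoint piecewise smooth curves or arcs, and a closed subset $\alpha\subset\partial B$ consisting of arcs or curves, $\omega(z,\alpha,B)$ denotes the bounded harmonic function of $z\in B$ that tends to $1$ at interior points of $\alpha$ and to $0$ at interior points of $\partial B\setminus\alpha$ (the harmonic measure of $\alpha$ at $z$ with respect to $B$). Matrix of inverse values of poles for $[-1,1]$: a triangular array $\mathfrak{A}=\{a_{k,n}\}_{n\ge1,\,1\le k\le n}$ of complex numbers such that $1/a_{k,n}\in\overline{\mathbb{C}}\setminus[-1,1]$ for all $k,n$ (with $1/0=\infty$), and such that in each row the non-real entries occur in complex conjugate pairs (counted with multiplicity). The poles are the points $1/a_{k,n}$; an accumulation point of the poles is an accumulation point of the set $\{1/a_{k,n}:n\ge1,1\le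 k\le n\}$. The function $\varpi_n$ in the claim is, up to a constant multiplier, a rational function of the form $\prod_{k=1}^n\frac{x-x_{k,n}}{1-a_{k,n}x}$ (a Chebyshev–Markov rational function), with $n$ distinct zeros $x_{n,n}<\cdots<x_{1,n}$ in $(-1,1)$. Lebesgue constant: for a node matrix $\mathfrak{M}=\{x_{k,n}\}$, $x_{n,n}<\cdots<x_{1,n}$, and a matrix $\mathfrak{A}=\{a_{k,n}\}_{n\ge1,\,1\le k\le n}$ of inverse values of poles for $[-1,1]$ (a triangular array of complex numbers with $1/a_{k,n}\in\overline{\mathbb{C}}\setminus[-1,1]$ for all $k,n$, where $1/0=\infty$, the non-real entries of each row occurring in complex conjugate pairs counted with multiplicity), put $w_n(x)=\prod_{k=1}^n\frac{x-x_{k,n}}{1-a_{k,n}x}$, $\ell_{k,n}(\mathfrak{M},\mathfrak{A},x)=\frac{w_n(x)}{w_n'(x_{k,n})(x-x_{k,n})}$ (extended by continuity to $x=x_{k,n}$), $\lambda_n(\mathfrak{M},\mathfrak{A},x)=\sum_{k=1}^n|\ell_{k,n}(\mathfrak{M},\mathfrak{A},x)|$, and $\lambda_n(\mathfrak{M},\mathfrak{A})=\sup_{x\in[-1,1]}\lambda_n(\mathfrak{M},\mathfrak{A},x)$. *)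

(* Defs.v *)
From HB Require Import structures.
From mathcomp Require Import all_boot all_order all_algebra.
From mathcomp Require Import all_classical all_reals all_analysis.
From mathcomp Require Export complex.

Set Implicit Arguments.
Unset Strict Implicit.
Unset Printing Implicit Defensive.

Import Order.TTheory GRing.Theory Num.Theory.
Import numFieldNormedType.Exports.

Local Open Scope classical_set_scope.
Local Open Scope ring_scope.
Local Open Scope complex_scope.

(* Seen through its numClosedFieldType structure, [R[i]] inherits the topology
   and the normed module structure (over itself) that every numFieldType has. *)
Definition Cplx (R : realType) : numClosedFieldType := R[i].

Definition cplx_of_real (R : realType) (t : R) : Cplx R := t%:C.

Definition riemann_sphere (R : realType) := one_point_compactification (Cplx R).

Definition sphere_inv (R : realType) (z : Cplx R) : riemann_sphere R :=
  if z == 0 then None else Some z^-1.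

Section Harmonic.
Variable R : realType.
Implicit Types (f : R * R -> R) (U : set (R * R)).

Definition e1 : R * R := (1, 0).
Definition e2 : R * R := (0, 1).

Definition C1_on U f := forall p, U p ->
  [/\ derivable f p e1, derivable f p e2,
      {for p, continuous ('D_e1 f)} & {for p, continuous ('D_e2 f)}].

Definition C2_on U f :=
  [/\ C1_on U f, C1_on U ('D_e1 f) & C1_on U ('D_e2 f)].

Definition laplacian f (p : R * R) : R :=
  'D_e1 ('D_e1 f) p + 'D_e2 ('D_e2 f) p.

(* [U] is meant to be open *)
Definition plane_harmonic U f :=
  C2_on U f /\ forall p, U p -> laplacian f p = 0.

Definition chart0 (p : R * R) : riemann_sphere R := Some (p.1 +i* p.2 : Cplx R).
Definition chartoo (p : R * R) : riemann_sphere R :=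
  sphere_inv (p.1 +i* p.2 : Cplx R).

(* The charts z and 1/z cover the sphere; the condition at infinity is that
   u(1/z) is harmonic near 0. *)
Definition sphere_harmonic (B : set (riemann_sphere R))
    (u : riemann_sphere R -> R) :=
  plane_harmonic (chart0 @^-1` B) (u \o chart0) /\
  plane_harmonic (chartoo @^-1` B) (u \o chartoo).

End Harmonic.

Section HarmonicMeasure.
Variable R : realType.
Implicit Types (alpha B : set (riemann_sphere R)) (u : riemann_sphere R -> R).

Definition frontier B : set (riemann_sphere R) := closure B `\` B°.

(* Interior of [A] in the subspace topology of [S], for A included in S. *)
Definition relative_interior (S A : set (riemann_sphere R)) :
    set (riemann_sphere R) :=
  [set p | A p /\ within S (nbhs p) A].

Definition is_harmonic_measure alpha B u :=
  [/\ exists M : R, forall z, B z -> `|u z| <= M,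
      sphere_harmonic B u,
      forall p, relative_interior (frontier B) alpha p ->
        u z @[z --> within B (nbhs p)] --> (1 : R) &
      forall p, relative_interior (frontier B) (frontier B `\` alpha) p ->
        u z @[z --> within B (nbhs p)] --> (0 : R)].

(* Only the values at [z] in [B] are meaningful: the defining conditions put no
   constraint on [u] outside [B]. *)
Definition harmonic_measure (z : riemann_sphere R) alpha B : R :=
  xget (fun=> 0) [set u | is_harmonic_measure alpha B u] z.

Definition segment (s t : R) : set (riemann_sphere R) :=
  [set Some (cplx_of_real r) | r in `[s, t]].

Definition slit_sphere : set (riemann_sphere R) := ~` segment (-1) 1.

End HarmonicMeasure.

Section RationalInterpolation.
Variable R : realType.

(* Row [n] is indexed by ['I_n], so that the entry a_{k,n}, 1 <= k <= n, is
   [a n (k - 1)]; row [0] is empty. *)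
Definition inverse_pole_matrix (a : forall n, 'I_n -> Cplx R) :=
  forall n,
    (forall k, slit_sphere (sphere_inv (a n k))) /\
    (forall c, c \isn't Num.real ->
      #|[set k | a n k == c]%SET| = #|[set k | a n k == c^*%R]%SET|).

Definition poles (a : forall n, 'I_n -> Cplx R) : set (riemann_sphere R) :=
  [set p | exists n (k : 'I_n), p = sphere_inv (a n k)].

Definition varpi n (a : 'I_n -> Cplx R) (x : R) : R :=
  cos (pi * \sum_(k < n)
    harmonic_measure (sphere_inv (a k)) (segment (-1) x) (@slit_sphere R)).

Definition wfun n (x : 'I_n -> R) (a : 'I_n -> Cplx R) (z : Cplx R) : Cplx R :=
  \prod_(k < n) ((z - cplx_of_real (x k)) / (1 - a k * z)).

Definition ell_quotient n (x : 'I_n -> R) (a : 'I_n -> Cplx R) (k : 'I_n)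
    (z : Cplx R) : Cplx R :=
  wfun x a z /
    (derive1 (wfun x a) (cplx_of_real (x k)) * (z - cplx_of_real (x k))).

Definition ell n (x : 'I_n -> R) (a : 'I_n -> Cplx R) (k : 'I_n)
    (z : Cplx R) : Cplx R :=
  if z == cplx_of_real (x k)
  then lim (ell_quotient x a k y @[y --> (cplx_of_real (x k))^'])
  else ell_quotient x a k z.

Definition lebesgue_function n (x : 'I_n -> R) (a : 'I_n -> Cplx R) (t : R) : R :=
  \sum_(k < n) ComplexField.Normc.normc (ell x a k (cplx_of_real t)).

Definition lebesgue_constant n (x : 'I_n -> R) (a : 'I_n -> Cplx R) : \bar R :=
  ereal_sup [set (lebesgue_function x a t)%:E | t in `[-1, 1]].

(* [x] lists the zeros of [varpi a] in [-1, 1] in decreasing order. *)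
Definition zero_row n (a : 'I_n -> Cplx R) (x : 'I_n -> R) :=
  (forall i j : 'I_n, (i < j)%N -> x j < x i) /\
  range x = [set t | t \in `[-1, 1] /\ varpi a t = 0].

End RationalInterpolation.

(* Main.v *)
Require Import Defs.
From HB Require Import structures.
From mathcomp Require Import all_boot all_order all_algebra.
From mathcomp Require Import all_classical all_reals all_analysis.
From mathcomp Require Import perm ring lra zify.

Set Implicit Arguments.
Unset Strict Implicit.
Unset Printing Implicit Defensive.

Import Order.TTheory GRing.Theory Num.Theory.
Import numFieldNormedType.Exports.

Local Open Scope classical_set_scope.
Local Open Scope ring_scope.

(** Row [n] carries one conjugate pair of finite poles, [(b + 1/b) / 2] with
[b = r e^(+- i phi)], and leaves all its other poles at infinity (rows with
[n <= 4] have no finite poles). The angle satisfies [cos phi = t], where [t]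
runs cyclically through [F] as [n] grows, and [r = 1 - 4/n]; since [r] tends
to 1, every [t] in [F] is a limit of poles. With two finite poles in each
row every object of the statement can be computed.

Harmonic measure. In the coordinate [a = 1/z] the function
[omega x a = 1/2 + atan (...) / pi] has for gradient the conjugate of a
holomorphic function, so it is harmonic off the slit, at infinity included,
and it tends to 1 at the points of the slit left of [x] and to 0 at those
right of [x]. Since a harmonic measure is bounded but has no prescribed
limit at [x] itself, its uniqueness ([harmonic_measure_le]) takes a
Phragmen-Lindelof argument: if [u1] and [u2] are two candidates, then
[u1 - u2 - e * barrier], where [barrier] is nonnegative, strictly
superharmonic and infinite at [x], has a continuous positive part on the
whole compact sphere; a positive maximum would lie off the slit and
contradict the second derivative test. Let [e] tend to 0.

Phase. At [x = cos th] the harmonic measure of a pole is [1 - A th / pi], where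
[A] is the mean of the arguments of two Blaschke factors. Hence
[varpi n (cos th) = cos (n pi - Phi th)] with
[Phi th = (n - 2) th + 2 A th]. The derivative of [A] is the mean of two
Poisson kernels, so it lies between 0 and [(1 + r) / (1 - r)], which is at
most [n / 2] by the choice of [r]; therefore [Phi] has slope between [n / 2]
and [2 n], as it would if all poles stayed away from the interval
([row_phase_lip]). The nodes are the cosines of the solutions of
[Phi th = (k + 1/2) pi].

Lebesgue constant. The product of [cos Phi] with the modulus of the denominator
of [w_n] is, up to a constant factor, a polynomial of degree at most [n] in
[cos th], and it vanishes at the nodes ([row_poly]), so
[|w_n (cos th)| = kappa |cos (Phi th)|]. Comparing [cos th - cos th_k] with
[th - th_k], and those with [Phi th - Phi th_k], yields
[|l_k (cos th)| <= 128 / (1 + |k - j|)] where [j] is the integer part of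
[Phi th / pi] ([ell_bound]); summing over [k] gives a harmonic sum, hence
[log n]. *)

(** * Calculus in the real plane *)

Lemma is_derive_ext (R : numFieldType) (V W : normedModType R) (f g : V -> W)
    (x v : V) (df dg : W) :
  f =1 g -> df = dg -> is_derive x v f df -> is_derive x v g dg.
Proof. by move=> /funext -> ->. Qed.

(** A directional derivative is the derivative of the restriction to a line,
    which gives access to the one-variable theorems. *)
Lemma is_derive_slice (R : realType) (V : normedModType R) (f : V -> R)
    (x v : V) (t a : R) :
  is_derive (t *: v + x) v f a <-> is_derive t 1 (fun h => f (h *: v + x)) a.
Proof.
have E : (fun h : R => h^-1 *: ((f \o shift (t *: v + x)) (h *: v)
           - f (t *: v + x))) =
  (fun h : R => h^-1 *: (((fun k : R => f (k *: v + x)) \o shift t) (h *: 1%R)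
           - f (t *: v + x))).
  apply/funext => h /=; congr (_ *: (f _ - _)).
  by rewrite addrA -scalerDl [h *: 1%R]mulr1.
split=> -[d <-]; split.
- by rewrite /derivable -E.
- by rewrite /derive -E.
- by rewrite /derivable E.
- by rewrite /derive E.
Qed.

Lemma is_derive_slice0 (R : realType) (V : normedModType R) (f : V -> R)
    (x v : V) (a : R) :
  is_derive x v f a <-> is_derive (0 : R) 1 (fun h => f (h *: v + x)) a.
Proof. by have := is_derive_slice f x v 0 a; rewrite scale0r add0r. Qed.

Lemma is_derive_comp1 (R : realType) (V : normedModType R) (f : V -> R)
    (g : R -> R) (x v : V) (a b : R) :
  is_derive (f x) 1 g b -> is_derive x v f a ->
  is_derive x v (g \o f) (b * a).
Proof.
move=> dg /is_derive_slice0 df; apply/is_derive_slice0.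
have := @is_derive1_comp R g (fun h : R => f (h *: v + x)) 0 b a.
by rewrite /= scale0r add0r; apply.
Qed.

Lemma is_derive_inv (R : realType) (V : normedModType R) (f : V -> R)
    (x v : V) (a : R) : f x != 0 ->
  is_derive x v f a -> is_derive x v (fun y => (f y)^-1) (- (f x) ^- 2 * a).
Proof.
move=> fx0 df; move: df => -[df dfE]; split; first exact: derivableV.
by rewrite deriveV // dfE.
Qed.

Section ComplexValued.
Variable R : realType.
Local Notation C := R[i].
Local Notation Re := complex.Re.
Local Notation Im := complex.Im.
Local Open Scope complex_scope.
Implicit Types (f g : R * R -> C) (p v : R * R).

Definition toC (p : R * R) : C := p.1 +i* p.2.

(** Values are kept in the algebraic type [R[i]] and differentiated through
    their real and imaginary parts, because the harmonicity to be proved is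
    phrased with derivatives along the two axes of [R * R]. *)
Definition cderive p v f (d : C) :=
  is_derive p v (fun q => Re (f q)) (Re d) /\
  is_derive p v (fun q => Im (f q)) (Im d).

(** The Cauchy-Riemann equations in complex form: the derivative along the
    second axis is [i] times the derivative along the first. *)
Definition hol p f (d : C) := cderive p (e1 R) f d /\ cderive p (e2 R) f ('i * d).

Definition ccont p f :=
  Re (f q) @[q --> p] --> Re (f p) /\ Im (f q) @[q --> p] --> Im (f p).

Lemma ReM (x y : C) : Re (x * y) = Re x * Re y - Im x * Im y.
Proof. by case: x => a b; case: y => c d. Qed.

Lemma ImM (x y : C) : Im (x * y) = Re x * Im y + Im x * Re y.
Proof. by case: x => a b; case: y => c d. Qed.

Lemma ReD (x y : C) : Re (x + y) = Re x + Re y.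
Proof. by case: x => a b; case: y => c d. Qed.

Lemma ImD (x y : C) : Im (x + y) = Im x + Im y.
Proof. by case: x => a b; case: y => c d. Qed.

Lemma ReN (x : C) : Re (- x) = - Re x.
Proof. by case: x => a b. Qed.

Lemma ImN (x : C) : Im (- x) = - Im x.
Proof. by case: x => a b. Qed.

Definition normsq (x : C) : R := Re x ^+ 2 + Im x ^+ 2.

Lemma ReV (x : C) : Re x^-1 = Re x / normsq x.
Proof. by case: x => a b. Qed.

Lemma ImV (x : C) : Im x^-1 = - (Im x / normsq x).
Proof. by case: x => a b. Qed.

Lemma ReC (a : R) : Re a%:C = a. Proof. by []. Qed.
Lemma ImC (a : R) : Im a%:C = 0. Proof. by []. Qed.
Lemma Rei : Re ('i : C) = 0. Proof. by []. Qed.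
Lemma Imi : Im ('i : C) = 1. Proof. by []. Qed.

Lemma Re_iM (x : C) : Re ('i * x) = - Im x.
Proof. by case: x => a b /=; ring. Qed.
Lemma Im_iM (x : C) : Im ('i * x) = Re x.
Proof. by case: x => a b /=; ring. Qed.

Definition ReImE := (ReM, ImM, ReD, ImD, ReN, ImN, ReC, ImC, Rei, Imi).

Lemma eqC (x y : C) : Re x = Re y -> Im x = Im y -> x = y.
Proof. by case: x => a b; case: y => c d /= -> ->. Qed.

Lemma normsq_eq0 (x : C) : (normsq x == 0) = (x == 0).
Proof.
case: x => a b; rewrite /normsq paddr_eq0 ?sqr_ge0 //= !sqrf_eq0.
by rewrite eq_complex.
Qed.

Lemma normsq_ge0 (x : C) : 0 <= normsq x.
Proof. by rewrite addr_ge0 ?sqr_ge0. Qed.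

Lemma normsq_gt0 (x : C) : (0 < normsq x) = (x != 0).
Proof. by rewrite lt_neqAle normsq_ge0 andbT eq_sym normsq_eq0. Qed.

Lemma normsqM (x y : C) : normsq (x * y) = normsq x * normsq y.
Proof. by case: x => a b; case: y => c d; rewrite /normsq /=; ring. Qed.

Lemma normsqV (x : C) : normsq x^-1 = (normsq x)^-1.
Proof.
have [->|x0] := eqVneq x 0; first by rewrite invr0 /normsq /= expr0n addr0 invr0.
have n0 : normsq x != 0 by rewrite normsq_eq0.
apply: (mulfI n0); rewrite mulfV // -normsqM mulfV //.
by rewrite /normsq /= expr1n expr0n addr0.
Qed.

Lemma cderive_cst p v (c : C) : cderive p v (cst c) 0.
Proof. by split; exact: is_derive_cst. Qed.

Lemma cderiveD p v f g a b :
  cderive p v f a -> cderive p v g b -> cderive p v (fun q => f q + g q) (a + b).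
Proof.
move=> [fr fi] [gr gi]; split.
- by apply: is_derive_ext (is_deriveD fr gr) => [q|]; rewrite ReD.
- by apply: is_derive_ext (is_deriveD fi gi) => [q|]; rewrite ImD.
Qed.

Lemma cderiveN p v f a : cderive p v f a -> cderive p v (fun q => - f q) (- a).
Proof.
move=> [fr fi]; split.
- by apply: is_derive_ext (is_deriveN fr) => [q|]; rewrite ReN.
- by apply: is_derive_ext (is_deriveN fi) => [q|]; rewrite ImN.
Qed.

Lemma cderiveM p v f g a b :
  cderive p v f a -> cderive p v g b ->
  cderive p v (fun q => f q * g q) (f p * b + a * g p).
Proof.
move=> [fr fi] [gr gi]; split.
- apply: is_derive_ext (is_deriveB (is_deriveM fr gr) (is_deriveM fi gi)).
    by move=> q; rewrite ReM.
  by rewrite !ReImE /GRing.scale/=; ring.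
- apply: is_derive_ext (is_deriveD (is_deriveM fr gi) (is_deriveM fi gr)).
    by move=> q; rewrite ImM.
  by rewrite !ReImE /GRing.scale/=; ring.
Qed.

Lemma is_derive_normsq p v f a : cderive p v f a ->
  is_derive p v (fun q => normsq (f q)) (2 * (Re (f p) * Re a + Im (f p) * Im a)).
Proof.
move=> [fr fi].
apply: is_derive_ext (is_deriveD (is_deriveM fr fr) (is_deriveM fi fi)).
  by move=> q; rewrite /normsq !expr2.
by rewrite /GRing.scale/=; ring.
Qed.

Lemma cderiveV p v f a : f p != 0 ->
  cderive p v f a -> cderive p v (fun q => (f q)^-1) (- a / f p ^+ 2).
Proof.
move=> fp0 df.
have np0 : normsq (f p) != 0 by rewrite normsq_eq0.
have dn := @is_derive_inv _ _ (fun q => normsq (f q)) _ _ _ np0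
  (is_derive_normsq df).
case: df => fr fi; split.
- apply: is_derive_ext (is_deriveM fr dn); first by move=> q; rewrite ReV.
  rewrite expr2 !(ReImE, ReV, ImV, normsqM) /GRing.scale/=.
  move: np0; rewrite /normsq => np0; field; exact: np0.
- apply: is_derive_ext (is_deriveN (is_deriveM fi dn)).
    by move=> q; rewrite ImV.
  rewrite expr2 !(ReImE, ReV, ImV, normsqM) /GRing.scale/=.
  move: np0; rewrite /normsq => np0; field; exact: np0.
Qed.

Lemma hol_cst p (c : C) : hol p (cst c) 0.
Proof. by split; rewrite ?mulr0; exact: cderive_cst. Qed.

Lemma holD p f g a b : hol p f a -> hol p g b -> hol p (fun q => f q + g q) (a + b).
Proof. by move=> [f1 f2] [g1 g2]; split; rewrite ?mulrDr; exact: cderiveD. Qed.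

Lemma holN p f a : hol p f a -> hol p (fun q => - f q) (- a).
Proof. by move=> [f1 f2]; split; rewrite ?mulrN; exact: cderiveN. Qed.

Lemma holM p f g a b : hol p f a -> hol p g b ->
  hol p (fun q => f q * g q) (f p * b + a * g p).
Proof.
move=> [f1 f2] [g1 g2]; split; first exact: cderiveM.
have -> : 'i * (f p * b + a * g p) = f p * ('i * b) + ('i * a) * g p by ring.
exact: cderiveM.
Qed.

Lemma holV p f a : f p != 0 -> hol p f a ->
  hol p (fun q => (f q)^-1) (- a / f p ^+ 2).
Proof.
move=> fp0 [f1 f2]; split; first exact: cderiveV.
by rewrite mulrA mulrN; exact: cderiveV.
Qed.

Let is_derive_affine (a b : R) : is_derive (0 : R) 1 (fun h : R => h * a + b) a.
Proof.
apply: is_derive_ext (is_deriveD (is_deriveM (is_derive_id (0 : R) 1)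
  (is_derive_cst a _ _)) (is_derive_cst b _ _)); first by [].
by rewrite /GRing.scale/= /cst; ring.
Qed.

Lemma is_derive_fst p v : is_derive p v (fst : R * R -> R) v.1.
Proof. by apply/is_derive_slice0; exact: is_derive_affine. Qed.

Lemma is_derive_snd p v : is_derive p v (snd : R * R -> R) v.2.
Proof. by apply/is_derive_slice0; exact: is_derive_affine. Qed.

Lemma hol_toC p : hol p toC 1.
Proof.
split; rewrite ?mulr1.
- by split; [exact: (is_derive_fst p (e1 R))|exact: (is_derive_snd p (e1 R))].
- by split; [exact: (is_derive_fst p (e2 R))|exact: (is_derive_snd p (e2 R))].
Qed.

Lemma ccont_cst p (c : C) : ccont p (cst c).
Proof. by split; exact: cvg_cst. Qed.

Lemma ccontD p f g : ccont p f -> ccont p g -> ccont p (fun q => f q + g q).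
Proof.
move=> [a b] [c d]; split; rewrite !ReImE; under eq_fun do rewrite !ReImE;
  exact: cvgD.
Qed.

Lemma ccontN p f : ccont p f -> ccont p (fun q => - f q).
Proof.
move=> [a b]; split; rewrite !ReImE; under eq_fun do rewrite !ReImE;
  exact: cvgN.
Qed.

Lemma ccontM p f g : ccont p f -> ccont p g -> ccont p (fun q => f q * g q).
Proof.
move=> [a b] [c d]; split; rewrite !ReImE; under eq_fun do rewrite !ReImE.
- by apply: cvgB; apply: cvgM.
- by apply: cvgD; apply: cvgM.
Qed.

Lemma ccont_normsq p f : ccont p f -> normsq (f q) @[q --> p] --> normsq (f p).
Proof.
move=> [a b]; rewrite /normsq !expr2; under eq_fun do rewrite !expr2.
by apply: cvgD; apply: cvgM.
Qed.

Lemma ccontV p f : f p != 0 -> ccont p f -> ccont p (fun q => (f q)^-1).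
Proof.
move=> fp0 cf; have cn := ccont_normsq cf; case: cf => [a b].
split; rewrite !(ReV, ImV); under eq_fun do rewrite !(ReV, ImV).
- by apply: cvgM => //; apply: cvgV => //; rewrite normsq_eq0.
- by apply: cvgN; apply: cvgM => //; apply: cvgV => //; rewrite normsq_eq0.
Qed.

Lemma ccont_toC p : ccont p toC.
Proof. by split; [exact: cvg_fst|exact: cvg_snd]. Qed.

(** If [K = h_x - i h_y] is holomorphic then [h_xx = Re K'] and [h_yy = - Re K']
    cancel. Every harmonic function below is recognised by its gradient, so no
    harmonic conjugate of [h] is ever needed. *)
Lemma hol_plane_harmonic (U : set (R * R)) (h : R * R -> R) (K K' : R * R -> C) :
  open U ->
  (forall p, U p -> is_derive p (e1 R) h (Re (K p)) /\
                    is_derive p (e2 R) h (- Im (K p))) ->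
  (forall p, U p -> hol p K (K' p)) -> (forall p, U p -> ccont p K) ->
  (forall p, U p -> ccont p K') ->
  plane_harmonic U h.
Proof.
move=> oU dh hK cK cK'.
have D1 p : U p -> 'D_(e1 R) h p = Re (K p) by move=> /dh[[]].
have D2 p : U p -> 'D_(e2 R) h p = - Im (K p) by move=> /dh[_ []].
have N p : U p -> \near p, U p by move=> Up; apply: open_nbhs_nbhs; split.
have D1n p : U p -> \near p, 'D_(e1 R) h p = Re (K p).
  by move=> /N; apply: filterS => q; exact: D1.
have D2n p : U p -> \near p, 'D_(e2 R) h p = - Im (K p).
  by move=> /N; apply: filterS => q; exact: D2.
have d11 p : U p -> is_derive p (e1 R) ('D_(e1 R) h) (Re (K' p)).
  move=> Up; case: (hK _ Up) => [[a _] _].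
  by apply: near_eq_is_derive a; apply: filterS (D1n _ Up) => q ->.
have d12 p : U p -> is_derive p (e2 R) ('D_(e1 R) h) (- Im (K' p)).
  move=> Up; case: (hK _ Up) => [_ [a _]].
  rewrite Re_iM in a.
  by apply: near_eq_is_derive a; apply: filterS (D1n _ Up) => q ->.
have d21 p : U p -> is_derive p (e1 R) ('D_(e2 R) h) (- Im (K' p)).
  move=> Up; case: (hK _ Up) => [[_ a] _].
  by apply: near_eq_is_derive (is_deriveN a); apply: filterS (D2n _ Up) => q ->.
have d22 p : U p -> is_derive p (e2 R) ('D_(e2 R) h) (- Re (K' p)).
  move=> Up; case: (hK _ Up) => [_ [_ a]].
  rewrite Im_iM in a.
  by apply: near_eq_is_derive (is_deriveN a); apply: filterS (D2n _ Up) => q ->.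
have cn (g k : R * R -> R) p : U p -> (forall q, U q -> g q = k q) ->
    {for p, continuous k} -> {for p, continuous g}.
  move=> Up gk ck; rewrite /prop_for /continuous_at gk //.
  apply: cvg_trans ck; apply: near_eq_cvg.
  by apply: filterS (N _ Up) => q /gk ->.
split; last first.
  move=> p Up; rewrite /laplacian.
  by case: (d11 _ Up) => _ ->; case: (d22 _ Up) => _ ->; rewrite subrr.
split.
- move=> p Up; split.
  + by case: (dh _ Up) => [[]].
  + by case: (dh _ Up) => [_ []].
  + by apply: cn D1 _ => //; case: (cK _ Up).
  + by apply: cn D2 _ => //; apply: cvgN; case: (cK _ Up).
- move=> p Up; split.
  + by case: (d11 _ Up).
  + by case: (d12 _ Up).
  + apply: (cn _ _ _ Up (fun q Uq => @derive_val _ _ _ _ _ _ _ (d11 q Uq))).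
    by case: (cK' _ Up).
  + apply: (cn _ _ _ Up (fun q Uq => @derive_val _ _ _ _ _ _ _ (d12 q Uq))).
    by apply: cvgN; case: (cK' _ Up).
- move=> p Up; split.
  + by case: (d21 _ Up).
  + by case: (d22 _ Up).
  + apply: (cn _ _ _ Up (fun q Uq => @derive_val _ _ _ _ _ _ _ (d21 q Uq))).
    by apply: cvgN; case: (cK' _ Up).
  + apply: (cn _ _ _ Up (fun q Uq => @derive_val _ _ _ _ _ _ _ (d22 q Uq))).
    by apply: cvgN; case: (cK' _ Up).
Qed.

End ComplexValued.

(** * The principal square root *)

Section Sqrt.
Variable R : realType.
Local Notation C := R[i].
Local Notation Re := complex.Re.
Local Notation Im := complex.Im.
Local Open Scope complex_scope.
Implicit Types (f g : R * R -> C) (p v : R * R).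

Lemma Re_sqrtc (z : C) : Re (sqrtc z) = Num.sqrt ((Num.sqrt (normsq z) + Re z) / 2).
Proof. by case: z. Qed.

Lemma Re_sqrtc_ge0 (z : C) : 0 <= Re (sqrtc z).
Proof. by rewrite Re_sqrtc sqrtr_ge0. Qed.

Lemma sqrtc_ReIm (z : C) :
  Re z = Re (sqrtc z) ^+ 2 - Im (sqrtc z) ^+ 2 /\
  Im z = 2 * (Re (sqrtc z) * Im (sqrtc z)).
Proof.
by rewrite -[in LHS](sqr_sqrtc z) -[in X in _ /\ X = _](sqr_sqrtc z) expr2 ReM ImM;
   split; ring.
Qed.

Lemma sqrt_normsq (z : C) : Num.sqrt (normsq z) = normsq (sqrtc z).
Proof.
by rewrite -{1}(sqr_sqrtc z) expr2 normsqM -expr2 sqrtr_sqr ger0_norm ?normsq_ge0.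
Qed.

Lemma Im_sqrtc (z : C) : 0 < Re (sqrtc z) ->
  Im (sqrtc z) = Im z / (2 * Re (sqrtc z)).
Proof.
move=> h; rewrite (sqrtc_ReIm z).2; field.
by rewrite gt_eqF.
Qed.

(** The two square roots are opposite, so the sign of the real part selects
    one. *)
Lemma sqrtc_unique (z w : C) : 0 < Re w -> w ^+ 2 = z -> sqrtc z = w.
Proof.
move=> w0 wz; have /eqP : sqrtc z ^+ 2 = w ^+ 2 by rewrite sqr_sqrtc.
rewrite eqf_sqr => /orP[/eqP //|/eqP zw].
by have := Re_sqrtc_ge0 z; rewrite zw ReN oppr_ge0 leNgt w0.
Qed.

(** The principal root leaves the imaginary axis exactly off the branch cut
    along the nonpositive reals. *)
Lemma Re_sqrtc_gt0 (z : C) : (0 < Re (sqrtc z)) = ~~ ((Im z == 0) && (Re z <= 0)).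
Proof.
have [rz iz] := sqrtc_ReIm z.
rewrite lt_neqAle Re_sqrtc_ge0 andbT; congr negb; rewrite eq_sym.
apply/eqP/andP => [h|[/eqP h1 h2]].
  by rewrite rz iz h mul0r mulr0 expr0n sub0r oppr_le0 sqr_ge0.
apply/eqP/negPn/negP => h0.
move: iz; rewrite h1 => /esym/eqP; rewrite !mulf_eq0 pnatr_eq0 /= (negbTE h0) /=.
move=> /eqP h3; move: h2; rewrite rz h3 expr0n subr0 => h4.
by move: h0; rewrite -sqrf_eq0 eq_le h4 sqr_ge0.
Qed.

Lemma cvg_Re_sqrtc p f : ccont p f ->
  Re (sqrtc (f q)) @[q --> p] --> Re (sqrtc (f p)).
Proof.
move=> cf; rewrite Re_sqrtc; under eq_fun do rewrite Re_sqrtc.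
apply: (@cvg_comp _ _ _ _ (@Num.sqrt R)); last exact: sqrt_continuous.
apply: cvgM; last exact: cvg_cst.
apply: cvgD; last by case: cf.
apply: (@cvg_comp _ _ _ _ (@Num.sqrt R)); last exact: sqrt_continuous.
exact: ccont_normsq.
Qed.

Lemma near_Re_sqrtc_gt0 p f : ccont p f -> 0 < Re (sqrtc (f p)) ->
  \near p, 0 < Re (sqrtc (f p)).
Proof. by move=> cf h; exact: (cvgr_gt _ (cvg_Re_sqrtc cf) _ h). Qed.

Lemma ccont_sqrtc p f : ccont p f -> 0 < Re (sqrtc (f p)) ->
  ccont p (fun q => sqrtc (f q)).
Proof.
move=> cf h; split; first exact: cvg_Re_sqrtc.
rewrite Im_sqrtc //.
have N : \near p, Im (f p) / (2 * Re (sqrtc (f p))) = Im (sqrtc (f p)).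
  by apply: filterS (near_Re_sqrtc_gt0 cf h) => q /Im_sqrtc.
apply: cvg_trans; first exact: (near_eq_cvg N).
apply: cvgM; first by case: cf.
apply: cvgV; first by rewrite mulf_neq0 ?gt_eqF.
by apply: cvgM; [exact: cvg_cst|exact: cvg_Re_sqrtc].
Qed.

(** With [w = sqrt f] the real part is [sqrt ((|f| + Re f) / 2)], an explicit
    real function, and the imaginary part is [Im f / (2 Re w)]; differentiating
    both and expressing the result in [w] gives the real and imaginary parts of
    [f' / (2 w)]. *)
Lemma cderive_sqrtc p v f a : ccont p f -> 0 < Re (sqrtc (f p)) ->
  cderive p v f a -> cderive p v (fun q => sqrtc (f q)) (a / (2 * sqrtc (f p))).
Proof.
move=> cf h df; have [fr fi] := df.
have h0 : Re (sqrtc (f p)) != 0 by rewrite gt_eqF.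
have [rz iz] := sqrtc_ReIm (f p).
set w := sqrtc (f p) in h h0 rz iz *.
have n0 : 0 < normsq w by rewrite /normsq ltr_pwDl ?sqr_ge0 // exprn_gt0.
have nf0 : 0 < normsq (f p).
  by rewrite -(sqr_sqrtc (f p)) expr2 normsqM mulr_gt0.
have n0' : normsq w != 0 by rewrite gt_eqF.
have da : Re (a / (2 * w)) = (Re w * Re a + Im w * Im a) / (2 * normsq w) /\
          Im (a / (2 * w)) = (Re w * Im a - Im w * Re a) / (2 * normsq w).
  have -> : (2 : C) = 2%:C by apply: eqC => /=; ring.
  rewrite !(ReImE, ReV, ImV, normsqM) /=.
  have -> : normsq (2%:C) = 4 :> R by rewrite /normsq /=; ring.
  by split; field.
have D1 : is_derive p v (fun q => Re (sqrtc (f q))) (Re (a / (2 * w))).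
  have dn := @is_derive_comp1 _ _ (fun q => normsq (f q)) _ _ _ _ _
    (is_derive1_sqrt nf0) (is_derive_normsq df).
  have s0 : 0 < (Num.sqrt (normsq (f p)) + Re (f p)) / 2.
    by rewrite -sqrtr_gt0 -Re_sqrtc.
  pose k (q : R * R) : R := (Num.sqrt (normsq (f q)) + Re (f q)) / 2.
  have dk : is_derive p v k ((Re w * Re a + Im w * Im a) * Re w / normsq w).
    have dE := is_deriveM (is_deriveD dn fr) (is_derive_cst (2^-1 : R) p v).
    apply: is_derive_ext dE.
      by [].
    rewrite /GRing.scale/= sqrt_normsq -/w rz iz /cst.
    move: n0'; rewrite /normsq => n0'; field; exact: n0'.
  apply: is_derive_ext (@is_derive_comp1 _ _ k _ _ _ _ _ (is_derive1_sqrt s0) dk).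
    by move=> q; rewrite /= Re_sqrtc.
  by rewrite -Re_sqrtc -/w da.1; field; exact/andP.
split => //.
have N : \near p, Im (f p) / (2 * Re (sqrtc (f p))) = Im (sqrtc (f p)).
  by apply: filterS (near_Re_sqrtc_gt0 cf h) => q /Im_sqrtc.
apply: near_eq_is_derive N _.
have dV := @is_derive_inv _ _ (fun q => Re (sqrtc (f q))) _ _ _ h0 D1.
have D2 := is_deriveM (is_deriveM fi (is_derive_cst (2^-1 : R) p v)) dV.
apply: is_derive_ext D2; first by move=> q; rewrite invfM -mulrA.
rewrite /GRing.scale/= !fctE /= -/w da.1 da.2 iz.
move: n0'; rewrite /normsq => n0'; field; exact/andP.
Qed.

Lemma hol_sqrtc p f a : ccont p f -> 0 < Re (sqrtc (f p)) ->
  hol p f a -> hol p (fun q => sqrtc (f q)) (a / (2 * sqrtc (f p))).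
Proof.
by move=> cf h [d1 d2]; split; rewrite ?mulrA; exact: cderive_sqrtc.
Qed.

(** The continuity of the function and of its derivative travels with
    holomorphy, since harmonicity asks for continuous second derivatives. *)
Definition hol_on (U : set (R * R)) f df :=
  forall p, U p -> [/\ hol p f (df p), ccont p f & ccont p df].

Lemma hol_on_cst U (c : C) : hol_on U (cst c) (cst 0).
Proof. by move=> p _; split; [exact: hol_cst|exact: ccont_cst..]. Qed.

Lemma hol_on_toC U : hol_on U (@toC R) (cst 1).
Proof. by move=> p _; split; [exact: hol_toC|exact: ccont_toC|exact: ccont_cst]. Qed.

Lemma hol_onD U f g df dg : hol_on U f df -> hol_on U g dg ->
  hol_on U (fun q => f q + g q) (fun q => df q + dg q).
Proof.
move=> hf hg p Up; have [? ? ?] := hf _ Up; have [? ? ?] := hg _ Up.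
by split; [exact: holD|exact: ccontD..].
Qed.

Lemma hol_onN U f df : hol_on U f df -> hol_on U (fun q => - f q) (fun q => - df q).
Proof.
move=> hf p Up; have [? ? ?] := hf _ Up.
by split; [exact: holN|exact: ccontN..].
Qed.

Lemma hol_onM U f g df dg : hol_on U f df -> hol_on U g dg ->
  hol_on U (fun q => f q * g q) (fun q => f q * dg q + df q * g q).
Proof.
move=> hf hg p Up; have [? ? ?] := hf _ Up; have [? ? ?] := hg _ Up.
by split; [exact: holM|exact: ccontM|by apply: ccontD; exact: ccontM].
Qed.

Lemma hol_onV U f df : (forall p, U p -> f p != 0) -> hol_on U f df ->
  hol_on U (fun q => (f q)^-1) (fun q => - df q / f q ^+ 2).
Proof.
move=> f0 hf p Up; have [? ? ?] := hf _ Up; have ? := f0 _ Up.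
split; [exact: holV|exact: ccontV|apply: ccontM; first exact: ccontN].
by apply: ccontV; rewrite ?expf_neq0 //; apply: ccontM.
Qed.

Lemma hol_on_sqrtc U f df : (forall p, U p -> 0 < Re (sqrtc (f p))) -> hol_on U f df ->
  hol_on U (fun q => sqrtc (f q)) (fun q => df q / (2 * sqrtc (f q))).
Proof.
move=> f0 hf p Up; have [? ? ?] := hf _ Up; have h := f0 _ Up.
split; [exact: hol_sqrtc|exact: ccont_sqrtc|apply: ccontM => //].
apply: ccontV.
  rewrite mulf_neq0 ?pnatr_eq0 //; apply/eqP => E.
  by move: h; rewrite E ltxx.
by apply: ccontM; [exact: ccont_cst|exact: ccont_sqrtc].
Qed.

End Sqrt.

(** * The closed form of the harmonic measure *)

Section Omega.
Variable R : realType.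
Local Notation C := R[i].
Local Notation Re := complex.Re.
Local Notation Im := complex.Im.
Local Open Scope complex_scope.
Implicit Types (f g : R * R -> C) (p v : R * R).

(** In the coordinate [a = 1/z] on the sphere the slit [[-1, 1]] becomes the set
    of real [a] with [|a| >= 1], which is where [1 - a^2] meets the branch cut
    of the square root: the domain is [0 < Re (rt a)]. *)
Definition rt (z : C) : C := sqrtc (1 - z * z).

(** With [1/z = cosh (u + i v)] this is [(x cosh u - cos v) cosh u |z|^2]; the
    factor [cosh u |z|^2] is shared with the denominator in [omega]. *)
Definition omega_num (x : R) (z : C) : R := (Re (rt z) ^+ 2 + Re z ^+ 2) * x - Re z.

(** The harmonic measure of [[-1, x]] at the point with coordinate [z = 1/zeta].
    Under the Joukowski map [zeta = (b + 1/b) / 2] the exterior of the slit is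
    the unit disc and [[-1, x]] is an arc symmetric about -1; its harmonic
    measure is the angle under which the arc is seen, suitably normalised, and
    the arctangent below is that angle written in terms of [z] alone. *)
Definition omega (x : R) (z : C) : R :=
  2^-1 + atan (omega_num x z / (Re (rt z) * Num.sqrt (1 - x ^+ 2))) / pi.

(** These are the imaginary and real parts of [rt z ^+ 2 + z ^+ 2 = 1]; the
    algebraic identities below are reduced modulo the two of them. *)
Lemma rt_ReIm (z : C) :
  Re (rt z) * Im (rt z) + Re z * Im z = 0 /\
  Re (rt z) ^+ 2 - Im (rt z) ^+ 2 - 1 + Re z ^+ 2 - Im z ^+ 2 = 0.
Proof.
have := sqrtc_ReIm (1 - z * z); rewrite -/(rt z) !ReImE => -[h1 h2].
split; last by move: h1 => /=; lra.
by move: h2 => /=; lra.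
Qed.

(** Turns the denominator [1 + (.)^2] of the derivative of the arctangent into a
    product in which [|1 - x z|^2] is visible, as holomorphy of the gradient
    requires. *)
Lemma omega_num_normsq (x : R) (z : C) : 
  omega_num x z ^+ 2 + (1 - x ^+ 2) * Re (rt z) ^+ 2 =
  (Re (rt z) ^+ 2 + Re z ^+ 2) * normsq (1 - x%:C * z).
Proof.
have [r1 r2] := rt_ReIm z; rewrite /omega_num /normsq !ReImE /=.
move: r1 r2; set t := Re (rt z); set u := Im (rt z); set a := Re z; set b := Im z.
move=> r1 r2; apply/eqP; rewrite -subr_eq0; apply/eqP.
transitivity (x ^+ 2 * (t ^+ 2 * (t ^+ 2 - u ^+ 2 - 1 + a ^+ 2 - b ^+ 2)
   + (t * u - a * b) * (t * u + a * b))); first by ring.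
by rewrite r1 r2; ring.
Qed.

Lemma omega_num_gt0 (x : R) (z : C) : -1 < x < 1 -> 0 < Re (rt z) ->
  0 < omega_num x z ^+ 2 + (1 - x ^+ 2) * Re (rt z) ^+ 2.
Proof.
move=> hx h; rewrite ltr_wpDl ?sqr_ge0 // mulr_gt0 ?exprn_gt0 //.
by nra.
Qed.

Lemma oneMxz_neq0 (x : R) (z : C) : -1 < x < 1 -> 0 < Re (rt z) ->
  1 - x%:C * z != 0.
Proof.
move=> hx h; rewrite -normsq_eq0; apply/eqP => E.
by have := omega_num_gt0 hx h; rewrite omega_num_normsq E mulr0 ltxx.
Qed.

Lemma cderive_rt p v f a : ccont p f -> 0 < Re (rt (f p)) -> cderive p v f a ->
  cderive p v (fun q => rt (f q)) (- (f p * a) / rt (f p)).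
Proof.
move=> cf h df.
have c2 : ccont p (fun q => 1 - f q * f q).
  by apply: (ccontD (ccont_cst p 1)); apply: ccontN; apply: ccontM.
have d2 : cderive p v (fun q => 1 - f q * f q) (0 - (f p * a + a * f p)).
  by apply: (cderiveD (cderive_cst p v 1)); apply: cderiveN; apply: cderiveM.
have := cderive_sqrtc c2 h d2; rewrite -/(rt (f p)).
have -> : (0 - (f p * a + a * f p)) / (2 * rt (f p)) = - (f p * a) / rt (f p).
  have r0 : rt (f p) != 0 by apply/eqP => E; move: h; rewrite E ltxx.
  by field.
by [].
Qed.

Lemma Re_div (y w : C) : Re (y / w) = Re (y * w^*) / normsq w.
Proof.
by case: y => a b; case: w => c d; rewrite ReM ReV ImV /=; ring.
Qed.

(** The derivative of [omega x] along any curve is the real part of a fixed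
    holomorphic function times the velocity, that is [d omega = - sqrt (1 - x^2)
    / pi * Re (dz / ((1 - x z) rt z))]. *)
Lemma is_derive_omega (x : R) p v f a : -1 < x < 1 ->
  ccont p f -> 0 < Re (rt (f p)) -> cderive p v f a ->
  is_derive p v (fun q => omega x (f q))
    (- (Num.sqrt (1 - x ^+ 2) / pi) * Re (a / ((1 - x%:C * f p) * rt (f p)))).
Proof.
move=> hx cf h df.
have s0 : 0 < Num.sqrt (1 - x ^+ 2) by rewrite sqrtr_gt0; nra.
set s := Num.sqrt _ in s0 *.
have sE : s ^+ 2 = 1 - x ^+ 2 by rewrite sqr_sqrtr //; nra.
have [dr _] := cderive_rt cf h df.
have [da _] := df.
set w := rt (f p) in h dr *.
have w0 : w != 0 by apply/eqP => E; move: h; rewrite E ltxx.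
have nw : 0 < normsq w by rewrite normsq_gt0.
have n1 : 0 < normsq (1 - x%:C * f p) by rewrite normsq_gt0; exact: oneMxz_neq0.
have t0 : Re w != 0 by rewrite gt_eqF.
have s0' : s != 0 by rewrite gt_eqF.
have dP : is_derive p v (fun q => omega_num x (f q))
  (2 * (Re w * Re (- (f p * a) / w) + Re (f p) * Re a) * x - Re a).
  have D := is_deriveB (is_deriveM (is_deriveD (is_deriveM dr dr)
    (is_deriveM da da)) (is_derive_cst x p v)) da.
  apply: is_derive_ext D; first by move=> q; rewrite /omega_num !expr2.
  by rewrite /GRing.scale/= /cst -/w; ring.
have t0' : Re (rt (f p)) != 0 by [].
have dV := @is_derive_inv _ _ (fun q => Re (rt (f q))) _ _ _ t0' dr.
have dQ : is_derive p v (fun q => omega_num x (f q) / (Re (rt (f q)) * s))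
  (((2 * (Re w * Re (- (f p * a) / w) + Re (f p) * Re a) * x - Re a) * Re w
    - omega_num x (f p) * Re (- (f p * a) / w)) / (Re w ^+ 2 * s)).
  have D := is_deriveM (is_deriveM dP dV) (is_derive_cst (s^-1) p v).
  apply: is_derive_ext D; first by move=> q; rewrite invfM mulrA.
  rewrite /GRing.scale/= !fctE /= -/w; field; by apply/andP; split.
have datan := is_derive1_atan (omega_num x (f p) / (Re (rt (f p)) * s)).
have D := is_deriveD (is_derive_cst (2^-1 : R) p v)
  (is_deriveM (@is_derive_comp1 _ _ (fun q => omega_num x (f q) / (Re (rt (f q)) * s))
   _ _ _ _ _ datan dQ) (is_derive_cst (pi^-1 : R) p v)).
apply: is_derive_ext D; first by [].
have pi0 : (pi : R) != 0 by rewrite gt_eqF ?pi_gt0.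
rewrite /GRing.scale/= ?fctE /= -/w.
set k := Re (- (f p * a) / w).
have kE : k * normsq w = - Re (f p * a * w^*).
  by rewrite /k Re_div divfK ?gt_eqF // mulNr ReN.
rewrite (Re_div a) normsqM.
have N : omega_num x (f p) ^+ 2 + s ^+ 2 * Re w ^+ 2 =
  (Re w ^+ 2 + Re (f p) ^+ 2) * normsq (1 - x%:C * f p).
  by rewrite sE omega_num_normsq.
have G0 : Re w ^+ 2 + Re (f p) ^+ 2 != 0.
  by rewrite gt_eqF // ltr_pwDl ?sqr_ge0 ?exprn_gt0.
have M : ((2 * (Re w * k + Re (f p) * Re a) * x - Re a) * Re w
    - omega_num x (f p) * k) * normsq w =
   - (Re w ^+ 2 + Re (f p) ^+ 2) * Re (a * ((1 - x%:C * f p) * w)^*).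
  rewrite mulrBl -(mulrA _ k) kE.
  have -> : (2 * (Re w * k + Re (f p) * Re a) * x - Re a) * Re w * normsq w
    = (2 * (Re w * (k * normsq w) + Re (f p) * Re a * normsq w) * x
       - Re a * normsq w) * Re w by ring.
  rewrite kE /omega_num -/w.
  have [r1 _] := rt_ReIm (f p); rewrite -/w in r1.
  move: r1; case: (w) => t u; case: (f p) => z y; clear.
  case: a => a b /= r1; rewrite /normsq /=.
  apply/eqP; rewrite -subr_eq0; apply/eqP.
  transitivity ((t * u + z * y) *
     (- a * u + b * t + x * (2 * a * z * u - 2 * b * z * t))); first by ring.
  by rewrite r1 mul0r.
have -> : (1 + (omega_num x (f p) / (Re w * s)) ^+ 2)^-1 =
   (Re w * s) ^+ 2 / (omega_num x (f p) ^+ 2 + s ^+ 2 * Re w ^+ 2).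
  have N0 : omega_num x (f p) ^+ 2 + s ^+ 2 * Re w ^+ 2 != 0.
    by rewrite N mulf_neq0 // gt_eqF.
  by field; apply/and3P; split => //; rewrite exprMn.
rewrite N; set E := _ - omega_num x (f p) * k in M *.
have -> : E = - (Re w ^+ 2 + Re (f p) ^+ 2) * Re (a * ((1 - x%:C * f p) * w)^*)
   / normsq w.
  by rewrite -M mulfK // gt_eqF.
have nw0 : normsq w != 0 by rewrite gt_eqF.
have n10 : normsq (1 - x%:C * f p) != 0 by rewrite gt_eqF.
set P := pi in pi0 *; clearbody P; field.
by do ?[apply/andP; split].
Qed.

End Omega.

Section Harmonicity.
Variable R : realType.
Local Notation C := R[i].
Local Notation Re := complex.Re.
Local Notation Im := complex.Im.
Local Open Scope complex_scope.
Implicit Types (f g Z dZ : R * R -> C) (p v : R * R) (U : set (R * R)).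

Lemma hol_on_rt U f df : (forall p, U p -> 0 < Re (rt (f p))) -> hol_on U f df ->
  exists dT, hol_on U (fun q => rt (f q)) dT.
Proof.
move=> f0 hf; have h := hol_onD (@hol_on_cst _ U 1) (hol_onN (hol_onM hf hf)).
by eexists; exact: (hol_on_sqrtc f0 h).
Qed.

Lemma rt_neq0 (z : C) : 0 < Re (rt z) -> rt z != 0.
Proof. by move=> h; apply/eqP => E; move: h; rewrite E ltxx. Qed.

Lemma harmonic_omega U Z dZ ddZ (x : R) : -1 < x < 1 -> open U ->
  (forall p, U p -> 0 < Re (rt (Z p))) ->
  hol_on U Z dZ -> hol_on U dZ ddZ ->
  plane_harmonic U (fun q => omega x (Z q)).
Proof.
move=> hx oU Z0 hZ hdZ.
have [dT hT] := hol_on_rt Z0 hZ.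
pose D q := (1 - x%:C * Z q) * rt (Z q).
have hD := hol_onM (hol_onD (@hol_on_cst _ U 1)
  (hol_onN (hol_onM (@hol_on_cst _ U x%:C) hZ))) hT.
have D0 p : U p -> D p != 0.
  by move=> Up; rewrite mulf_neq0 ?rt_neq0 ?oneMxz_neq0 //; exact: Z0.
pose c : C := (- (Num.sqrt (1 - x ^+ 2) / pi))%:C.
have hK := hol_onM (@hol_on_cst _ U c) (hol_onM hdZ (hol_onV D0 hD)).
apply: (@hol_plane_harmonic _ _ _ (fun q => c * (dZ q / D q)) _ oU).
- move=> p Up; have [[h1 h2] cz _] := hZ _ Up.
  have := is_derive_omega hx cz (Z0 _ Up) h1.
  have := is_derive_omega hx cz (Z0 _ Up) h2.
  rewrite -/(D p) -mulrA Re_iM.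
  by rewrite [Im (c * _)]ImM [Re (c * _)]ReM ImC ReC !mul0r subr0 addr0 mulrN; split.
- by move=> p Up; case: (hK _ Up) => H _ _; exact: H.
- by move=> p Up; case: (hK _ Up) => _ H _; exact: H.
- by move=> p Up; case: (hK _ Up) => _ _ H; exact: H.
Qed.

Lemma is_derive_ln_normsq p v f a : f p != 0 -> cderive p v f a ->
  is_derive p v (fun q => ln (normsq (f q))) (2 * Re (a / f p)).
Proof.
move=> f0 df; have n0 : 0 < normsq (f p) by rewrite normsq_gt0.
have := @is_derive_comp1 _ _ (fun q => normsq (f q)) _ _ _ _ _
  (is_derive1_ln n0) (is_derive_normsq df).
apply: is_derive_ext => //; rewrite Re_div.
by case: (f p) => y1 y2; case: a {df} => a1 a2 /=; ring.
Qed.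

(** The gradient of [ln |f|^2] is that of [2 Re (log f)], whose derivative
    [2 f' / f] is single-valued even though [log f] need not be. *)
Lemma harmonic_ln_normsq U f df ddf : open U -> (forall p, U p -> f p != 0) ->
  hol_on U f df -> hol_on U df ddf -> plane_harmonic U (fun q => ln (normsq (f q))).
Proof.
move=> oU f0 hf hdf.
have hK := hol_onM (@hol_on_cst _ U 2%:C) (hol_onM hdf (hol_onV f0 hf)).
apply: (@hol_plane_harmonic _ _ _ (fun q => 2%:C * (df q / f q)) _ oU).
- move=> p Up; have [[h1 h2] cz _] := hf _ Up; have fp := f0 _ Up.
  have := is_derive_ln_normsq fp h1; have := is_derive_ln_normsq fp h2.
  rewrite -mulrA Re_iM [Im (_ * (df p / _))]ImM [Re (_ * (df p / _))]ReM.
  by rewrite ImC ReC !mul0r subr0 addr0 mulrN; split.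
- by move=> p Up; case: (hK _ Up) => H _ _; exact: H.
- by move=> p Up; case: (hK _ Up) => _ H _; exact: H.
- by move=> p Up; case: (hK _ Up) => _ _ H; exact: H.
Qed.

Lemma rt_normsq_sum (z : C) :
  Re (rt z) ^+ 2 + Re z ^+ 2 = 1 + Im (rt z) ^+ 2 + Im z ^+ 2.
Proof. by have [_ r2] := rt_ReIm z; lra. Qed.

(** The quotient [rt z / (1 - x z)] stays in the right half plane: this makes
    the logarithm of [1 + rt z / (1 - x z)] harmonic and nonnegative. *)
Lemma Re_rt_div (x : R) (z : C) : -1 <= x <= 1 -> 0 < Re (rt z) ->
  0 < Re (rt z * (1 - x%:C * z)^*).
Proof.
move=> hx h; have G := rt_normsq_sum z; have [r1 r2] := rt_ReIm z.
have GG : Re z * x < Re (rt z) ^+ 2 + Re z ^+ 2.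
  have x2 : x ^+ 2 <= 1 by nra.
  have t2 : 0 < Re (rt z) ^+ 2 by rewrite exprn_gt0.
  have := sqr_ge0 (Im (rt z)); have := sqr_ge0 (Im z).
  by have := sqr_ge0 (Re z - x); nra.
have G0 : 0 < Re (rt z) ^+ 2 + Re z ^+ 2.
  by rewrite ltr_pwDl ?sqr_ge0 ?exprn_gt0.
rewrite -(pmulr_rgt0 _ h) -(pmulr_rgt0 _ G0).
suff -> : (Re (rt z) ^+ 2 + Re z ^+ 2) * (Re (rt z) * Re (rt z * (1 - x%:C * z)^*)) =
  Re (rt z) ^+ 2 * (Re (rt z) ^+ 2 + Re z ^+ 2 - Re z * x).
  by rewrite mulr_gt0 ?exprn_gt0 ?subr_gt0.
move: r1 r2 {h G GG G0}; case: (rt z) => t u; case: z => a b /= r1 r2.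
apply/eqP; rewrite -subr_eq0; apply/eqP.
transitivity (- x * (a * t ^+ 2 * (t ^+ 2 - u ^+ 2 - 1 + a ^+ 2 - b ^+ 2)
  + (a * (t * u - a * b) + (t ^+ 2 + a ^+ 2) * b) * (t * u + a * b))).
  by ring.
by rewrite r1 r2; ring.
Qed.

End Harmonicity.

(** * Topology of the complex plane and of the sphere *)

Section PlaneTopology.
Variable R : realType.
Local Notation C := (Cplx R).
Local Notation Re := complex.Re.
Local Notation Im := complex.Im.
Local Notation normc := ComplexField.Normc.normc.
Local Notation sphere := (riemann_sphere R).
Local Open Scope complex_scope.
Implicit Types (z w : C) (p q : R * R).

Definition toR (z : R[i]) : R * R := (Re z, Im z).

Lemma toRK : cancel toR (@toC R). Proof. by case. Qed.
Lemma toCK : cancel (@toC R) toR. Proof. by case. Qed.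

Lemma normcE (z : R[i]) : normc z = Num.sqrt (normsq z).
Proof. by case: z. Qed.

Lemma normc_ge0 (z : R[i]) : 0 <= normc z.
Proof. by rewrite normcE sqrtr_ge0. Qed.

Lemma sqr_normc (z : R[i]) : normc z ^+ 2 = normsq z.
Proof. by rewrite normcE sqr_sqrtr // normsq_ge0. Qed.

Lemma normrE (z : C) : `|z| = (normc z)%:C.
Proof. by rewrite normc_def; case: z. Qed.

Lemma ReIm_le_normc (z : R[i]) : `|Re z| <= normc z /\ `|Im z| <= normc z.
Proof.
rewrite normcE -!sqrtr_sqr !ler_wsqrtr //.
  by rewrite /normsq lerDr sqr_ge0.
by rewrite /normsq lerDl sqr_ge0.
Qed.

Lemma normc_le_ReIm (z : R[i]) : normc z <= `|Re z| + `|Im z|.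
Proof.
rewrite -(@ler_pXn2r _ 2) ?nnegrE ?normc_ge0 ?addr_ge0 //.
rewrite sqr_normc /normsq -(real_normK (num_real (Re z))).
rewrite -(real_normK (num_real (Im z))).
have := normr_ge0 (Re z); have := normr_ge0 (Im z); nra.
Qed.

(** The topology of [Cplx R] comes from a norm with values in [Cplx R] itself;
    this reduces it to real radii. *)
Lemma nbhs_CplxP z (A : set C) :
  nbhs z A <-> exists2 e : R, 0 < e & forall w, normc (z - w) < e -> A w.
Proof.
split.
  move=> /nbhs_ballP[e e0 eA]; exists (Re e).
    by move: e0; rewrite /= ltcE => /andP[].
  move=> w zw; apply: eA; rewrite -ball_normE /ball_ /= normrE.
  by move: e0; rewrite /= !ltcE /= => /andP[/eqP -> _]; rewrite zw eqxx.
move=> [e e0 eA]; apply/nbhs_ballP; exists e%:C; first by rewrite /= ltcR.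
by move=> w; rewrite -ball_normE /ball_ /= normrE ltcR; exact: eA.
Qed.

Lemma nbhs_RRP p (A : set (R * R)) :
  nbhs p A <-> exists2 e : R, 0 < e &
    forall q, `|p.1 - q.1| < e -> `|p.2 - q.2| < e -> A q.
Proof.
split.
  move=> /nbhs_ballP[e e0 eA]; exists e => // q h1 h2; apply: eA.
  by split; rewrite -ball_normE.
move=> [e e0 eA]; apply/nbhs_ballP; exists e => //= q [h1 h2].
by apply: eA; [move: h1|move: h2]; rewrite -ball_normE.
Qed.

Lemma nbhs_toC z (A : set C) : nbhs z A <-> nbhs (toR z) (@toC R @^-1` A).
Proof.
split.
  move=> /nbhs_CplxP[e e0 eA]; apply/nbhs_RRP; exists (e / 2).
    by rewrite divr_gt0.
  move=> q h1 h2; apply: eA; apply: le_lt_trans (normc_le_ReIm _) _.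
  move: h1 h2; rewrite ReD ImD ReN ImN /= => h1 h2.
  by rewrite [ltRHS](splitr e) ltrD.
move=> /nbhs_RRP[e e0 eA]; apply/nbhs_CplxP; exists e => // w zw.
rewrite -(toRK w); apply: eA => /=; rewrite -?ReN -?ImN -?ReD -?ImD.
  exact: le_lt_trans (ReIm_le_normc _).1 zw.
exact: le_lt_trans (ReIm_le_normc _).2 zw.
Qed.

Lemma nbhs_Some z (A : set sphere) :
  nbhs (Some z : sphere) A <-> nbhs (toR z) (@chart0 R @^-1` A).
Proof. exact: (nbhs_toC z (Some @^-1` A)). Qed.

Lemma continuous_toC : continuous (@toC R : R * R -> C).
Proof. by move=> p A /nbhs_toC; rewrite toCK. Qed.

(** The coordinate [1/z] of a point of the sphere; at 0, which is a point of the
    slit, it has the default value 0. *)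
Definition pinv (p : sphere) : C := if p is Some z then z^-1 else 0.

Lemma sphere_invK : cancel (@sphere_inv R) pinv.
Proof.
by move=> z; rewrite /sphere_inv; case: eqVneq => [->|z0] //=; rewrite invrK.
Qed.

Lemma pinvK (p : sphere) : p <> Some 0 -> sphere_inv (pinv p) = p.
Proof.
case: p => [z|] /= h; rewrite /sphere_inv ?eqxx // invr_eq0.
by case: eqVneq h => [->|z0 _] //; rewrite invrK.
Qed.

Lemma compact_box (M : R) : compact (@toC R @` (`[- M, M] `*` `[- M, M]) : set C).
Proof.
apply: continuous_compact; first exact/continuous_subspaceT/continuous_toC.
by apply: compact_setX; exact: segment_compact.
Qed.

Lemma closed_compact (A : set C) : compact A -> closed A.
Proof. by apply: compact_closed; exact: norm_hausdorff. Qed.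

(** The chart [1/z] is open. At the point at infinity the complement of a
    neighbourhood has to contain the complement of a compact set, for which a
    closed box serves. *)
Lemma nbhs_sphere_inv z (A : set sphere) :
  nbhs (toR z) (@chartoo R @^-1` A) -> nbhs (sphere_inv z) A.
Proof.
rewrite /sphere_inv; case: eqVneq => [->|z0].
  move=> /nbhs_RRP[e e0 eA].
  exists (@toC R @` (`[- (2 / e), 2 / e] `*` `[- (2 / e), 2 / e])).
    by split; [|apply: closed_compact]; exact: compact_box.
  move=> p [[w Aw <-]|->]; last first.
    have := eA (0, 0); rewrite /= subrr normr0 => /(_ e0 e0).
    by rewrite /chartoo /sphere_inv /= eqxx.
  have w0 : w != 0.
    apply/eqP => w0; apply: Aw; exists (toR w); rewrite ?toRK // w0 /=.
    have d0 : 0 <= 2 / e by rewrite divr_ge0 // ltW.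
    by split => /=; rewrite in_itv /= oppr_le0 d0.
  have nw : 2 / e < normc w.
    rewrite ltNge; apply/negP => nw; apply: Aw; exists (toR w); rewrite ?toRK //.
    have [h1 h2] := ReIm_le_normc w.
    split => /=; rewrite in_itv /= -ler_norml.
      exact: le_trans nw.
    exact: le_trans nw.
  have nw0 : 0 < normc w by apply: lt_trans nw; rewrite divr_gt0.
  have ni : normc w^-1 < e.
    rewrite ComplexField.Normc.normcV invf_plt ?posrE //.
    apply: lt_trans nw; rewrite -[ltLHS]mul1r ltr_pM2r ?invr_gt0 //.
    by rewrite ltr1n.
  have [h1 h2] := ReIm_le_normc w^-1.
  have := eA (toR w^-1); rewrite /= !sub0r !normrN.
  move=> /(_ (le_lt_trans h1 ni) (le_lt_trans h2 ni)).
  by rewrite /chartoo -/(toC _) toRK /sphere_inv invr_eq0 (negbTE w0) invrK.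
move=> h.
have {h} : nbhs (z : C) (fun w : C => A (sphere_inv w)).
  by apply/nbhs_toC; exact: h.
have zi0 : z^-1 != 0 by rewrite invr_eq0.
rewrite -{1}(invrK z) => /(inv_continuous zi0) h.
have n0 : \forall w \near (z^-1 : C), w != 0.
  by apply: (@cvgr_neq0 _ _ _ (nbhs (z^-1 : C)) _ id z^-1) => //; exact: cvg_id.
change (nbhs (z^-1 : C) (fun w : C => A (Some w))).
have {}h : \forall w \near (z^-1 : C), A (sphere_inv w^-1) by exact: h.
near=> w.
have w0 : w != 0 by near: w.
have h1 : A (sphere_inv w^-1) by near: w.
by move: h1; rewrite /sphere_inv invr_eq0 (negbTE w0) invrK.
Unshelve. all: by end_near. Qed.

End PlaneTopology.

(** * The complement of the slit *)

Section Slit.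
Variable R : realType.
Local Notation C := (Cplx R).
Local Notation Re := complex.Re.
Local Notation Im := complex.Im.
Local Notation normc := ComplexField.Normc.normc.
Local Notation sphere := (riemann_sphere R).
Local Notation B := (@slit_sphere R).
Local Open Scope complex_scope.
Implicit Types (z w : C) (p q : R * R) (s : sphere).

Lemma segmentP (a b : R) s :
  segment a b s <-> exists2 r, a <= r <= b & s = Some (r%:C : C).
Proof.
split.
  by move=> [r /= ab <-]; exists r => //; move: ab; rewrite in_itv.
by move=> [r ab ->]; exists r => //=; rewrite in_itv.
Qed.

(** [1/z] lies on the slit exactly when [z] is real with [|z| >= 1], that is
    when [1 - z^2] is a nonpositive real. *)
Lemma slit_sphere_inv z : B (sphere_inv z) <-> 0 < Re (rt z).
Proof.
rewrite Re_sqrtc_gt0 !ReImE /= sub0r oppr_eq0.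
split.
  move=> h; apply/negP => /andP[/eqP h1 h2]; apply: h; apply/segmentP.
  have im0 : Im z = 0.
    have /eqP : Re z * Im z = 0 by move: h1; lra.
    rewrite mulf_eq0 => /orP[/eqP r0|/eqP //].
    by have := sqr_ge0 (Im z); move: h2; rewrite r0; nra.
  rewrite im0 in h2.
  have a0 : Re z != 0 by apply/eqP => r0; move: h2; rewrite r0; lra.
  have zE : z = (Re z)%:C by apply: eqC.
  have z0 : z != 0 by rewrite zE; apply/eqP => -[/eqP]; rewrite (negbTE a0).
  exists (Re z)^-1.
    rewrite -ler_norml normfV invf_le1 ?normr_gt0 //.
    rewrite -(@ler_pXn2r _ 2) ?nnegrE // expr1n real_normK ?num_real //; nra.
  by rewrite /sphere_inv (negbTE z0) {1}zE; congr Some; rewrite -fmorphV.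
move=> /negP h /segmentP[r hr]; rewrite /sphere_inv; case: eqVneq => // z0 [zr].
have zE : z = (r^-1)%:C.
  by rewrite -[z]invrK (_ : z^-1 = r%:C) ?fmorphV //.
apply: h; rewrite zE /= mulr0 mul0r addr0 eqxx /= mul0r subr0.
have r0 : r != 0 by apply/eqP => r0; move: z0; rewrite zE r0 invr0 eqxx.
have r2 : 0 < r ^+ 2 by rewrite lt_neqAle sqr_ge0 eq_sym sqrf_eq0 r0.
rewrite subr_le0 -invfM -expr2 invf_ge1 //; nra.
Qed.

Lemma slit_pinv s : B s -> sphere_inv (pinv s) = s.
Proof.
move=> Bs; apply: pinvK => s0; apply: Bs; rewrite s0; apply/segmentP.
by exists 0; rewrite // oppr_le0 ler01.
Qed.

Lemma slit_rt s : B s -> 0 < Re (rt (pinv s)).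
Proof. by move=> Bs; apply/slit_sphere_inv; rewrite slit_pinv. Qed.

Lemma slit_chart0 p : B (chart0 p) -> toC p != 0 /\ 0 < Re (rt (toC p)^-1).
Proof.
move=> Bp; split; last exact: (slit_rt Bp).
apply/eqP => p0; apply: Bp; apply/segmentP; exists 0.
  by rewrite oppr_le0 ler01.
by rewrite /chart0 -/(toC p) p0.
Qed.

Lemma chart0_slit p : toC p != 0 -> 0 < Re (rt (toC p)^-1) -> B (chart0 p).
Proof.
move=> p0 /slit_sphere_inv; rewrite /sphere_inv invr_eq0 (negbTE p0).
by rewrite invrK.
Qed.

Lemma near_rt_gt0 p (f : R * R -> R[i]) : ccont p f -> 0 < Re (rt (f p)) ->
  \forall q \near p, 0 < Re (rt (f q)).
Proof.
move=> cf; have c2 : ccont p (fun q => 1 - f q * f q).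
  by apply: (ccontD (ccont_cst p 1)); apply: ccontN; apply: ccontM.
exact: (near_Re_sqrtc_gt0 c2).
Qed.

Lemma open_chartoo : open (@chartoo R @^-1` B).
Proof.
rewrite openE => p /= /slit_sphere_inv h.
have N := near_rt_gt0 (@ccont_toC _ p) h.
by apply: filterS N => q h'; apply/slit_sphere_inv.
Qed.

Lemma near_toC_neq0 p : toC p != 0 -> \forall q \near p, toC q != 0.
Proof.
rewrite -normsq_gt0 => h.
have N : \forall q \near p, 0 < normsq (toC q).
  exact: (cvgr_gt _ (ccont_normsq (@ccont_toC _ p)) _ h).
by apply: filterS N => q; rewrite normsq_gt0.
Qed.

Lemma open_chart0 : open (@chart0 R @^-1` B).
Proof.
rewrite openE => p /= /slit_chart0[p0 h].
have c : ccont p (fun q => (toC q)^-1) by apply: ccontV => //; exact: ccont_toC.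
have N1 := near_rt_gt0 c h; have N2 := near_toC_neq0 p0.
by apply: filterS2 N1 N2 => q h1 h2; exact: chart0_slit.
Qed.

Lemma nbhs_slit s : B s -> nbhs s B.
Proof.
move=> Bs; rewrite -(slit_pinv Bs); apply: nbhs_sphere_inv.
have := open_chartoo; rewrite openE => /(_ (toR (pinv s))); apply.
by rewrite /= /chartoo -/(toC _) toRK slit_pinv.
Qed.

Lemma near_slit_point (r : R) (A : set sphere) :
  nbhs (Some (r%:C : C) : sphere) A ->
  exists2 e : R, 0 < e & forall a b, `|r - a| < e -> `|b| < e ->
     A (Some (a +i* b : C)).
Proof.
move=> /nbhs_Some/nbhs_RRP[e e0 eA]; exists e => // a b h1 h2.
by apply: (eA (a, b)) => //=; rewrite sub0r normrN.
Qed.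

(** The slit has empty interior: every one of its points is approached
    vertically from outside. *)
Lemma frontier_slit s : frontier B s <-> segment (-1) 1 s.
Proof.
split; first by move=> [_ h]; apply: contrapT => Bs; exact: (h (nbhs_slit Bs)).
move=> sg; split; last by move=> /nbhs_singleton; exact.
move: sg => /segmentP[r hr ->] A /near_slit_point[e e0 eA].
exists (Some (r +i* (e / 2) : C)); split.
  move=> /segmentP[r' _ []] _ /eqP; rewrite mulf_eq0 (gt_eqF e0) /=.
  by rewrite invr_eq0 pnatr_eq0.
apply: eA; first by rewrite subrr normr0.
by rewrite gtr0_norm ?divr_gt0 // ltr_pdivrMr // ltr_pMr // ltr1n.
Qed.

Lemma relint_alpha (x r : R) : x <= 1 -> -1 <= r < x ->
  relative_interior (frontier B) (segment (-1) x) (Some (r%:C : C)).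
Proof.
move=> x1 /andP[r1 rx]; split.
  by apply/segmentP; exists r => //; rewrite r1 ltW.
apply/nbhs_Some/nbhs_RRP; exists (x - r); first by rewrite subr_gt0.
move=> q /= h _ /frontier_slit/segmentP[t ht [q1 q2]].
apply/segmentP; exists t; last by rewrite /chart0 q1 q2.
rewrite (andP ht).1 /= -q1; move: h; rewrite ltr_norml; lra.
Qed.

Lemma relint_compl (x r : R) : -1 <= x -> x < r <= 1 ->
  relative_interior (frontier B) (frontier B `\` segment (-1) x)
    (Some (r%:C : C)).
Proof.
move=> x1 /andP[xr r1]; split.
  split; first by apply/frontier_slit/segmentP; exists r => //; lra.
  by move=> /segmentP[t ht [rt]]; move: ht; rewrite -rt; lra.
apply/nbhs_Some/nbhs_RRP; exists (r - x); first by rewrite subr_gt0.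
move=> q /= h _ fq; split => //; move/frontier_slit/segmentP: fq => [t ht [q1 q2]].
move=> /segmentP[t' ht' [q1' _]].
move: h; rewrite ltr_norml q1' => h; lra.
Qed.

(** The endpoint [x] of [[-1, x]] is not in the relative interior, because the
    slit continues to its right; at [x = 1] it would be. *)
Lemma relint_alphaP (x : R) s : x < 1 -> 
  relative_interior (frontier B) (segment (-1) x) s ->
  exists2 r, -1 <= r < x & s = Some (r%:C : C).
Proof.
move=> x1 [/segmentP[r hr ->] N]; exists r => //.
rewrite (andP hr).1 lt_neqAle (andP hr).2 andbT /=; apply/eqP => rx; subst r.
have [e e0 eA] := near_slit_point N.
pose d := Num.min (e / 2) (1 - x).
have d0 : 0 < d by rewrite lt_min divr_gt0 //= subr_gt0.
have de : d < e.
  by rewrite gt_min ltr_pdivrMr // ltr_pMr // ltr1n.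
have dx : d <= 1 - x by rewrite ge_min lexx orbT.
have := eA (x + d) 0; rewrite normr0 opprD addrA subrr sub0r normrN gtr0_norm //.
move=> /(_ de e0) h.
have /h : frontier B (Some ((x + d)%:C : C)).
  by apply/frontier_slit/segmentP; exists (x + d) => //; lra.
by move=> /segmentP[t ht [xt]]; move: ht; rewrite -xt; lra.
Qed.

Lemma relint_complP (x : R) s :
  relative_interior (frontier B) (frontier B `\` segment (-1) x) s ->
  exists2 r, x < r <= 1 & -1 <= r /\ s = Some (r%:C : C).
Proof.
move=> [[/frontier_slit/segmentP[r hr ->] h] _]; exists r; last by split=> //; lra.
rewrite (andP hr).2 andbT ltNge; apply/negP => rx; apply: h; apply/segmentP.
by exists r => //; lra.
Qed.

End Slit.

(** * The second derivative test *)

Section SecondDerivativeTest.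
Variable R : realType.
Implicit Types (p q v : R * R) (U : set (R * R)).

Lemma near0P (P : R -> Prop) : (\forall t \near (0 : R), P t) ->
  exists2 e : R, 0 < e & forall t, `|t| < e -> P t.
Proof.
move=> /nbhs_ballP[e e0 eP]; exists e => // t te; apply: eP.
by rewrite -ball_normE /ball_ /= sub0r normrN.
Qed.

(** If the second derivative were positive, the first derivative, which vanishes
    at the maximum, would be positive on some [(0, h]], and the mean value
    theorem would make [f h] exceed [f 0]. *)
Lemma local_max_second (f f' : R -> R) (c : R) :
  (\forall t \near (0 : R), is_derive (t : R) 1 f (f' t)) ->
  is_derive (0 : R) 1 f' c ->
  (\forall t \near (0 : R), f t <= f 0) -> c <= 0.
Proof.
move=> /near0P[e1 e10 df] df' /near0P[e2 e20 fmax].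
pose e : R := Num.min e1 e2.
have e0 : 0 < e by rewrite lt_min e10.
have He (t : R) : `|t| < e -> `|t| < e1 /\ `|t| < e2 by rewrite lt_min => /andP[].
have f'0 : f' 0 = 0.
  have : is_derive (0 : R) 1 f 0.
    apply: (@derive1_at_max R f (- e) e 0).
    - by rewrite ge0_cp // ltW.
    - move=> t; rewrite in_itv /= -ltr_norml => /He[t1 _].
      by have [] := df t t1.
    - by rewrite in_itv /= oppr_lt0 e0.
    - by move=> t; rewrite in_itv /= -ltr_norml => /He[_ t2]; exact: fmax.
  have h0 : `|0 : R| < e1 by rewrite normr0.
  by move=> [_ D0]; case: (df 0 h0) => _ <-.
rewrite leNgt; apply/negP => c0.
have /cvgr_gt/(_ 0 c0) : h^-1 * (f' (h * 1 + 0) - f' 0) @[h --> (0 : R)^'] --> c.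
  by case: df' => d dE; rewrite -dE; exact: d.
rewrite /dnbhs near_withinE => /near0P[e3 e30 H].
pose h : R := Num.min e e3 / 2.
have m0 : 0 < Num.min e e3 by rewrite lt_min e0.
have h0 : 0 < h by rewrite divr_gt0.
have slit_measure : h < Num.min e e3 by rewrite ltr_pdivrMr // ltr_pMr // ltr1n.
have [he h3] : h < e /\ h < e3 by apply/andP; rewrite -lt_min.
have pos (t : R) : 0 < t -> t <= h -> 0 < f' t.
  move=> t0 th; have := H t; rewrite gtr0_norm // => /(_ (le_lt_trans th h3)).
  rewrite gt_eqF // => /(_ isT); rewrite f'0 subr0 addr0 mulr1.
  by rewrite pmulr_rgt0 // invr_gt0.
have [] := @MVT R f f' 0 h h0.
- move=> t; rewrite in_itv /= => /andP[t0 th]; apply: df.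
  by have [] := He t; rewrite gtr0_norm // (lt_trans th).
- apply: derivable_within_continuous => t; rewrite in_itv /= => /andP[t0 th].
  have [t1 _] : `|t| < e1 /\ `|t| < e2.
    by apply: He; rewrite ger0_norm // (le_lt_trans th).
  by have [] := df t t1.
move=> t; rewrite in_itv /= => /andP[t0 th] E.
have : f h <= f 0 by apply: fmax; have [] := He h; rewrite gtr0_norm.
rewrite -subr_le0 E subr0 leNgt mulr_gt0 //; exact: pos (ltW _).
Qed.

(** The first derivative is carried as a function [f1] defined near [p], so that
    the rules below can be chained without rewriting derivatives under
    binders. *)
Definition has_derive2 p v (f f1 : R * R -> R) (c : R) :=
  (\forall q \near p, is_derive q v f (f1 q)) /\ is_derive p v f1 c.

Lemma near_slice p v (P : R * R -> Prop) : (\forall q \near p, P q) ->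
  \forall t \near (0 : R), P (t *: v + p).
Proof.
move=> H; have S : t *: v + p @[t --> (0 : R)] --> (0 : R) *: v + p.
  by apply: cvgD; [exact: scalel_continuous|exact: cvg_cst].
by rewrite scale0r add0r in S; exact: S.
Qed.

Lemma has_derive2_max p v f f1 c : has_derive2 p v f f1 c ->
  (\forall q \near p, f q <= f p) -> c <= 0.
Proof.
move=> [/(near_slice v) df /is_derive_slice0 df1] /(near_slice v) fmax.
apply: (@local_max_second (fun t => f (t *: v + p)) (fun t => f1 (t *: v + p))) => //.
  by apply: filterS df => t; exact: (is_derive_slice _ _ _ _ _).1.
by rewrite scale0r add0r.
Qed.

Lemma has_derive2B p v f f1 c g g1 d :
  has_derive2 p v f f1 c -> has_derive2 p v g g1 d ->
  has_derive2 p v (fun q => f q - g q) (fun q => f1 q - g1 q) (c - d).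
Proof.
move=> [f_ f1_] [g_ g1_]; split; last exact: is_deriveB.
by apply: filterS2 f_ g_ => q a b; exact: is_deriveB.
Qed.

Lemma has_derive2Z p v f f1 c (k : R) : has_derive2 p v f f1 c ->
  has_derive2 p v (fun q => k * f q) (fun q => k * f1 q) (k * c).
Proof.
move=> [f_ f1_]; split; last exact: is_deriveZ.
by apply: filterS f_ => q a; exact: is_deriveZ.
Qed.

Lemma has_derive2_cst p v (k : R) : has_derive2 p v (cst k) (cst 0) 0.
Proof.
split; last exact: is_derive_cst.
by apply: filterE => q; exact: is_derive_cst.
Qed.

Lemma has_derive2_sq p v f f1 c : has_derive2 p v f f1 c ->
  has_derive2 p v (fun q => f q * f q) (fun q => 2 * (f q * f1 q))
    (2 * (f1 p ^+ 2 + f p * c)).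
Proof.
move=> [f_ f1_]; split.
  apply: filterS f_ => q a; apply: is_derive_ext (is_deriveM a a) => //.
  by rewrite /GRing.scale /=; ring.
have a := nbhs_singleton f_.
apply: is_derive_ext (is_deriveZ 2 (is_deriveM a f1_)) => //.
by rewrite /GRing.scale /=; ring.
Qed.

Lemma harmonic_has_derive2 U f p : open U -> plane_harmonic U f -> U p ->
  has_derive2 p (e1 R) f ('D_(e1 R) f) ('D_(e1 R) ('D_(e1 R) f) p) /\
  has_derive2 p (e2 R) f ('D_(e2 R) f) ('D_(e2 R) ('D_(e2 R) f) p).
Proof.
move=> oU [[c0 c1 c2] _] Up.
have N : \forall q \near p, U q by apply: open_nbhs_nbhs; split.
split; split.
- by apply: filterS N => q Uq; apply: derivableP; case: (c0 _ Uq).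
- by apply: derivableP; case: (c1 _ Up).
- by apply: filterS N => q Uq; apply: derivableP; case: (c0 _ Uq).
- by apply: derivableP; case: (c2 _ Up).
Qed.

(** The mean value inequality along a segment, read on the slice through [p]. *)
Lemma slice_lipschitz (f : R * R -> R) v p (h M : R) :
  (forall t : R, `|t| <= `|h| -> derivable f (t *: v + p) v /\
     `|'D_v f (t *: v + p)| <= M) ->
  `|f (h *: v + p) - f p| <= M * `|h|.
Proof.
move=> H; pose g (t : R) : R := f (t *: v + p).
have dg (t : R) : `|t| <= `|h| -> is_derive (t : R) 1 g ('D_v f (t *: v + p)).
  by move=> /H[d _]; apply: (is_derive_slice f p v t _).1; exact: derivableP.
have g0 : f p = g 0 by rewrite /g scale0r add0r.
rewrite g0 -/(g h).
have [h0|h0|h0] := ltgtP 0 h; last by rewrite -h0 subrr !normr0 mulr0.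
  have B (t : R) : 0 <= t <= h -> `|t| <= `|h|.
    by move=> /andP[t0 th]; rewrite !ger0_norm // ltW.
  have [t|t|t] := @MVT R g (fun t => 'D_v f (t *: v + p)) 0 h h0.
  - by rewrite in_itv /= => /andP[t0 th]; apply: dg; apply: B; rewrite !ltW.
  - apply: derivable_within_continuous => {}t; rewrite in_itv /= => /B tB.
    by have [] := dg _ tB.
  - rewrite in_itv /= => /andP[t0 th] ->; rewrite subr0 normrM ler_wpM2r //.
    by apply: (H _ _).2; apply: B; rewrite !ltW.
have B (t : R) : h <= t <= 0 -> `|t| <= `|h|.
  by move=> /andP[th t0]; rewrite !ler0_norm ?lerN2 // ltW.
rewrite distrC.
have [t|t|t] := @MVT R g (fun t => 'D_v f (t *: v + p)) h 0 h0.
- by rewrite in_itv /= => /andP[t0 th]; apply: dg; apply: B; rewrite !ltW.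
- apply: derivable_within_continuous => {}t; rewrite in_itv /= => /B tB.
  by have [] := dg _ tB.
- rewrite in_itv /= => /andP[t0 th] ->; rewrite sub0r normrM normrN ler_wpM2r //.
  by apply: (H _ _).2; apply: B; rewrite !ltW.
Qed.

(** Partial derivatives that are continuous are locally bounded, so moving first
    along one axis and then along the other changes [f] little. Candidates for
    the harmonic measure are only known to have continuous partial derivatives,
    and the maximum principle needs their continuity. *)
Lemma C1_continuous U f p : open U -> C1_on U f -> U p -> {for p, continuous f}.
Proof.
move=> oU C1 Up; have [_ _ c1 c2] := C1 _ Up.
pose M : R := `|'D_(e1 R) f p| + `|'D_(e2 R) f p| + 1.
have M0 : 0 < M by rewrite ltr_wpDl ?addr_ge0.
have b1 : \forall q \near p, `|'D_(e1 R) f q| < M.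
  have h : `|'D_(e1 R) f p| < M.
    by rewrite /M -addrA ltrDl ltr_wpDl.
  exact: (cvgr_norm_lt _ c1 _ h).
have b2 : \forall q \near p, `|'D_(e2 R) f q| < M.
  have h : `|'D_(e2 R) f p| < M.
    by rewrite /M addrAC ltrDr ltr_wpDl.
  exact: (cvgr_norm_lt _ c2 _ h).
have N : \forall q \near p, U q by apply: open_nbhs_nbhs; split.
have [e e0 H] := (nbhs_RRP p _).1 (filterI N (filterI b1 b2)).
apply/cvgrPdist_le => eps eps0; apply: (nbhs_RRP p _).2.
exists (Num.min e (eps / (2 * M))).
  by rewrite lt_min e0 divr_gt0 // mulr_gt0.
move=> q; rewrite !lt_min => /andP[q1 q1'] /andP[q2 q2'].
have D1 : `|f q - f (p.1, q.2)| <= M * `|q.1 - p.1|.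
  have E : q = (q.1 - p.1) *: e1 R + (p.1, q.2).
    by case: (q) => a b; rewrite /e1 /=; congr (_, _);
      rewrite /GRing.scale/= /GRing.scale/= ?mulr1 ?mulr0 ?add0r ?subrK.
  rewrite {1}E; apply: slice_lipschitz => t; rewrite [`|q.1 - _|]distrC => tq.
  have [] := H (t *: e1 R + (p.1, q.2)).
  - rewrite /= /GRing.scale/= mulr1 opprD addrCA subrr addr0 normrN.
    exact: le_lt_trans tq q1.
  - by rewrite /= /GRing.scale/= mulr0 add0r.
  by move=> /C1[d _ _ _] [/ltW ? _].
have D2 : `|f (p.1, q.2) - f p| <= M * `|q.2 - p.2|.
  have -> : (p.1, q.2) = (q.2 - p.2) *: e2 R + p.
    by case: (p) => a b; rewrite /e2 /=; congr (_, _);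
      rewrite /GRing.scale/= /GRing.scale/= ?mulr1 ?mulr0 ?add0r ?subrK.
  apply: slice_lipschitz => t; rewrite [`|q.2 - _|]distrC => tq.
  have [] := H (t *: e2 R + p).
  - by rewrite /= /GRing.scale/= mulr0 add0r subrr normr0.
  - rewrite /= /GRing.scale/= mulr1 opprD addrCA subrr addr0 normrN.
    exact: le_lt_trans tq q2.
  by move=> /C1[_ d _ _] [_ /ltW ?].
rewrite distrC in D1; rewrite distrC in D2.
apply: le_trans (ler_distD (f (p.1, q.2)) _ _) _.
rewrite [leRHS](splitr eps) lerD //.
  apply: le_trans D2 _; rewrite distrC mulrC -ler_pdivlMr // -mulrA -invfM.
  exact: ltW.
apply: le_trans D1 _; rewrite distrC mulrC -ler_pdivlMr // -mulrA -invfM.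
exact: ltW.
Qed.

End SecondDerivativeTest.

(** * Boundary values of the closed form *)

Section BoundaryBehaviour.
Variable R : realType.
Local Notation C := (Cplx R).
Local Notation Re := complex.Re.
Local Notation Im := complex.Im.
Local Notation normc := ComplexField.Normc.normc.
Local Notation sphere := (riemann_sphere R).
Local Notation B := (@slit_sphere R).
Local Open Scope complex_scope.
Implicit Types (z w : C) (p q : R * R) (s : sphere).

Definition omega_slope (x : R) (z : R[i]) : R :=
  omega_num x z / (Re (rt z) * Num.sqrt (1 - x ^+ 2)).

Lemma omegaE (x : R) (z : R[i]) : omega x z = 2^-1 + atan (omega_slope x z) / pi.
Proof. by []. Qed.

Lemma omega_ge0 (x : R) z : 0 <= omega x z.
Proof.
rewrite omegaE; have := atan_gtNpi2 (omega_slope x z); have p0 := pi_gt0 R => h.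
rewrite -(@pmulr_lge0 _ pi) // mulrDl divfK ?gt_eqF //; lra.
Qed.

Lemma omega_le1 (x : R) z : omega x z <= 1.
Proof.
rewrite omegaE; have := atan_ltpi2 (omega_slope x z); have p0 := pi_gt0 R => h.
rewrite -(@ler_pM2r _ pi) // mulrDl divfK ?gt_eqF //; lra.
Qed.

(** With [z = cosh (u + i v)] this is [cosh u ^+ 2], the square of half the sum
    of the distances from [z] to -1 and 1. It is continuous on the whole plane,
    with the value 1 on the slit, whereas [1/z] and [rt (1/z)] are unbounded
    near 0. *)
Definition cosh2 (z : R[i]) : R := (normsq z + 1 + Num.sqrt (normsq (z * z - 1))) / 2.

Lemma cosh2_real (r : R) : -1 <= r <= 1 -> cosh2 r%:C = 1.
Proof.
move=> hr; rewrite /cosh2.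
have -> : normsq (r%:C * r%:C - 1) = (1 - r ^+ 2) ^+ 2.
  by rewrite /normsq !ReImE /=; ring.
rewrite sqrtr_sqr ger0_norm; last by nra.
by rewrite /normsq /=; field.
Qed.

Lemma rt_cosh2 (z : R[i]) : z != 0 ->
  (Re (rt z^-1) ^+ 2 + Re z^-1 ^+ 2) * normsq z = cosh2 z.
Proof.
move=> z0; have n0 : normsq z != 0 by rewrite normsq_eq0.
rewrite Re_sqrtc sqr_sqrtr; last first.
  apply: divr_ge0 => //.
  have : `|Re (1 - z^-1 * z^-1)| <= Num.sqrt (normsq (1 - z^-1 * z^-1)).
    by rewrite -normcE; exact: (ReIm_le_normc _).1.
  by move=> /ler_normlP[]; lra.
have S : Num.sqrt (normsq (1 - z^-1 * z^-1)) * normsq z =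
         Num.sqrt (normsq (z * z - 1)).
  have -> : z * z - 1 = (1 - z^-1 * z^-1) * (z * z) by field.
  rewrite [in RHS]normsqM sqrtrM ?normsq_ge0 //; congr (_ * _).
  by rewrite normsqM -expr2 sqrtr_sqr ger0_norm // normsq_ge0.
rewrite /cosh2 -S; set T := Num.sqrt _; rewrite !(ReImE, ReV, ImV) /=.
by move: n0; rewrite /normsq => n0; field.
Qed.

(** In elliptic coordinates: [Re (rt (1/z)) |z|^2 = cosh u sinh u]. *)
Lemma rt_cosh2_mul (z : R[i]) : z != 0 ->
  (Re (rt z^-1) * normsq z) ^+ 2 = cosh2 z * (cosh2 z - 1).
Proof.
move=> z0; rewrite -rt_cosh2 //; have [r1 r2] := rt_ReIm z^-1.
have N : (Re z^-1 ^+ 2 + Im z^-1 ^+ 2) * normsq z = 1.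
  by rewrite -/(normsq _) -normsqM mulVf // /normsq /=; ring.
move: r1 r2 N; move: (Re (rt z^-1)) (Im (rt z^-1)) (Re z^-1) (Im z^-1) (normsq z).
move=> t u a b m r1 r2 N; rewrite -{1}N -mulrBl mulrACA -expr2.
have -> : (t ^+ 2 + a ^+ 2) * (t ^+ 2 + a ^+ 2 - (a ^+ 2 + b ^+ 2)) = t ^+ 2.
  apply/eqP; rewrite -subr_eq0; apply/eqP.
  transitivity (t ^+ 2 * (t ^+ 2 - u ^+ 2 - 1 + a ^+ 2 - b ^+ 2)
    + (t * u - a * b) * (t * u + a * b)); first by ring.
  by rewrite r1 r2; ring.
by rewrite exprMn.
Qed.

(** The argument of the arctangent in terms of functions continuous across the
    slit; the denominator vanishes on the slit and the numerator tends to
    [x - r] at the point [r]. *)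
Lemma omega_slope_cosh2 (x : R) (z : R[i]) : z != 0 -> 0 < Re (rt z^-1) ->
  omega_slope x z^-1 = (cosh2 z * x - Re z) /
    (Num.sqrt (cosh2 z * (cosh2 z - 1)) * Num.sqrt (1 - x ^+ 2)).
Proof.
move=> z0 h; have n0 : 0 < normsq z by rewrite normsq_gt0.
rewrite -rt_cosh2_mul // sqrtr_sqr gtr0_norm ?mulr_gt0 // -rt_cosh2 //.
rewrite /omega_slope /omega_num.
have -> : Re z = Re z^-1 * normsq z by rewrite ReV divfK // gt_eqF.
rewrite -mulrA [normsq z * x]mulrC mulrA -mulrBl.
by rewrite -[_ * normsq z * Num.sqrt _]mulrA [normsq z * Num.sqrt _]mulrC mulrA
   -mulf_div divff ?mulr1 // gt_eqF.
Qed.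

Lemma cvg_cosh2 p : cosh2 (toC q) @[q --> p] --> cosh2 (toC p).
Proof.
apply: cvgM; last exact: cvg_cst.
apply: cvgD.
  by apply: cvgD; [apply: ccont_normsq; exact: ccont_toC|exact: cvg_cst].
apply: (@cvg_comp _ _ _ _ (@Num.sqrt R)); last exact: sqrt_continuous.
apply: (@ccont_normsq _ p (fun q => toC q * toC q - 1)).
apply: ccontD; last exact: ccontN (ccont_cst p 1).
by apply: ccontM; exact: ccont_toC.
Qed.

(** The sign [sg] treats together the points on the left of [x], where the slope
    tends to [+oo], and those on the right, where it tends to [-oo]. *)
Lemma omega_slope_large (sg x r A : R) : sg ^+ 2 = 1 -> -1 < x < 1 -> -1 <= r <= 1 ->
  0 < sg * (x - r) -> 0 < A ->
  \forall q \near ((r, 0) : R * R), B (chart0 q) -> A < sg * omega_slope x (toC q)^-1.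
Proof.
move=> sg1 hx hr sxr A0.
pose p : R * R := (r, 0); pose d := sg * (x - r) / 2.
have d0 : 0 < d by rewrite divr_gt0.
have s0 : 0 < Num.sqrt (1 - x ^+ 2) by rewrite sqrtr_gt0; nra.
set s := Num.sqrt _ in s0.
have c2p : cosh2 (toC p) = 1 by rewrite -(cosh2_real hr).
have N1 : \forall q \near p, d < sg * (cosh2 (toC q) * x - q.1).
  have L : sg * (cosh2 (toC q) * x - q.1) @[q --> p] --> sg * (cosh2 (toC p) * x - p.1).
    apply: cvgM; first exact: cvg_cst.
    apply: cvgB; last exact: cvg_fst.
    by apply: cvgM; [exact: cvg_cosh2|exact: cvg_cst].
  apply: (cvgr_gt _ L); rewrite c2p mul1r /p /= /d; lra.
have N2 : \forall q \near p,
    Num.sqrt (cosh2 (toC q) * (cosh2 (toC q) - 1)) * s < d / A.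
  have L : Num.sqrt (cosh2 (toC q) * (cosh2 (toC q) - 1)) * s @[q --> p] -->
           Num.sqrt (cosh2 (toC p) * (cosh2 (toC p) - 1)) * s.
    apply: cvgM; last exact: cvg_cst.
    apply: (@cvg_comp _ _ _ _ (@Num.sqrt R)); last exact: sqrt_continuous.
    apply: cvgM; first exact: cvg_cosh2.
    by apply: cvgB; [exact: cvg_cosh2|exact: cvg_cst].
  apply: (cvgr_lt _ L); rewrite c2p subrr mulr0 sqrtr0 mul0r.
  by rewrite divr_gt0.
apply: filterS2 N1 N2 => q h1 h2 /slit_chart0[q0 rq].
rewrite omega_slope_cosh2 // -/s mulrA ltr_pdivlMr; last first.
  rewrite mulr_gt0 // sqrtr_gt0 -rt_cosh2_mul // exprn_gt0 // mulr_gt0 //.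
  by rewrite normsq_gt0.
by apply: lt_trans h1; rewrite mulrC -ltr_pdivlMr.
Qed.

Lemma omega_boundary (sg x r : R) : sg ^+ 2 = 1 -> -1 < x < 1 -> -1 <= r <= 1 ->
  0 < sg * (x - r) ->
  omega x (pinv s) @[s --> within B (nbhs (Some (r%:C : C) : sphere))] -->
    (1 + sg) / 2.
Proof.
move=> sg1 hx hr sxr; apply/cvgrPdist_lt => e e0.
have p0 := pi_gt0 R.
have /cvgr_gt/(_ (pi / 2 - pi * e)) : (@atan R) x @[x --> +oo] --> pi / 2.
  exact: cvgy_atan.
have : pi / 2 - pi * e < pi / 2 :> R by rewrite gtrBl mulr_gt0.
move=> /[swap] /[apply] -[M [_ HM]].
pose A := Num.max M 1 + 1.
have A0 : 0 < A by rewrite ltr_wpDl // le_max ler01 orbT.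
rewrite near_withinE; apply/nbhs_Some.
apply: filterS (omega_slope_large sg1 hx hr sxr A0) => q H Bq; have {}H := H Bq.
rewrite omegaE; set y := omega_slope _ _ in H *.
have H1 : pi / 2 - pi * e < atan (sg * y).
  apply: HM; apply: lt_trans H; rewrite /A ltr_pwDr //.
  by rewrite le_max lexx.
have H2 := atan_ltpi2 (sg * y).
have H3 : atan (sg * y) = sg * atan y.
  move/eqP: sg1; rewrite -[1](expr1n _ 2) eqf_sqr => /orP[] /eqP ->.
    by rewrite !mul1r.
  by rewrite !mulN1r atanN.
have -> : (1 + sg) / 2 - (2^-1 + atan y / pi) = sg * (pi / 2 - sg * atan y) / pi.
  rewrite mulrBr [sg * (sg * _)]mulrA -expr2 sg1 mul1r.
  have G (P : R) : P != 0 ->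
    (1 + sg) / 2 - (2^-1 + atan y / P) = (sg * (P / 2) - atan y) / P.
    by move=> P0; field.
  by apply: G; rewrite gt_eqF.
rewrite -H3 !normrM.
have -> : `|sg| = 1.
  by apply/eqP; rewrite -(@eqrXn2 _ 2) // -normrX sg1 normr1 expr1n.
rewrite mul1r normfV [`|pi|]gtr0_norm // ltr_pdivrMr // gtr0_norm; lra.
Qed.

(** At [x = 1] and [x = -1] the arc is the whole slit or a single point and the
    closed form degenerates (a vanishing denominator), while the harmonic
    measure is constant. *)
Definition slit_measure (x : R) (s : sphere) : R :=
  if x == 1 then 1 else if x == -1 then 0 else omega x (pinv s).

Let itv_strict (x : R) : -1 <= x <= 1 -> (x == 1) = false -> (x == -1) = false ->
  -1 < x < 1.
Proof.
move=> /andP[h1 h2] /negbT n1 /negbT n2; apply/andP; split.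
  by rewrite lt_neqAle h1 andbT eq_sym.
by rewrite lt_neqAle h2 andbT.
Qed.

Lemma slit_measure_itv x s : 0 <= slit_measure x s <= 1.
Proof.
rewrite /slit_measure; case: ifP => _; first by rewrite ler01 lexx.
by case: ifP => _; rewrite ?ler01 ?lexx // omega_ge0 omega_le1.
Qed.

Lemma harmonic_cst (U : set (R * R)) (k : R) : open U -> plane_harmonic U (fun=> k).
Proof.
move=> oU; apply: (@hol_plane_harmonic _ _ _ (cst 0) (cst 0) oU).
- move=> p _; split; rewrite /= ?oppr0; exact: is_derive_cst.
- by move=> p _; exact: hol_cst.
- by move=> p _; exact: ccont_cst.
- by move=> p _; exact: ccont_cst.
Qed.

Lemma harmonic_omega_chartoo (x : R) : -1 < x < 1 ->
  plane_harmonic (@chartoo R @^-1` B) (fun q => omega x (toC q)).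
Proof.
move=> hx; apply: harmonic_omega => //.
- exact: open_chartoo.
- by move=> p /slit_sphere_inv; exact.
- exact: hol_on_toC.
- exact: hol_on_cst.
Qed.

Lemma harmonic_omega_chart0 (x : R) : -1 < x < 1 ->
  plane_harmonic (@chart0 R @^-1` B) (fun q => omega x (toC q)^-1).
Proof.
move=> hx.
have c0 p : (@chart0 R @^-1` B) p -> toC p != 0 by move=> /slit_chart0[].
have h1 := hol_onV c0 (@hol_on_toC R _).
have c00 p : (@chart0 R @^-1` B) p -> toC p ^+ 2 != 0.
  by move=> /c0 ?; rewrite expf_neq0.
have h2 := hol_onM (hol_onN (@hol_on_cst _ (@chart0 R @^-1` B) 1))
  (hol_onV c00 (hol_onM (@hol_on_toC R _) (@hol_on_toC R _))).
apply: harmonic_omega h1 h2 => //; first exact: open_chart0.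
by move=> p /slit_chart0[].
Qed.

Lemma slit_measure_is_harmonic_measure (x : R) : -1 <= x <= 1 ->
  is_harmonic_measure (segment (-1) x) B (slit_measure x).
Proof.
move=> hx; split.
- exists 1 => s _; have /andP[h0 h1] := slit_measure_itv x s; by rewrite ger0_norm.
- rewrite /sphere_harmonic /slit_measure; case x1: (x == 1).
    by split; [exact/harmonic_cst/open_chart0|exact/harmonic_cst/open_chartoo].
  case x2: (x == -1).
    by split; [exact/harmonic_cst/open_chart0|exact/harmonic_cst/open_chartoo].
  have hx' := itv_strict hx x1 x2.
  split; first exact: harmonic_omega_chart0.
  rewrite (_ : _ \o _ = fun q => omega x (toC q)); first exact: harmonic_omega_chartoo.
  by apply/funext => q /=; rewrite /chartoo sphere_invK.
- rewrite /slit_measure; case x1: (x == 1); first by move=> p _; exact: cvg_cst.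
  have x1' : x < 1 by rewrite lt_neqAle x1 (andP hx).2.
  move=> p /(relint_alphaP x1')[r hr ->]; case x2: (x == -1).
    by move: hr; rewrite (eqP x2); lra.
  have hx' := itv_strict hx x1 x2.
  have := @omega_boundary 1 x r (expr1n _ _) hx'.
  rewrite mul1r (_ : (1 + 1) / 2 = 1 :> R); last by field.
  by apply; lra.
- move=> p /relint_complP[r hr [r1 ->]]; rewrite /slit_measure; case x1: (x == 1).
    by move: hr; rewrite (eqP x1); lra.
  case x2: (x == -1); first exact: cvg_cst.
  have hx' := itv_strict hx x1 x2.
  have sg1 : (-1) ^+ 2 = 1 :> R by rewrite sqrrN expr1n.
  have := @omega_boundary (-1) x r sg1 hx'.
  by rewrite subrr mul0r; apply; lra.
Qed.

End BoundaryBehaviour.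

(** * The barrier at the exceptional point *)

Section Uniqueness.
Variable R : realType.
Local Notation C := (Cplx R).
Local Notation Re := complex.Re.
Local Notation Im := complex.Im.
Local Notation normc := ComplexField.Normc.normc.
Local Notation sphere := (riemann_sphere R).
Local Notation B := (@slit_sphere R).
Local Notation Om := (@chartoo R @^-1` B).
Local Open Scope complex_scope.
Implicit Types (z w : C) (p q : R * R) (s : sphere).

(** The quotient [rt z / (1 - x z)] is unbounded only near the coordinate [1/x]
    of the exceptional boundary point; adding 1 keeps the logarithm
    nonnegative. *)
Definition log_barrier (x : R) (z : R[i]) : R :=
  ln (normsq (1 + rt z / (1 - x%:C * z))).

Lemma oneMxz_neq0_closed (x : R) (z : R[i]) : -1 <= x <= 1 -> 0 < Re (rt z) ->
  1 - x%:C * z != 0.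
Proof.
move=> hx h; apply/eqP => E; have := Re_rt_div hx h.
by rewrite E ReM /= oppr0 !mulr0 subrr ltxx.
Qed.

(** [|1 + w|^2 = 1 + 2 Re w + |w|^2] with [Re w > 0]. *)
Lemma log_barrier_normsq (x : R) (z : R[i]) : -1 <= x <= 1 -> 0 < Re (rt z) ->
  1 + normsq (rt z / (1 - x%:C * z)) <= normsq (1 + rt z / (1 - x%:C * z)).
Proof.
move=> hx h; have := Re_rt_div hx h.
have n0 : 0 < normsq (1 - x%:C * z) by rewrite normsq_gt0 oneMxz_neq0_closed.
move=> r0; have : 0 < Re (rt z / (1 - x%:C * z)) by rewrite Re_div divr_gt0.
by rewrite /normsq ReD ImD /=; nra.
Qed.

Lemma log_barrier_ge0 (x : R) (z : R[i]) : -1 <= x <= 1 -> 0 < Re (rt z) ->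
  0 <= log_barrier x z.
Proof.
move=> hx h; apply: ln_ge0; apply: le_trans (log_barrier_normsq hx h).
by rewrite lerDl normsq_ge0.
Qed.

Lemma harmonic_log_barrier (x : R) : -1 <= x <= 1 ->
  plane_harmonic Om (fun q => log_barrier x (toC q)).
Proof.
move=> hx; set U := Om; pose k := (@hol_on_cst R U); pose Z := @hol_on_toC R U.
have U0 p : U p -> 0 < Re (rt (toC p)) by move=> /slit_sphere_inv.
have hS := hol_onD (k 1) (hol_onN (hol_onM Z Z)).
have hdS := hol_onD (k 0) (hol_onN (hol_onD (hol_onM Z (k 1)) (hol_onM (k 1) Z))).
have hT := hol_on_sqrtc U0 hS.
have T0 p : U p -> 2 * rt (toC p) != 0.
  by move=> Up; rewrite mulf_neq0 ?pnatr_eq0 // rt_neq0 // U0.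
have hdT := hol_onM hdS (hol_onV T0 (hol_onM (k 2) hT)).
have hD := hol_onD (k 1) (hol_onN (hol_onM (k x%:C) Z)).
have hdD := hol_onD (k 0)
  (hol_onN (hol_onD (hol_onM (k x%:C) (k 1)) (hol_onM (k 0) Z))).
have D0 p : U p -> 1 - x%:C * toC p != 0.
  by move=> Up; rewrite oneMxz_neq0_closed // U0.
have hV := hol_onV D0 hD.
have D20 p : U p -> (1 - x%:C * toC p) ^+ 2 != 0.
  by move=> Up; rewrite expf_neq0 // D0.
have hdV := hol_onM (hol_onN hdD) (hol_onV D20 (hol_onM hD hD)).
have hf := hol_onD (k 1) (hol_onM hT hV).
have hdf := hol_onD (k 0) (hol_onD (hol_onM hT hdV) (hol_onM hdT hV)).
have f0 p : U p -> 1 + rt (toC p) / (1 - x%:C * toC p) != 0.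
  move=> Up; rewrite -normsq_gt0; apply: lt_le_trans (log_barrier_normsq hx (U0 _ Up)).
  by rewrite ltr_pwDl ?normsq_ge0.
exact: (harmonic_ln_normsq (@open_chartoo R) f0 hf hdf).
Qed.

Lemma normcM (z w : R[i]) : normc (z * w) = normc z * normc w.
Proof. by rewrite !normcE normsqM sqrtrM ?normsq_ge0. Qed.

Lemma cvg_normc p (f : R * R -> R[i]) : ccont p f ->
  normc (f q) @[q --> p] --> normc (f p).
Proof.
move=> cf; rewrite normcE; under eq_fun do rewrite normcE.
apply: (@cvg_comp _ _ _ _ (@Num.sqrt R)); last exact: sqrt_continuous.
exact: ccont_normsq.
Qed.

(** [z^2 - 1] vanishes at most to first order at [x]: to first order if [x = 1]
    or [x = -1], not at all otherwise. *)
Lemma near_normc_lower (x : R) : -1 <= x <= 1 -> exists2 k : R, 0 < k &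
  \forall q \near ((x, 0) : R * R),
    k * normc (toC q - x%:C) <= normc (toC q * toC q - 1).
Proof.
move=> hx; pose p : R * R := (x, 0).
have ct := @ccont_toC R p.
have cm : ccont p (fun q => toC q - x%:C) by apply: ccontD => //; exact: ccont_cst.
have [x1|x1] := eqVneq (x ^+ 2) 1.
  exists 1 => //.
  have cp : ccont p (fun q => toC q + x%:C) by apply: ccontD => //; exact: ccont_cst.
  have E (z : R[i]) : z * z - 1 = (z - x%:C) * (z + x%:C).
    have : x%:C * x%:C = 1 :> R[i] by rewrite -rmorphM -expr2 x1.
    by move=> <-; ring.
  have N : \forall q \near p, 1 < normc (toC q + x%:C).
    apply: (cvgr_gt _ (cvg_normc cp)).
    rewrite /p normcE /normsq !ReImE /= addr0 expr0n addr0.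
    have -> : (x + x) ^+ 2 = 2 ^+ 2 * x ^+ 2 by ring.
    by rewrite x1 mulr1 sqrtr_sqr ger0_norm // ltr1n.
  apply: filterS N => q h; rewrite E normcM mul1r ler_peMr ?normc_ge0 //.
  exact: ltW.
have x2 : 0 < 1 - x ^+ 2.
  by rewrite subr_gt0 lt_neqAle x1 /=; nra.
exists ((1 - x ^+ 2) / 2); first by rewrite divr_gt0.
have cq : ccont p (fun q => toC q * toC q - 1).
  by apply: ccontD; [exact: ccontM|exact: ccontN (ccont_cst p 1)].
have N1 : \forall q \near p, (1 - x ^+ 2) / 2 < normc (toC q * toC q - 1).
  apply: (cvgr_gt _ (cvg_normc cq)).
  rewrite /p normcE /normsq !ReImE /=.
  have -> : (x * x - 0 * 0 + - 1) ^+ 2 + (x * 0 + 0 * x + - 0) ^+ 2 =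
     (1 - x ^+ 2) ^+ 2 by ring.
  by rewrite sqrtr_sqr ger0_norm ?ltW //; lra.
have N2 : \forall q \near p, normc (toC q - x%:C) < 1.
  apply: (cvgr_lt _ (cvg_normc cm)).
  by rewrite /p normcE /normsq !ReImE /= subrr subr0 expr0n addr0 sqrtr0.
apply: filterS2 N1 N2 => q h1 h2; apply: le_trans (ltW h1).
by rewrite ler_piMr ?ltW // divr_gt0.
Qed.

(** For [q] near [x] the square of the modulus of the quotient is
    [|q^2 - 1| / |q - x|^2], at least a constant times [1 / |q - x|]. At an
    endpoint of the slit the numerator vanishes too, but only to first order. *)
Lemma log_barrier_blowup (x A : R) : -1 <= x <= 1 ->
  \forall q \near ((x, 0) : R * R), B (chart0 q) -> A < log_barrier x (toC q)^-1.
Proof.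
move=> hx; have [k k0 N1] := near_normc_lower hx.
pose p : R * R := (x, 0).
have cm : ccont p (fun q => toC q - x%:C).
  by apply: ccontD; [exact: ccont_toC|exact: ccont_cst].
have N2 : \forall q \near p, normc (toC q - x%:C) < k * expR (- A).
  apply: (cvgr_lt _ (cvg_normc cm)).
  rewrite /p normcE /normsq !ReImE /= subrr subr0 expr0n addr0 sqrtr0.
  by rewrite mulr_gt0 // expR_gt0.
apply: filterS2 N1 N2 => q h1 h2 Bq; have [q0 rq] := slit_chart0 Bq.
set z := toC q in h1 h2 q0 rq *.
have zx : z - x%:C != 0.
  rewrite subr_eq0; apply/eqP => zx; apply: Bq; apply/segmentP; exists x => //.
  by rewrite /chart0 -/(toC q) -/z zx.
have e0 : 0 < normc (z - x%:C) by rewrite normcE sqrtr_gt0 normsq_gt0.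
have n1 := log_barrier_normsq hx rq.
have G : normsq (rt z^-1 / (1 - x%:C * z^-1)) =
   normc (z * z - 1) / normc (z - x%:C) ^+ 2.
  rewrite normsqM normsqV sqr_normc /rt -sqrt_normsq -normcE.
  have -> : z * z - 1 = (1 - z^-1 * z^-1) * (z * z) by field.
  have -> : z - x%:C = (1 - x%:C * z^-1) * z by field.
  rewrite !normcM normsqM -[normsq z]sqr_normc expr2.
  have nz : 0 < normc z by rewrite normcE sqrtr_gt0 normsq_gt0.
  have nw : 0 < normsq (1 - x%:C * z^-1) by rewrite normsq_gt0 oneMxz_neq0_closed.
  by rewrite -mulf_div divff ?mulr1 // mulf_neq0 ?gt_eqF.
have H : expR A < normsq (1 + rt z^-1 / (1 - x%:C * z^-1)).
  apply: lt_le_trans n1; rewrite G ltr_wpDl //.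
  rewrite ltr_pdivlMr ?exprn_gt0 //; apply: lt_le_trans h1.
  rewrite expr2 mulrA ltr_pM2r // -ltr_pdivlMl ?expR_gt0 // mulrC.
  by rewrite -expRN.
by rewrite -[A]expRK /log_barrier ltr_ln ?posrE ?expR_gt0 // (lt_trans _ H) // expR_gt0.
Qed.

(** The last term makes the barrier strictly superharmonic: the Laplacian of
    [- omega_0^2] is [- 2 |grad omega_0|^2], and [omega 0] has no critical
    point. The constant 1 keeps the barrier nonnegative since
    [0 <= omega 0 <= 1]. *)
Definition barrier (x : R) (z : R[i]) : R :=
  log_barrier x z + 1 - omega 0 z * omega 0 z.

Lemma barrier_ge (x : R) (z : R[i]) : log_barrier x z <= barrier x z.
Proof.
have := omega_ge0 0 z; have := omega_le1 0 z; rewrite /barrier; nra.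
Qed.

Lemma grad_omega0 p : 0 < Re (rt (toC p)) ->
  0 < 'D_(e1 R) (fun q => omega 0 (toC q)) p ^+ 2 +
      'D_(e2 R) (fun q => omega 0 (toC q)) p ^+ 2.
Proof.
move=> h; have h0 : -1 < (0 : R) < 1 by rewrite oppr_lt0 ltr01.
have [d1 d2] := @hol_toC R p.
have [_ ->] := is_derive_omega h0 (ccont_toC p) h d1.
have [_ ->] := is_derive_omega h0 (ccont_toC p) h d2.
rewrite mul0r subr0 !mul1r mulr1 Re_iM expr0n subr0 sqrtr1.
have : 0 < normsq (rt (toC p))^-1 by rewrite normsq_gt0 invr_neq0 // rt_neq0.
move: ((rt (toC p))^-1) => y y0.
have P0 : 0 < (1 / pi) ^+ 2 :> R by rewrite exprn_gt0 // divr_gt0 // pi_gt0.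
have -> : (- (1 / pi) * Re y) ^+ 2 + (- (1 / pi) * - Im y) ^+ 2 =
  (1 / pi) ^+ 2 * normsq y by rewrite /normsq; ring.
exact: mulr_gt0.
Qed.

Lemma harmonic_continuous (U : set (R * R)) f p : open U -> plane_harmonic U f ->
  U p -> {for p, continuous f}.
Proof. by move=> oU [[c _ _] _]; exact: C1_continuous. Qed.

(** The sum of the two second derivatives of [u1 - u2 - e * barrier] at a
    maximum is nonpositive, yet harmonicity leaves only [2 e (d1^2 + d2^2)] of
    it. *)
Let maximum_arithmetic (e o a1 a2 b1 b2 k1 k2 o1 o2 d1 d2 : R) : 0 < e ->
  a1 - b1 - e * (k1 - (2 * (d1 ^+ 2 + o * o1) - 0)) <= 0 ->
  a2 - b2 - e * (k2 - (2 * (d2 ^+ 2 + o * o2) - 0)) <= 0 ->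
  a1 + a2 = 0 -> b1 + b2 = 0 -> k1 + k2 = 0 -> o1 + o2 = 0 ->
  ~ (0 < d1 ^+ 2 + d2 ^+ 2).
Proof.
move=> e0 H1 H2 L1 L2 L3 L4 G.
have E : (a1 - b1 - e * (k1 - (2 * (d1 ^+ 2 + o * o1) - 0))) +
  (a2 - b2 - e * (k2 - (2 * (d2 ^+ 2 + o * o2) - 0))) =
  (a1 + a2) - (b1 + b2) - e * (k1 + k2) + 2 * (e * o) * (o1 + o2)
  + 2 * (e * (d1 ^+ 2 + d2 ^+ 2)) by ring.
rewrite L1 L2 L3 L4 in E.
have : 0 < e * (d1 ^+ 2 + d2 ^+ 2) by rewrite mulr_gt0.
lra.
Qed.

(** A strictly subharmonic function has no local maximum. *)
Lemma no_interior_max (x e : R) (v1 v2 : R * R -> R) p : -1 <= x <= 1 -> 0 < e ->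
  plane_harmonic Om v1 -> plane_harmonic Om v2 -> Om p ->
  ~ (\forall q \near p, v1 q - v2 q - e * barrier x (toC q) <=
       v1 p - v2 p - e * barrier x (toC p)).
Proof.
move=> hx e0 h1 h2 Up fmax.
have oU := @open_chartoo R.
have h0 : -1 < (0 : R) < 1 by rewrite oppr_lt0 ltr01.
have [a1 a2] := harmonic_has_derive2 oU h1 Up.
have [b1 b2] := harmonic_has_derive2 oU h2 Up.
have [k1 k2] := harmonic_has_derive2 oU (harmonic_log_barrier hx) Up.
have [w1 w2] := harmonic_has_derive2 oU (harmonic_omega_chartoo h0) Up.
have D v1' v2' log_barrier' omega' v c1 c2 c3 c4 :
    has_derive2 p v v1 v1' c1 -> has_derive2 p v v2 v2' c2 ->
    has_derive2 p v (fun q => log_barrier x (toC q)) log_barrier' c3 ->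
    has_derive2 p v (fun q => omega 0 (toC q)) omega' c4 ->
    c1 - c2 - e * (c3 - (2 * (omega' p ^+ 2 + omega 0 (toC p) * c4) - 0)) <= 0.
  move=> A1 A2 A3 A4.
  have := has_derive2B (has_derive2B A1 A2) (has_derive2Z e
    (has_derive2B A3 (has_derive2B (has_derive2_sq A4) (has_derive2_cst p v 1)))).
  move=> /has_derive2_max; apply; apply: filterS fmax => q /=.
  rewrite /barrier /cst; lra.
have H1 := D _ _ _ _ _ _ _ _ _ a1 b1 k1 w1.
have H2 := D _ _ _ _ _ _ _ _ _ a2 b2 k2 w2.
have L1 := h1.2 _ Up; have L2 := h2.2 _ Up.
have L3 := (harmonic_log_barrier hx).2 _ Up.
have L4 := (harmonic_omega_chartoo h0).2 _ Up.
rewrite /laplacian in L1 L2 L3 L4.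
have G : 0 < 'D_(e1 R) (fun q => omega 0 (toC q)) p ^+ 2 +
      'D_(e2 R) (fun q => omega 0 (toC q)) p ^+ 2.
  by apply: grad_omega0; exact/slit_sphere_inv.
exact: (maximum_arithmetic e0 H1 H2 L1 L2 L3 L4 G).
Qed.

End Uniqueness.

(** * The maximum principle and the harmonic measure of the slit *)

Section HarmonicMeasureOfSlit.
Variable R : realType.
Local Notation C := (Cplx R).
Local Notation Re := complex.Re.
Local Notation Im := complex.Im.
Local Notation sphere := (riemann_sphere R).
Local Notation B := (@slit_sphere R).
Local Notation Om := (@chartoo R @^-1` B).
Local Open Scope complex_scope.
Implicit Types (z w : C) (p q : R * R) (s : sphere).

Definition pos_part (t : R) : R := (t + `|t|) / 2.

Lemma pos_part_ge0 t : 0 <= pos_part t.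
Proof. by rewrite /pos_part; have := ler_norm (- t); rewrite normrN; lra. Qed.

Lemma pos_part_ge t : t <= pos_part t.
Proof. by rewrite /pos_part; have := ler_norm t; lra. Qed.

Lemma pos_part_id t : 0 <= t -> pos_part t = t.
Proof. by move=> t0; rewrite /pos_part ger0_norm //; field. Qed.

Lemma pos_part_eq0 t : t <= 0 -> pos_part t = 0.
Proof. by move=> t0; rewrite /pos_part ler0_norm // subrr mul0r. Qed.

Lemma pos_part_le t e : 0 <= e -> t <= e -> pos_part t <= e.
Proof.
move=> e0 te; have [t0|/ltW t0] := leP 0 t; first by rewrite pos_part_id.
by rewrite pos_part_eq0.
Qed.

Section TwoSolutions.
Variables (x e : R) (u1 u2 : sphere -> R).
Hypotheses (hx : -1 <= x <= 1) (e0 : 0 < e).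
Hypotheses (h1 : is_harmonic_measure (segment (-1) x) B u1)
           (h2 : is_harmonic_measure (segment (-1) x) B u2).

Let F s := u1 s - u2 s - e * barrier x (pinv s).
Let g s := if `[< B s >] then pos_part (F s) else 0.

Let barrier_ge0 s : B s -> 0 <= barrier x (pinv s).
Proof.
by move=> /slit_rt h; apply: le_trans (barrier_ge _ _); exact: log_barrier_ge0.
Qed.

Let F_chartoo q : F (chartoo q) =
  u1 (chartoo q) - u2 (chartoo q) - e * barrier x (toC q).
Proof. by rewrite /F /chartoo sphere_invK. Qed.

Let toRpinv s : B s -> chartoo (toR (pinv s)) = s.
Proof. by move=> Bs; rewrite /chartoo -/(toC _) toRK slit_pinv. Qed.

Let g_ge0 s : 0 <= g s.
Proof. by rewrite /g; case: ifP => // _; exact: pos_part_ge0. Qed.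

Let cont_interior s : B s -> {for s, continuous g}.
Proof.
move=> Bs; have Os : Om (toR (pinv s)) by rewrite /= toRpinv.
have oU := @open_chartoo R.
have k0 : -1 < (0 : R) < 1 by rewrite oppr_lt0 ltr01.
have cF : {for toR (pinv s), continuous (fun q => pos_part (F (chartoo q)))}.
  have cF' : {for toR (pinv s), continuous (fun q => F (chartoo q))}.
    have -> : (fun q => F (chartoo q)) = (fun q => (u1 \o @chartoo R) q -
        (u2 \o @chartoo R) q -
        e * (log_barrier x (toC q) + 1 - omega 0 (toC q) * omega 0 (toC q))).
      by apply/funext => q; rewrite F_chartoo.
    have [_ [_ H1] _ _] := h1; have [_ [_ H2] _ _] := h2.
    have c1 := harmonic_continuous oU H1 Os.
    have c2 := harmonic_continuous oU H2 Os.
    have c3 := harmonic_continuous oU (harmonic_log_barrier hx) Os.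
    have c4 := harmonic_continuous oU (harmonic_omega_chartoo k0) Os.
    apply: cvgB; first exact: cvgB.
    apply: cvgM; first exact: cvg_cst.
    apply: cvgB; last exact: cvgM.
    by apply: cvgD => //; exact: cvg_cst.
  apply: cvgM; last exact: cvg_cst.
  by apply: cvgD => //; exact: (cvg_norm cF').
move=> V gV; change (nbhs s (g @^-1` V)); rewrite -(slit_pinv Bs).
apply: nbhs_sphere_inv.
have gs : g s = pos_part (F (chartoo (toR (pinv s)))).
  by rewrite toRpinv // /g; case: asboolP.
rewrite gs in gV.
have N1 : nbhs (toR (pinv s)) (fun q => V (pos_part (F (chartoo q)))) := cF V gV.
have N2 : nbhs (toR (pinv s)) Om by apply: open_nbhs_nbhs; split.
have N3 : nbhs (toR (pinv s))
    ((fun q => V (pos_part (F (chartoo q)))) `&` Om) by exact: filterI.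
apply: filterS N3 => q [/= Vq Oq].
by rewrite /= /g; case: asboolP.
Qed.

Let g_slit (r : R) : -1 <= r <= 1 -> g (Some (r%:C : C)) = 0.
Proof.
move=> hr; rewrite /g; case: asboolP => // -[]; apply/segmentP.
by exists r.
Qed.

Let same_limit (r : R) : -1 <= r <= 1 -> r != x -> exists l : R,
  u1 s @[s --> within B (nbhs (Some (r%:C : C) : sphere))] --> l /\
  u2 s @[s --> within B (nbhs (Some (r%:C : C) : sphere))] --> l.
Proof.
move=> hr; have [_ _ a1 b1] := h1; have [_ _ a2 b2] := h2.
rewrite neq_lt => /orP[rx|xr].
  have A : relative_interior (frontier B) (segment (-1) x) (Some (r%:C : C)).
    by apply: relint_alpha; [case/andP: hx|rewrite rx (andP hr).1].
  by exists 1; split; [exact: a1|exact: a2].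
have A : relative_interior (frontier B) (frontier B `\` segment (-1) x)
    (Some (r%:C : C)).
  by apply: relint_compl; [case/andP: hx|rewrite xr (andP hr).2].
by exists 0; split; [exact: b1|exact: b2].
Qed.

(** Off [x] the difference of the candidates tends to 0 and the barrier is
    nonnegative, so the positive part tends to 0. *)
Let cont_regular (r : R) : -1 <= r <= 1 -> r != x ->
  {for (Some (r%:C : C) : sphere), continuous g}.
Proof.
move=> hr rx; have [l [l1 l2]] := same_limit hr rx.
rewrite /prop_for /continuous_at g_slit //; apply/cvgrPdist_lt => d d0.
have d20 : 0 < d / 2 by rewrite divr_gt0.
have FF : Filter (within B (nbhs (Some (r%:C : C) : sphere))) by exact: within_filter.
have l12 : u1 s - u2 s @[s --> within B (nbhs (Some (r%:C : C) : sphere))] --> 0.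
  by rewrite -(subrr l); exact: cvgB.
have N : within B (nbhs (Some (r%:C : C) : sphere)) (fun s => u1 s - u2 s < d / 2).
  exact: (cvgr_lt _ l12 _ d20).
apply: (nbhs_Some _ _).2; have {}N := (nbhs_Some (r%:C : C) _).1 N.
apply: filterS N => q H /=; rewrite sub0r normrN ger0_norm //.
rewrite {1}/g; case: asboolP => // Bs.
apply: (@le_lt_trans _ _ (d / 2)); last by lra.
apply: pos_part_le; first exact: ltW.
have := H Bs; rewrite /= /F; have := mulr_ge0 (ltW e0) (barrier_ge0 Bs).
lra.
Qed.

(** At [x] nothing is known about the candidates but their boundedness, and the
    barrier exceeds any bound. *)
Let cont_singular : {for (Some (x%:C : C) : sphere), continuous g}.
Proof.
have [[M1 B1] _ _ _] := h1; have [[M2 B2] _ _ _] := h2.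
rewrite /prop_for /continuous_at g_slit //; apply/cvgrPdist_lt => d d0.
apply: (nbhs_Some _ _).2.
apply: filterS (log_barrier_blowup ((M1 + M2) / e) hx) => q H /=.
rewrite sub0r normrN ger0_norm // {1}/g; case: asboolP => // Bs.
rewrite pos_part_eq0 // /F.
have b1 := B1 _ Bs; have b2 := B2 _ Bs.
have : M1 + M2 < e * barrier x (pinv (chart0 q)).
  rewrite mulrC -ltr_pdivrMr //; apply: lt_le_trans (H Bs) _.
  exact: barrier_ge.
move: b1 b2; rewrite !ler_norml => /andP[_ b1] /andP[b2 _]; lra.
Qed.

Let g_continuous : continuous g.
Proof.
move=> s; have [Bs|] := pselect (B s); first exact: cont_interior.
move=> /contrapT/segmentP[r hr ->].
by have [->|rx] := eqVneq r x; [exact: cont_singular|exact: cont_regular].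
Qed.

(** The positive part [g] attains its maximum on the compact sphere; were it
    positive, it would be attained off the slit and be a local maximum of
    [F]. *)
Let F_le0 s : B s -> F s <= 0.
Proof.
move=> Bs; rewrite leNgt; apply/negP => Fs.
have [c _ cmax] := compact_EVT_max (ex_intro setT s I)
  one_point_compactification_compact (continuous_subspaceT g_continuous).
have gs : g s = F s by rewrite /g; case: asboolP => // _; rewrite pos_part_id ?ltW.
have gc : 0 < g c by apply: lt_le_trans (cmax s _); rewrite ?gs // inE.
have Bc : B c.
  by apply: contrapT => nB; move: gc; rewrite /g; case: asboolP; rewrite ?ltxx.
have Oc : Om (toR (pinv c)) by rewrite /= toRpinv.
have Fc : g c = F c.
  move: gc; rewrite /g; case: asboolP => // _; have [h|h] := leP (F c) 0.
    by rewrite pos_part_eq0 // ltxx.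
  by rewrite pos_part_id // ltW.
have [_ [_ H1] _ _] := h1; have [_ [_ H2] _ _] := h2.
apply: (no_interior_max hx e0 H1 H2 Oc).
have N2 : nbhs (toR (pinv c)) Om.
  by apply: open_nbhs_nbhs; split => //; exact: open_chartoo.
apply: filterS N2 => q Oq.
have A : F (chartoo q) <= F (chartoo (toR (pinv c))).
  rewrite toRpinv // -Fc; apply: le_trans (cmax (chartoo q) _); last by rewrite inE.
  by rewrite /g; case: asboolP => // _; exact: pos_part_ge.
by move: A; rewrite !F_chartoo.
Qed.

Lemma harmonic_measure_le_barrier s : B s ->
  u1 s - u2 s <= e * barrier x (pinv s).
Proof. by move=> /F_le0; rewrite /F subr_le0. Qed.

End TwoSolutions.

(** Let the weight [e] of the barrier tend to 0. *)
Lemma harmonic_measure_le x u1 u2 s : -1 <= x <= 1 ->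
  is_harmonic_measure (segment (-1) x) B u1 ->
  is_harmonic_measure (segment (-1) x) B u2 -> B s -> u1 s <= u2 s.
Proof.
move=> hx h1 h2 Bs; rewrite -subr_le0 leNgt; apply/negP => v0.
set v := u1 s - u2 s in v0.
have H e : 0 < e -> v <= e * barrier x (pinv s).
  by move=> e0; exact: (harmonic_measure_le_barrier hx e0 h1 h2 Bs).
have b0 : 0 < barrier x (pinv s).
  by have := H 1 ltr01; rewrite mul1r; exact: lt_le_trans.
have := H (v / barrier x (pinv s) / 2).
rewrite !divr_gt0 // => /(_ isT).
by rewrite mulrAC divfK ?gt_eqF //; lra.
Qed.

Lemma harmonic_measure_slit x s : -1 <= x <= 1 -> B s ->
  harmonic_measure s (segment (-1) x) B = slit_measure x s.
Proof.
move=> hx Bs; rewrite /harmonic_measure.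
have h := slit_measure_is_harmonic_measure hx.
have h' : is_harmonic_measure (segment (-1) x) B
   (xget (fun=> 0) [set u | is_harmonic_measure (segment (-1) x) B u]).
  exact: (@xgetPex _ (fun=> 0) [set u | is_harmonic_measure (segment (-1) x) B u]
     (ex_intro _ _ h)).
by apply/eqP; rewrite eq_le !(harmonic_measure_le hx _ _ Bs).
Qed.

End HarmonicMeasureOfSlit.

(** * The phase of a conjugate pair of poles *)

Section Phase.
Variable R : realType.
Implicit Types (r psi th phi : R).

(** Minus the argument of [1 - r e^(i psi)]. *)
Definition blaschke_arg r psi : R := atan (r * sin psi / (1 - r * cos psi)).

(** The argument of the Blaschke factor [(e^(i psi) - r) / (1 - r e^(i psi))] on
    the unit circle; the arctangent gives its continuous branch. *)
Definition blaschke_phase r psi : R := psi + 2 * blaschke_arg r psi.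

Lemma cos_itv psi : -1 <= cos psi <= 1.
Proof. by rewrite cos_geN1 cos_le1. Qed.

Lemma blaschke_den_gt0 r psi : 0 <= r < 1 -> 0 < 1 - r * cos psi.
Proof. by move=> hr; have := cos_itv psi; nra. Qed.

Lemma poisson_den_gt0 r psi : 0 <= r < 1 ->
  0 < 1 + r ^+ 2 - 2 * r * cos psi.
Proof. by move=> hr; have := cos_itv psi; nra. Qed.

(** The derivative of the argument of a Blaschke factor is the Poisson
    kernel. *)
Lemma is_derive_blaschke_phase r psi : 0 <= r < 1 ->
  is_derive psi 1 (blaschke_phase r)
    ((1 - r ^+ 2) / (1 + r ^+ 2 - 2 * r * cos psi)).
Proof.
move=> hr; have d0 := blaschke_den_gt0 psi hr; have p0 := poisson_den_gt0 psi hr.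
have d0' : 1 - r * cos psi != 0 by rewrite gt_eqF.
have dn : is_derive psi 1 (fun y => r * sin y) (r * cos psi).
  exact: is_deriveZ.
have dd : is_derive psi 1 (fun y => 1 - r * cos y) (0 - r * - sin psi).
  by apply: is_deriveB; exact: is_deriveZ.
have dV := @is_derive_inv _ _ (fun y => 1 - r * cos y) _ _ _ d0' dd.
have da := is_derive1_atan (r * sin psi / (1 - r * cos psi)).
have D := is_deriveD (is_derive_id psi 1) (is_deriveZ 2
  (@is_derive_comp1 _ _ (fun y => r * sin y / (1 - r * cos y)) _ _ _ _ _ da
    (is_deriveM dn dV))).
apply: is_derive_ext D => //.
rewrite /GRing.scale /=; move: (sin psi) (cos psi) (cos2Dsin2 psi) d0' p0.
move=> s c sc d0' p0.
have p0' : 1 + r ^+ 2 - 2 * r * c != 0 by rewrite gt_eqF.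
have E : (1 - r * c) ^+ 2 + (r * s) ^+ 2 = 1 + r ^+ 2 - 2 * r * c.
  transitivity (1 - 2 * r * c + r ^+ 2 * (c ^+ 2 + s ^+ 2)); first by ring.
  by rewrite sc; ring.
have -> : (1 + (r * s / (1 - r * c)) ^+ 2)^-1 =
  (1 - r * c) ^+ 2 / (1 + r ^+ 2 - 2 * r * c).
  rewrite -E; have E0 : (1 - r * c) ^+ 2 + (r * s) ^+ 2 != 0 by rewrite E.
  by field; apply/andP.
transitivity (1 + 2 * (r * c - r ^+ 2 * (c ^+ 2 + s ^+ 2)) /
  (1 + r ^+ 2 - 2 * r * c)); first by field; apply/andP.
by rewrite sc; field.
Qed.

(** The Poisson kernel is positive and largest at [psi = 0], where it is
    [(1 + r) / (1 - r)]. *)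
Lemma blaschke_phase_lip r a b : 0 <= r < 1 -> a <= b ->
  0 <= blaschke_phase r b - blaschke_phase r a <= (1 + r) / (1 - r) * (b - a).
Proof.
move=> hr; rewrite le_eqVlt => /orP[/eqP ->|ab].
  by rewrite !subrr mulr0 lexx.
have [c|c|c] := @MVT R (blaschke_phase r)
   (fun psi => (1 - r ^+ 2) / (1 + r ^+ 2 - 2 * r * cos psi)) a b ab.
- by move=> _; exact: is_derive_blaschke_phase.
- apply: derivable_within_continuous => {}c _.
  by have [] := is_derive_blaschke_phase c hr.
move=> _ ->; have p0 := poisson_den_gt0 c hr.
have n0 : 0 < 1 - r ^+ 2 by nra.
have ba : 0 < b - a by rewrite subr_gt0.
rewrite ltW ?mulr_gt0 ?invr_gt0 //= ler_pM2r // ler_pdivrMr //.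
rewrite -ler_pdivrMl; last by rewrite divr_gt0; lra.
rewrite invf_div; have -> : (1 - r) / (1 + r) * (1 - r ^+ 2) = (1 - r) ^+ 2.
  by field; rewrite gt_eqF; lra.
by have := cos_itv c; nra.
Qed.

(** The mean of the Blaschke phases of [r e^(i phi)] and of its conjugate: the
    phase contributed by either of the two conjugate poles, since [omega] takes
    the same value at both. *)
Definition joukowski_phase r phi th : R :=
  th + blaschke_arg r (th - phi) + blaschke_arg r (th + phi).

Lemma joukowski_phaseE r phi th : 2 * joukowski_phase r phi th =
  blaschke_phase r (th - phi) + blaschke_phase r (th + phi).
Proof. by rewrite /joukowski_phase /blaschke_phase; ring. Qed.

Lemma blaschke_argN r psi : blaschke_arg r (- psi) = - blaschke_arg r psi.
Proof. by rewrite /blaschke_arg sinN cosN mulrN mulNr atanN. Qed.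

Lemma joukowski_phase0 r phi : joukowski_phase r phi 0 = 0.
Proof. by rewrite /joukowski_phase !add0r blaschke_argN addNr. Qed.

Lemma joukowski_phase_pi r phi : joukowski_phase r phi pi = pi.
Proof.
rewrite /joukowski_phase -[pi - phi]opprB blaschke_argN -addrA addrC.
rewrite (_ : blaschke_arg r (pi + phi) = blaschke_arg r (phi - pi)).
  by rewrite addNr add0r.
rewrite /blaschke_arg addrC sinDpi cosDpi -[phi - pi]opprB sinN cosN sinB cosB.
by rewrite sinpi cospi !mul0r !mulN1r !addr0 !sub0r opprK.
Qed.

Lemma joukowski_phase_r0 phi th : joukowski_phase 0 phi th = th.
Proof. by rewrite /joukowski_phase /blaschke_arg !mul0r atan0 !addr0. Qed.

Lemma joukowski_phase_lip r phi a b : 0 <= r < 1 -> a <= b ->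
  0 <= joukowski_phase r phi b - joukowski_phase r phi a
    <= (1 + r) / (1 - r) * (b - a).
Proof.
move=> hr ab.
have h1 := @blaschke_phase_lip r (a - phi) (b - phi) hr.
have h2 := @blaschke_phase_lip r (a + phi) (b + phi) hr.
have ab1 : a - phi <= b - phi by rewrite lerD2r.
have ab2 : a + phi <= b + phi by rewrite lerD2r.
have {}h1 := h1 ab1; have {}h2 := h2 ab2.
have e1 : b - phi - (a - phi) = b - a by ring.
have e2 : b + phi - (a + phi) = b - a by ring.
rewrite e1 in h1; rewrite e2 in h2.
have := joukowski_phaseE r phi a; have := joukowski_phaseE r phi b.
move: ((1 + r) / (1 - r) * (b - a)) h1 h2 => k; lra.
Qed.

(** [jX + i jY] is the product of [e^(i th)], [1 - b e^(- i th)] and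
    [1 - conj b e^(- i th)] for [b = r e^(i phi)], whose argument is the
    Joukowski phase. *)
Definition jX r phi th : R := (1 + r ^+ 2) * cos th - 2 * r * cos phi.
Definition jY r th : R := (1 - r ^+ 2) * sin th.

(** The argument of a product is the sum of the arguments of its factors, here
    in the form: cosine and sine of the phase are proportional to [jX] and
    [jY]. *)
Lemma joukowski_phase_cossin r phi th : 0 <= r < 1 -> exists2 M : R, 0 < M &
  cos (joukowski_phase r phi th) * M = jX r phi th /\
  sin (joukowski_phase r phi th) * M = jY r th.
Proof.
move=> hr.
have arg psi : exists2 m : R, 0 < m &
   cos (blaschke_arg r psi) * m = 1 - r * cos psi /\
   sin (blaschke_arg r psi) * m = r * sin psi.
  have d0 := blaschke_den_gt0 psi hr.
  have c0 : 0 < cos (blaschke_arg r psi).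
    by rewrite cos_atan invr_gt0 sqrtr_gt0 ltr_pwDl ?sqr_ge0.
  exists ((1 - r * cos psi) / cos (blaschke_arg r psi)); first by rewrite divr_gt0.
  split; first by rewrite mulrCA divff ?mulr1 // gt_eqF.
  have := atanK (r * sin psi / (1 - r * cos psi)).
  rewrite -/(blaschke_arg r psi) /tan => /eqP.
  have c0' := lt0r_neq0 c0; have d0' := lt0r_neq0 d0.
  rewrite eqr_div // => /eqP E.
  by rewrite mulrA E mulfK.
have [m1 m10 [C1 S1]] := arg (th - phi); have [m2 m20 [C2 S2]] := arg (th + phi).
exists (m1 * m2); first exact: mulr_gt0.
move: C1 S1 C2 S2; rewrite /joukowski_phase /jX /jY.
move: (blaschke_arg r (th - phi)) (blaschke_arg r (th + phi)) => u1 u2.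
rewrite [in cos (th + u1 + u2)]cosD [in sin (th + u1 + u2)]sinD.
rewrite !(cosD, sinD) !(cosN, sinN).
have := cos2Dsin2 th; have := cos2Dsin2 phi.
move: (cos th) (sin th) (cos phi) (sin phi) (cos u1) (sin u1) (cos u2) (sin u2).
move=> c s p q c1 s1 c2 s2 /eqP; rewrite -subr_eq0 => /eqP pq /eqP.
rewrite -subr_eq0 => /eqP cs C1 S1 C2 S2; split.
- transitivity (c * ((c1 * m1) * (c2 * m2) - (s1 * m1) * (s2 * m2)) -
    s * ((s1 * m1) * (c2 * m2) + (c1 * m1) * (s2 * m2))); first by ring.
  rewrite C1 S1 C2 S2; apply/eqP; rewrite -subr_eq0; apply/eqP.
  transitivity (r ^+ 2 * c * (c ^+ 2 + s ^+ 2) * (p ^+ 2 + q ^+ 2 - 1) +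
    (r ^+ 2 * c - 2 * r * p) * (c ^+ 2 + s ^+ 2 - 1)); first by ring.
  by rewrite pq cs !mulr0 addr0.
- transitivity (s * ((c1 * m1) * (c2 * m2) - (s1 * m1) * (s2 * m2)) +
    c * ((s1 * m1) * (c2 * m2) + (c1 * m1) * (s2 * m2))); first by ring.
  rewrite C1 S1 C2 S2; apply/eqP; rewrite -subr_eq0; apply/eqP.
  transitivity (- r ^+ 2 * s * (c ^+ 2 + s ^+ 2) * (p ^+ 2 + q ^+ 2 - 1) -
    r ^+ 2 * s * (c ^+ 2 + s ^+ 2 - 1)); first by ring.
  by rewrite pq cs !mulr0 subr0.
Qed.

Lemma joukowski_phase_itv r phi th : 0 <= r < 1 -> 0 <= th <= pi ->
  0 <= joukowski_phase r phi th <= pi.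
Proof.
move=> hr /andP[t0 tpi].
have := joukowski_phase_lip phi hr t0; have := joukowski_phase_lip phi hr tpi.
by rewrite joukowski_phase0 joukowski_phase_pi; lra.
Qed.

(** The phase lies in [(0, pi)], where it is the arccotangent of [jX / jY]: this
    is the shape in which [omega] presents it. *)
Lemma joukowski_phase_atan r phi th : 0 <= r < 1 -> 0 < th < pi ->
  atan (jX r phi th / jY r th) = pi / 2 - joukowski_phase r phi th.
Proof.
move=> hr /andP[t0 tpi].
have [M M0 [CM SM]] := joukowski_phase_cossin phi th hr.
have [h0 h1] : 0 <= joukowski_phase r phi th /\ joukowski_phase r phi th <= pi.
  by apply/andP; apply: joukowski_phase_itv => //; rewrite !ltW.
have Y0 : 0 < jY r th.
  by rewrite mulr_gt0 //; [nra|apply: sin_gt0_pi; rewrite t0].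
set A := joukowski_phase r phi th in CM SM h0 h1 *.
have sA : 0 < sin A by rewrite -(pmulr_lgt0 _ M0) SM.
have A0 : 0 < A.
  by rewrite lt_neqAle h0 andbT; apply/eqP => E; move: sA; rewrite -E sin0 ltxx.
have A1 : A < pi.
  by rewrite lt_neqAle h1 andbT; apply/eqP => E; move: sA; rewrite E sinpi ltxx.
rewrite -CM -SM -mulf_div divff ?mulr1 ?gt_eqF //.
have -> : cos A / sin A = tan (pi / 2 - A).
  rewrite /tan sinB cosB sin_pihalf cos_pihalf.
  by rewrite mul1r mul0r subr0 mul0r add0r mul1r.
by rewrite tanK // in_itv /=; lra.
Qed.

End Phase.

(** * Poles under the Joukowski map *)

Section Poles.
Variable R : realType.
Local Notation C := (Cplx R).
Local Notation Re := complex.Re.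
Local Notation Im := complex.Im.
Local Open Scope complex_scope.
Variables (r phi : R).
Hypothesis hr : 0 <= r < 1.

Definition disc_pole : R[i] := (r * cos phi) +i* (r * sin phi).

(** The inverse of [(b + 1/b) / 2] for [b = disc_pole]; the form of the quotient
    also covers [b = 0], the pole at infinity. *)
Definition inv_pole : R[i] := 2%:C * disc_pole / (1 + disc_pole * disc_pole).

Let b := disc_pole.
Let lam : R := normsq (1 + b * b) / (1 + r ^+ 2).

Let normsq_b : normsq b = r ^+ 2.
Proof.
rewrite /normsq /= !exprMn -mulrDr cos2Dsin2 mulr1 //.
Qed.

Let r2lt : 0 <= r ^+ 2 < 1.
Proof.
have /andP[r0 r1] := hr; rewrite sqr_ge0 expr2 /=.
by apply: le_lt_trans r1; rewrite ler_piMr // ltW // (andP hr).2.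
Qed.

Let bb_neq0 : 1 + b * b != 0.
Proof.
apply/eqP => E.
have : normsq (b * b) = 1.
  have -> : b * b = -1 by rewrite -[RHS]addr0 -E; ring.
  by rewrite /normsq !ReImE /=; ring.
rewrite normsqM normsq_b; move: (r ^+ 2) r2lt => y hy E1.
have := mulr_ge0 (andP hy).1 (andP hy).1; nra.
Qed.

Let n0 : 0 < normsq (1 + b * b).
Proof. by rewrite normsq_gt0. Qed.

Let r20 : 0 < 1 + r ^+ 2.
Proof. by rewrite ltr_pwDl ?sqr_ge0. Qed.

Let lam0 : 0 < lam.
Proof. exact: divr_gt0. Qed.

Let lamE (N : R) : lam * (N / normsq (1 + b * b)) = N / (1 + r ^+ 2).
Proof.
rewrite /lam; have := lt0r_neq0 n0; have := lt0r_neq0 r20.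
by move: (normsq _) (1 + r ^+ 2) => m k k0 m0; field; apply/andP.
Qed.

Let normsq_1bb : normsq (1 + b * b) =
  (1 - r ^+ 2) ^+ 2 + 4 * r ^+ 2 * cos phi ^+ 2.
Proof.
rewrite /normsq /b /disc_pole /=; have := cos2Dsin2 phi.
move: (cos phi) (sin phi) => c s /eqP; rewrite -subr_eq0 => /eqP E.
apply/eqP; rewrite -subr_eq0; apply/eqP.
transitivity ((c ^+ 2 + s ^+ 2 - 1) * (r ^+ 4 * (c ^+ 2 + s ^+ 2 + 1) - 2 * r ^+ 2)).
  by ring.
by rewrite E mul0r.
Qed.

(** The Joukowski map uniformises the square root; the right-hand side is the
    principal value because [|b| < 1]. *)
Let rt_inv_pole : rt inv_pole = (1 - b * b) / (1 + b * b).
Proof.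
apply: sqrtc_unique; last first.
  by rewrite /inv_pole -/b (_ : 2%:C = 2 :> R[i]); [field|apply: eqC => /=; ring].
rewrite Re_div divr_gt0 //.
have -> : Re ((1 - b * b) * (1 + b * b)^*) = 1 - normsq b ^+ 2.
  by rewrite /normsq; case: (b) => x y /=; ring.
rewrite normsq_b; move: (r ^+ 2) r2lt => y hy; nra.
Qed.

(** The common factor [|1 + b^2|^2 / (1 + r^2)] clears the denominators of all
    the quantities that enter [omega]. *)
Lemma inv_pole_lam : exists2 lam : R, 0 < lam & [/\
  lam * Re inv_pole = 2 * r * cos phi,
  lam * Re (rt inv_pole) = 1 - r ^+ 2 &
  lam * (Re (rt inv_pole) ^+ 2 + Re inv_pole ^+ 2) = 1 + r ^+ 2].
Proof.
have m0 := lt0r_neq0 n0; have r2 := lt0r_neq0 r20.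
have Ra : lam * Re inv_pole = 2 * r * cos phi.
  rewrite Re_div lamE.
  have -> : Re (2%:C * disc_pole * (1 + disc_pole * disc_pole)^*) =
     2 * Re b * (1 + normsq b).
    by rewrite /normsq /b; case: (disc_pole) => x y /=; ring.
  by rewrite normsq_b /=; field.
have Rt : lam * Re (rt inv_pole) = 1 - r ^+ 2.
  rewrite rt_inv_pole Re_div lamE.
  have -> : Re ((1 - b * b) * (1 + b * b)^*) = 1 - normsq b ^+ 2.
    by rewrite /normsq; case: (b) => x y /=; ring.
  by rewrite normsq_b; field.
exists lam => //; split => //.
apply: (mulfI (lt0r_neq0 lam0)).
have -> : lam * (lam * (Re (rt inv_pole) ^+ 2 + Re inv_pole ^+ 2)) =
  (lam * Re (rt inv_pole)) ^+ 2 + (lam * Re inv_pole) ^+ 2 by ring.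
by rewrite Ra Rt /lam divfK // normsq_1bb; ring.
Qed.

Lemma Re_rt_inv_pole_gt0 : 0 < Re (rt inv_pole).
Proof.
have [l l0 [_ h _]] := inv_pole_lam.
by rewrite -(pmulr_rgt0 _ l0) h subr_gt0 (andP r2lt).2.
Qed.

(** By [inv_pole_lam] the argument of the arctangent is [jX / jY]. *)
Lemma omega_inv_pole th : 0 < th < pi ->
  omega (cos th) inv_pole = 1 - joukowski_phase r phi th / pi.
Proof.
move=> hth; rewrite omegaE; have [l l0 [h1 h2 h3]] := inv_pole_lam.
have s0 : 0 < sin th by exact: sin_gt0_pi.
have -> : omega_slope (cos th) inv_pole = jX r phi th / jY r th.
  have -> : jX r phi th = l * omega_num (cos th) inv_pole.
    by rewrite /omega_num /jX -h1 -h3; ring.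
  have -> : jY r th = l * (Re (rt inv_pole) * Num.sqrt (1 - cos th ^+ 2)).
    rewrite /jY -h2 -sin2cos2 sqrtr_sqr ger0_norm; last exact: ltW.
    by ring.
  by rewrite -mulf_div divff ?mul1r // gt_eqF.
rewrite joukowski_phase_atan //; set A := joukowski_phase _ _ _.
have G (P : R) : P != 0 -> 2^-1 + (P / 2 - A) / P = 1 - A / P.
  by move=> P0; field.
by apply: G; rewrite gt_eqF // pi_gt0.
Qed.

Lemma cos_lt1_itv (th : R) : 0 < th < pi -> -1 < cos th < 1.
Proof.
move=> h; have := sin_gt0_pi h; have := cos2Dsin2 th => cs s0.
have : cos th ^+ 2 < 1 by nra.
by nra.
Qed.

(** The formula persists at the endpoints, where the phase takes the values 0
    and [pi]. *)
Lemma slit_measure_inv_pole (s : riemann_sphere R) th : 0 <= th <= pi ->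
  pinv s = inv_pole -> slit_measure (cos th) s = 1 - joukowski_phase r phi th / pi.
Proof.
move=> /andP[t0 tpi] sE; rewrite /slit_measure.
have pi0 : (pi : R) != 0 by rewrite gt_eqF // pi_gt0.
move: t0; rewrite le_eqVlt => /orP[/eqP <-|t0].
  by rewrite cos0 eqxx joukowski_phase0 mul0r subr0.
move: tpi; rewrite le_eqVlt => /orP[/eqP ->|tpi].
  have N : ((-1 : R) == 1) = false by apply/negbTE; rewrite lt_eqF //; lra.
  by rewrite cospi eqxx N joukowski_phase_pi divff // subrr.
have hth : 0 < th < pi by rewrite t0.
have /andP[c1 c2] := cos_lt1_itv hth.
by rewrite (lt_eqF c2) (gt_eqF c1) sE omega_inv_pole.
Qed.

(** The pair of poles contributes to the denominator of [w_n] the product of two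
    conjugate factors on the real line, hence the square of one modulus. *)
Lemma jXY_normsq : exists2 k : R, 0 < k & forall th,
  jX r phi th ^+ 2 + jY r th ^+ 2 = k * normsq (1 - inv_pole * (cos th)%:C).
Proof.
have [l l0 [h1 h2 h3]] := inv_pole_lam.
exists (l * (1 + r ^+ 2)); first by rewrite mulr_gt0.
move=> th; have E := omega_num_normsq (cos th) inv_pole; rewrite -sin2cos2 in E.
have X1 : jX r phi th = l * omega_num (cos th) inv_pole.
  by rewrite /omega_num /jX -h1 -h3; ring.
rewrite X1 /jY -h2 -h3 [inv_pole * _]mulrC.
transitivity (l * (l * (omega_num (cos th) inv_pole ^+ 2 +
  sin th ^+ 2 * Re (rt inv_pole) ^+ 2))); first by ring.
by rewrite E; ring.
Qed.

End Poles.

(** * Chebyshev polynomials *)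

Section Chebyshev.
Variable R : realType.
Implicit Types th : R.

Fixpoint cheb_pair (n : nat) : {poly R} * {poly R} :=
  if n is m.+1 then
    let: (p, q) := cheb_pair m in (q, 2%:P * 'X * q - p)
  else (1, 'X).

Definition cheb n := (cheb_pair n).1.

Lemma cheb_rec n : cheb n.+2 = 2%:P * 'X * cheb n.+1 - cheb n.
Proof. by rewrite /cheb /=; case: (cheb_pair n). Qed.

Lemma cheb_size n : (size (cheb n) <= n.+1)%N.
Proof.
suff : (size (cheb n) <= n.+1)%N /\ (size (cheb n.+1) <= n.+2)%N by case.
elim: n => [|n [h1 h2]].
  by rewrite /cheb /= size_poly1 size_polyX.
split => //; rewrite cheb_rec.
apply: (leq_trans (size_polyD _ _)); rewrite size_polyN geq_max.
apply/andP; split; last by apply: leq_trans h1 _; rewrite ltnW.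
rewrite mulrAC; apply: (leq_trans (size_polyMleq _ _)).
rewrite size_polyX addn2 /= ltnS.
apply: (leq_trans (size_polyMleq _ _)).
apply: (@leq_trans (1 + size (cheb n.+1)).-1); last by rewrite add1n.
by rewrite -!subn1 leq_sub2r // leq_add2r size_polyC_leq1.
Qed.

Lemma chebE n th : (cheb n).[cos th] = cos (n%:R * th).
Proof.
suff : (cheb n).[cos th] = cos (n%:R * th) /\
       (cheb n.+1).[cos th] = cos (n.+1%:R * th) by case.
elim: n => [|n [h1 h2]].
  by rewrite /cheb /= hornerC hornerX mul0r cos0 mul1r.
split => //; rewrite cheb_rec !hornerE h1 h2.
have e2 : n.+2%:R * th = n.+1%:R * th + th by rewrite -[in LHS]natr1; ring.
have e0 : n%:R * th = n.+1%:R * th - th by rewrite -natr1; ring.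
by rewrite e2 e0 cosB cosD; ring.
Qed.

End Chebyshev.

(** * Estimates for the sine and the harmonic sum *)

Section SineEstimates.
Variable R : realType.
Implicit Types (x y th : R).

Lemma sin_le_id y : 0 <= y -> sin y <= y.
Proof.
rewrite le_eqVlt => /orP[/eqP <-|y0]; first by rewrite sin0.
have [|c] := @MVT R (@sin R) (@cos R) 0 y y0 (fun c _ => is_derive_sin c).
  by apply: derivable_within_continuous => {}c _; have [] := is_derive_sin c.
move=> _; rewrite sin0 !subr0 => ->.
by rewrite -[leRHS]mul1r ler_pM2r // cos_le1.
Qed.

(** The difference of the two sides vanishes at 0 and has the derivative
    [u sin u]. *)
Lemma mul_cos_le_sin y : 0 <= y <= pi / 2 -> y * cos y <= sin y.
Proof.
move=> /andP[]; rewrite le_eqVlt => /orP[/eqP <- _|y0 ypi].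
  by rewrite mul0r sin0.
have D (c : R) : is_derive c 1 (fun u => sin u - u * cos u) (c * sin c).
  apply: is_derive_ext (is_deriveB (is_derive_sin c)
    (is_deriveM (is_derive_id c 1) (is_derive_cos c))) => //.
  by rewrite /GRing.scale /=; ring.
have [|c] := @MVT R (fun u => sin u - u * cos u) (fun u => u * sin u) 0 y y0
    (fun c _ => D c).
  by apply: derivable_within_continuous => {}c _; have [] := D c.
rewrite in_itv /= => /andP[c0 cy]; rewrite sin0 mul0r !subr0 => E.
rewrite -subr_ge0 E mulr_ge0 // ?mulr_ge0 ?ltW //.
apply: sin_gt0_pihalf; rewrite c0 /=; exact: lt_le_trans ypi.
Qed.

(** [sin y = 2 sin (y/2) cos (y/2) >= y cos (y/2)^2 = y (1 + cos y) / 2]. *)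
Lemma half_le_sin y : 0 <= y <= pi / 2 -> y / 2 <= sin y.
Proof.
move=> /andP[y0 ypi].
have p0 := pi_gt0 R.
have h : 0 <= y / 2 <= pi / 2 by lra.
have E : sin y = 2 * sin (y / 2) * cos (y / 2).
  by rewrite {1}(splitr y) sinD; ring.
have c2 : cos (y / 2) ^+ 2 = (1 + cos y) / 2.
  have := cos2Dsin2 (y / 2); rewrite [in cos y](splitr y) cosD; nra.
have cy : 0 <= cos y by apply: cos_ge0_pihalf; lra.
have ch : 0 <= cos (y / 2) by apply: cos_ge0_pihalf; lra.
have m := mul_cos_le_sin h; rewrite E.
apply: (@le_trans _ _ (y * cos (y / 2) ^+ 2)); first by rewrite c2; nra.
by have := ler_wpM2r ch m; nra.
Qed.

Lemma normr_sin_norm y : `|sin y| = `|sin `|y| |.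
Proof.
have [y0|/ltW y0] := leP 0 y; first by rewrite (ger0_norm y0).
by rewrite (ler0_norm y0) sinN normrN.
Qed.

Lemma normr_sin_le y : `|sin y| <= `|y|.
Proof.
rewrite normr_sin_norm ler_norml sin_le_id // andbT.
move: (normr_ge0 y); move: `|y| => u u0.
have [y1|/ltW y1] := leP 1 u; first by have := sin_geN1 u; lra.
apply: (@le_trans _ _ 0); first by rewrite oppr_le0.
apply: sin_ge0_pi; rewrite u0 /=; apply: le_trans y1 _.
by have := pi_ge2 R; lra.
Qed.

Lemma half_normr_le_sin y : `|y| <= pi / 2 -> `|y| / 2 <= `|sin y|.
Proof.
rewrite normr_sin_norm => h; apply: le_trans (ler_norm _).
by apply: half_le_sin; rewrite normr_ge0.
Qed.

Lemma cosB_prod x y :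
  cos x - cos y = - 2 * sin ((x + y) / 2) * sin ((x - y) / 2).
Proof.
have ex : x = (x + y) / 2 + (x - y) / 2 by field.
have ey : y = (x + y) / 2 - (x - y) / 2 by field.
by rewrite {1}ex {3}ey cosD cosB; ring.
Qed.

Variables (x y : R).
Hypotheses (hx : 0 <= x <= pi) (hy : 0 <= y <= pi).

Lemma sin_mid_ge0 : 0 <= sin ((x + y) / 2).
Proof. by apply: sin_ge0_pi; move: hx hy; lra. Qed.

Lemma normr_cosB : `|cos x - cos y| = 2 * sin ((x + y) / 2) * `|sin ((x - y) / 2)|.
Proof.
by rewrite cosB_prod !normrM normrN (ger0_norm sin_mid_ge0) normr_nat.
Qed.

Lemma normr_cosB_le : `|cos x - cos y| <= sin ((x + y) / 2) * `|x - y|.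
Proof.
rewrite normr_cosB mulrAC mulrC ler_wpM2l ?sin_mid_ge0 //.
have := normr_sin_le ((x - y) / 2); rewrite normrM (ger0_norm (_ : 0 <= 2^-1)) //.
by lra.
Qed.

(** Together with the upper bound this compares [cos x - cos y] with
    [(x - y) sin ((x + y) / 2)]; the midpoint keeps both bounds uniform up to
    the endpoints of the interval, where the sine vanishes. *)
Lemma normr_cosB_ge : sin ((x + y) / 2) * `|x - y| / 2 <= `|cos x - cos y|.
Proof.
rewrite normr_cosB mulrAC -mulrA [2 * _]mulrC -mulrA ler_wpM2l ?sin_mid_ge0 //.
have h : `|(x - y) / 2| <= pi / 2.
  rewrite normrM (ger0_norm (_ : 0 <= 2^-1)) // ler_pM2r // ler_norml; move: hx hy; lra.
have := half_normr_le_sin h; rewrite normrM (ger0_norm (_ : 0 <= 2^-1)) //.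
by lra.
Qed.

(** Halving the angles, the claim becomes [s c <= a c + b s] for
    [a = sin (x/2)], [b = cos (x/2)], [s = sin (y/2)], [c = cos (y/2)], and
    [a + b >= 1]. *)
Lemma sin_le_mid : sin y <= 2 * sin ((x + y) / 2).
Proof.
have e1 : sin y = 2 * sin (y / 2) * cos (y / 2).
  by rewrite {1}(splitr y) sinD; ring.
have e2 : sin ((x + y) / 2) =
    sin (x / 2) * cos (y / 2) + cos (x / 2) * sin (y / 2).
  by rewrite mulrDl sinD.
have p0 := pi_gt0 R; have hx' := hx; have hy' := hy.
have s1 : 0 <= sin (x / 2) by apply: sin_ge0_pi; lra.
have s2 : 0 <= sin (y / 2) by apply: sin_ge0_pi; lra.
have c1 : 0 <= cos (x / 2) by apply: cos_ge0_pihalf; lra.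
have c2 : 0 <= cos (y / 2) by apply: cos_ge0_pihalf; lra.
have := cos2Dsin2 (x / 2); have := cos_le1 (y / 2); have := sin_le1 (y / 2).
have := cos_le1 (x / 2); have := sin_le1 (x / 2).
rewrite e1 e2; move: s1 s2 c1 c2.
move: (sin (x / 2)) (sin (y / 2)) (cos (x / 2)) (cos (y / 2)).
move=> a s b c a0 s0 b0 c0 a1 b1 s1 c1 ab.
have h : 1 <= a + b by nra.
have h1 : s * c <= (a + b) * (s * c) by have := mulr_ge0 s0 c0; nra.
have h2 : a * (s * c) <= a * c by have := mulr_ge0 a0 c0; nra.
have h3 : b * (s * c) <= b * s by have := mulr_ge0 b0 s0; nra.
lra.
Qed.

End SineEstimates.

Section HarmonicSum.
Variable R : realType.

(** [1 / (n + 1) <= ln ((n + 1) / n)] by [ln (1 + t) <= t] with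
    [t = - 1 / (n + 1)]. *)
Lemma harmonic_le_ln n : (0 < n)%N ->
  \sum_(0 <= i < n) (i.+1%:R)^-1 <= 1 + ln (n%:R) :> R.
Proof.
case: n => // n _; elim: n => [|n IH]; first by rewrite big_nat1 invr1 ln1 addr0.
rewrite big_nat_recr //=; apply: le_trans (lerD IH (lexx _)) _.
rewrite -addrA lerD2l -lerBrDl.
have n1 : 0 < n.+1%:R :> R by rewrite ltr0n.
have n2 : 0 < n.+2%:R :> R by rewrite ltr0n.
have n10 := lt0r_neq0 n1; have n20 := lt0r_neq0 n2.
have h : -1 < - (n.+2%:R)^-1 :> R by rewrite ltrN2 invf_lt1 // ltr1n.
have := le_ln1Dx h.
have -> : 1 + - (n.+2%:R)^-1 = n.+1%:R / n.+2%:R :> R.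
  have e : n.+2%:R = n.+1%:R + 1 :> R by rewrite natr1.
  by rewrite e in n20 *; field.
rewrite ln_div ?posrE //.
move: (ln n.+1%:R) (ln n.+2%:R) (n.+2%:R^-1 : R) => a b c; lra.
Qed.

(** With truncated subtraction [(j - k) + (k - j)] is the distance of [j] and
    [k]; on each side of [j] the sum is a partial harmonic sum. *)
Lemma sum_dist_le n j : (j <= n)%N -> (0 < n)%N ->
  \sum_(k < n) (((j - k) + (k - j)).+1%:R)^-1 <= 2 * (1 + ln (n%:R)) :> R.
Proof.
move=> jn n0.
have H m : (m <= n)%N -> \sum_(0 <= i < m) (i.+1%:R)^-1 <= 1 + ln (n%:R) :> R.
  move=> mn; apply: le_trans (harmonic_le_ln n0).
  by rewrite [leRHS](big_cat_nat (leq0n m) mn) /= lerDl sumr_ge0.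
rewrite -(big_mkord predT (fun k => (((j - k) + (k - j)).+1%:R)^-1)).
rewrite (big_cat_nat (leq0n j) jn) /=.
have -> : 2 * (1 + ln (n%:R)) = (1 + ln (n%:R)) + (1 + ln (n%:R)) :> R by ring.
apply: lerD.
- apply: le_trans (H j jn); rewrite [leRHS]big_nat_rev /= add0n.
  apply: ler_sum_nat => k /andP[_ kj].
  rewrite lef_pV2 ?posrE ?ltr0n // ler_nat.
  by rewrite ltnS; lia.
- apply: le_trans (H (n - j)%N (leq_subr _ _)).
  rewrite -{1}[j]add0n big_addn; apply: ler_sum_nat => k _.
  by rewrite lef_pV2 ?posrE ?ltr0n // ler_nat ltnS; lia.
Qed.

End HarmonicSum.

(** * Nodes defined by a phase *)

Section ZerosOfCos.
Variable R : realType.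

Lemma normr_cos_sub_npi (n : nat) (y : R) : `|cos (n%:R * pi - y)| = `|cos y|.
Proof.
elim: n => [|n IH]; first by rewrite mul0r sub0r cosN.
by rewrite -natr1 mulrDl mul1r -addrAC cosDpi normrN.
Qed.

Lemma cos_half_nat (k : nat) : cos ((k%:R + 2^-1) * pi) = 0 :> R.
Proof.
apply/eqP; rewrite -normr_eq0 mulrDl -[2^-1 * _]opprK normr_cos_sub_npi.
by rewrite cosN mulrC cos_pihalf normr0.
Qed.

(** Removing the largest multiple of [pi] below [y] reduces to the interval
    [[0, pi]], where the cosine is injective. *)
Lemma cos_eq0_nat (n : nat) (y : R) : 0 <= y <= n%:R * pi -> cos y = 0 ->
  exists2 k : nat, (k < n)%N & y = (k%:R + 2^-1) * pi.
Proof.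
move=> /andP[y0 yn] cy; have p0 := pi_gt0 R.
have yp : 0 <= y / pi by rewrite divr_ge0 // ltW.
have /andP[k1 k2] := truncn_itv yp.
set k := Num.truncn (y / pi) in k1 k2.
rewrite ler_pdivlMr // in k1.
rewrite ltr_pdivrMr // -natr1 mulrDl mul1r in k2.
pose z := y - k%:R * pi.
have cz : cos z = cos (pi / 2).
  apply/eqP; rewrite cos_pihalf -normr_eq0 -cosN opprB normr_cos_sub_npi.
  by rewrite cy normr0.
have zE : z = pi / 2.
  by apply: cos_inj cz; rewrite in_itv /= /z; lra.
exists k; last by rewrite mulrDl [2^-1 * _]mulrC -zE /z; ring.
rewrite -(ltr_nat R) -(ltr_pM2r p0); apply: lt_le_trans yn.
by rewrite -subr_gt0 -/z zE divr_gt0.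
Qed.

End ZerosOfCos.

Section Nodes.
Variable R : realType.
Variables (n : nat) (Phi : R -> R).
Hypothesis Phi_cont : continuous Phi.
Hypothesis Phi0 : Phi 0 = 0.
Hypothesis Phi_pi : Phi pi = n%:R * pi.
Hypothesis Phi_lip : forall a b : R, a <= b ->
  n%:R / 2 * (b - a) <= Phi b - Phi a <= 2 * n%:R * (b - a).

(** [Phi] runs from 0 to [n pi], so it takes the value [(k + 1/2) pi] for each
    [k < n]. *)
Lemma node_exists (k : 'I_n) :
  exists th, 0 <= th <= pi /\ Phi th = (k%:R + 2^-1) * pi.
Proof.
have p0 := pi_gt0 R.
have [||th] := @IVT R Phi 0 pi ((k%:R + 2^-1) * pi) (ltW p0).
- exact: continuous_subspaceT.
- rewrite Phi0 Phi_pi.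
  have np : 0 <= n%:R * pi :> R by rewrite mulr_ge0 // ltW.
  have kp : 0 <= k%:R :> R by [].
  have kn : k%:R + 1 <= n%:R :> R by rewrite natr1 ler_nat.
  rewrite (min_idPl np) (max_idPr np); apply/andP; split.
    by rewrite mulr_ge0 ?ltW //; lra.
  by rewrite ler_pM2r //; lra.
by rewrite in_itv /= => h E; exists th.
Qed.

Definition node_angle (k : 'I_n) : R := sval (cid (node_exists k)).

Lemma node_angle_itv k : 0 <= node_angle k <= pi.
Proof. by rewrite /node_angle; case: cid => th []. Qed.

Lemma Phi_node k : Phi (node_angle k) = (k%:R + 2^-1) * pi.
Proof. by rewrite /node_angle; case: cid => th []. Qed.

Definition node (k : 'I_n) : R := cos (node_angle k).

Lemma Phi_incr a b : Phi a < Phi b -> a < b.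
Proof.
move=> ab; rewrite ltNge; apply/negP => ba; have /andP[h _] := Phi_lip ba.
have h' : 0 <= n%:R / 2 * (a - b) by rewrite mulr_ge0 ?divr_ge0 ?subr_ge0.
by have := le_trans h' h; rewrite subr_ge0 leNgt ab.
Qed.

Lemma node_decr (i j : 'I_n) : (i < j)%N -> node j < node i.
Proof.
move=> ij.
have h : node_angle i < node_angle j.
  by apply: Phi_incr; rewrite !Phi_node ltr_pM2r ?pi_gt0 // ltrD2r ltr_nat.
by rewrite /node ltr_cos // in_itv /=; exact: node_angle_itv.
Qed.

Lemma node_inj : injective node.
Proof.
move=> i j E; apply/val_inj/eqP; rewrite eqn_leq leqNgt [X in _ && X]leqNgt.
by apply/andP; split; apply/negP => /node_decr; rewrite E ltxx.
Qed.

Lemma node_itv k : -1 <= node k <= 1.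
Proof. by rewrite cos_geN1 cos_le1. Qed.

Lemma Phi_itv th : 0 <= th <= pi -> 0 <= Phi th <= n%:R * pi.
Proof.
move=> /andP[t0 t1]; have /andP[h0 _] := Phi_lip t0; have /andP[h1 _] := Phi_lip t1.
rewrite Phi0 in h0; rewrite Phi_pi in h1.
have e0 : 0 <= n%:R / 2 * (th - 0).
  by rewrite mulr_ge0 ?divr_ge0 ?subr0.
have e1 : 0 <= n%:R / 2 * (pi - th) by rewrite mulr_ge0 ?divr_ge0 ?subr_ge0.
lra.
Qed.

Lemma cos_Phi_eq0 th : 0 <= th <= pi -> cos (Phi th) = 0 ->
  exists k, cos th = node k.
Proof.
move=> h c0; have [k kn E] := cos_eq0_nat (Phi_itv h) c0.
exists (Ordinal kn); congr cos.
have {}E : Phi th = Phi (node_angle (Ordinal kn)) by rewrite E Phi_node.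
have n0 : 0 < n%:R :> R by rewrite ltr0n; exact: (leq_ltn_trans (leq0n k) kn).
apply/eqP; rewrite eq_le !leNgt; apply/andP; split; apply/negP => lt.
  have /andP[h1 _] := Phi_lip (ltW lt).
  by move: h1; rewrite E subrr leNgt mulr_gt0 ?divr_gt0 ?subr_gt0.
have /andP[h1 _] := Phi_lip (ltW lt).
by move: h1; rewrite E subrr leNgt mulr_gt0 ?divr_gt0 ?subr_gt0.
Qed.

Lemma cos_Phi_node k : cos (Phi (node_angle k)) = 0.
Proof. by rewrite Phi_node cos_half_nat. Qed.

(** [cos (n pi - Phi)] and [cos Phi] have the same modulus, hence the same
    zeros. *)
Lemma zero_row_node (a : 'I_n -> Cplx R) :
  (forall th, 0 <= th <= pi -> varpi a (cos th) = cos (n%:R * pi - Phi th)) ->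
  zero_row a node.
Proof.
move=> H; split; first exact: node_decr.
apply/seteqP; split => t /=.
  move=> [k _ <-]; split; first by rewrite in_itv /= node_itv.
  rewrite H ?node_angle_itv //; apply/eqP.
  by rewrite -normr_eq0 normr_cos_sub_npi cos_Phi_node normr0.
rewrite in_itv /= => -[ht v0].
have tI : t \in `[-1, 1] by rewrite in_itv.
have th : 0 <= acos t <= pi by rewrite acos_ge0 // acos_lepi.
move: v0; rewrite -[t](acosK tI) H // => /eqP.
rewrite -normr_eq0 normr_cos_sub_npi normr_eq0 => /eqP /(cos_Phi_eq0 th)[k ->].
by exists k.
Qed.

(** [Phi] takes an odd multiple of [pi / 2] at a node, so shifting by it
    exchanges cosine and sine. *)
Lemma normr_cos_Phi_node k th :
  `|cos (Phi th)| = `|sin (Phi th - Phi (node_angle k))|.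
Proof.
have c0 := cos_Phi_node k.
have : sin (Phi (node_angle k)) ^+ 2 = 1.
  by have := cos2Dsin2 (Phi (node_angle k)); rewrite c0 expr0n add0r.
move=> /eqP; rewrite sqrf_eq1 => s1.
rewrite sinB c0 mulr0 sub0r normrN normrM.
by case/orP: s1 => /eqP ->; rewrite ?normrN normr1 mulr1.
Qed.

Lemma Phi_dist th k :
  n%:R / 2 * `|th - node_angle k| <= `|Phi th - Phi (node_angle k)| <=
  2 * n%:R * `|th - node_angle k|.
Proof.
have n0 : 0 <= n%:R :> R by [].
have [h|/ltW h] := leP (node_angle k) th.
  have /andP[h1 h2] := Phi_lip h.
  rewrite (ger0_norm (_ : 0 <= th - _)) ?subr_ge0 // ger0_norm ?h1 //.
  by apply: le_trans h1; rewrite mulr_ge0 ?divr_ge0 ?subr_ge0.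
rewrite distrC [`|Phi th - _|]distrC.
have /andP[h1 h2] := Phi_lip h.
rewrite (ger0_norm (_ : 0 <= _ - th)) ?subr_ge0 // ger0_norm ?h1 //.
by apply: le_trans h1; rewrite mulr_ge0 ?divr_ge0 ?subr_ge0.
Qed.

(** Both [Phi th / pi] and [k + 1/2] are known up to the integers [j] and [k];
    the error of at most 1/2 is absorbed by the factor [pi >= 2] as soon as [k]
    differs from [j]. *)
Lemma Phi_dist_index th (k : 'I_n) : 0 <= th <= pi ->
  let j := Num.truncn (Phi th / pi) in
  (j <= n)%N /\ 
  (k%:R != j%:R :> R -> ((j - k) + (k - j))%:R <= `|Phi th - Phi (node_angle k)|).
Proof.
move=> h j; have p0 := pi_gt0 R; have /andP[P0 P1] := Phi_itv h.
have yp : 0 <= Phi th / pi by rewrite divr_ge0 // ltW.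
have /andP[] := truncn_itv yp; rewrite -/j => j1 j2.
split.
  rewrite -(ler_nat R); apply: le_trans j1 _; rewrite ler_pdivrMr //.
have -> : Phi th - Phi (node_angle k) = (Phi th / pi - (k%:R + 2^-1)) * pi.
  by rewrite Phi_node mulrBl divfK // gt_eqF.
rewrite normrM (gtr0_norm p0) => kj.
have p2 := pi_ge2 R.
move: j1 j2; set y := Phi th / pi => j1 j2.
rewrite -natr1 in j2.
suff : ((j - k + (k - j))%:R / 2 : R) <= `|y - (k%:R + 2^-1)|.
  move=> H; have := ler_wpM2r (ltW p0) H; apply: le_trans.
  rewrite mulrAC ler_pdivlMr // ler_wpM2l //.
have [jk|jk] := leqP j k.
  have -> : (j - k + (k - j))%:R = k%:R - j%:R :> R.
    by rewrite (eqP (jk : (j - k == 0)%N)) add0n natrB.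
  have : j%:R + 1 <= k%:R :> R.
    rewrite natr1 ler_nat ltn_neqAle jk andbT; apply: contra_neq kj => <-//.
  rewrite distrC => kj1; apply: le_trans (ler_norm _); lra.
have -> : (j - k + (k - j))%:R = j%:R - k%:R :> R.
  by rewrite (eqP (ltnW jk : (k - j == 0)%N)) addn0 natrB // ltnW.
have : k%:R + 1 <= j%:R :> R by rewrite natr1 ler_nat.
move=> kj1; apply: le_trans (ler_norm _); lra.
Qed.

End Nodes.

(** * Lagrange functions of linear fractions *)

Section LinearFactors.
Variable K : numFieldType.
Implicit Types (f G Q : K -> K) (x t : K).

Lemma continuous_prod_at (I : Type) (r : seq I) (P : pred I) (F : I -> K -> K) t :
  (forall i, P i -> {for t, continuous (F i)}) ->
  {for t, continuous (fun z => \prod_(i <- r | P i) F i z)}.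
Proof.
move=> cF; elim: r => [|i r IH].
  have -> : (fun z => \prod_(i <- [::] | P i) F i z) = cst 1.
    by apply/funext => z; rewrite big_nil.
  exact: cst_continuous.
have -> : (fun z => \prod_(j <- i :: r | P j) F j z) =
    (fun z => (if P i then F i z else 1) * \prod_(j <- r | P j) F j z).
  by apply/funext => z; rewrite big_cons; case: ifP; rewrite ?mul1r.
apply: continuousM IH; case Pi : (P i); first exact: cF.
exact: cst_continuous.
Qed.

Lemma continuous_linear_fractions (I : finType) (P : pred I) (b c : I -> K) (d t : K) :
  (forall i, 1 - c i * t != 0) -> 1 - d * t != 0 ->
  {for t, continuous (fun z =>
    \prod_(i | P i) ((z - b i) / (1 - c i * z)) / (1 - d * z))}.
Proof.
move=> c0 d0.
have den (e : K) : {for t, continuous (fun z => 1 - e * z)}.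
  apply: continuousB; first exact: cst_continuous.
  by apply: continuousM; [exact: cst_continuous|exact: cvg_id].
apply: continuousM; last by apply: continuousV; [exact: d0|exact: den].
apply: continuous_prod_at => i _.
apply: continuousM; last by apply: continuousV; [exact: c0|exact: den].
by apply: continuousB; [exact: cvg_id|exact: cst_continuous].
Qed.

(** The difference quotient at the zero is [G] itself, so continuity of [G] is
    all that differentiability takes. *)
Lemma derive1_simple_zero f G x0 : (forall z, f z = (z - x0) * G z) ->
  {for x0, continuous G} -> derive1 f x0 = G x0.
Proof.
move=> fE cG; rewrite /derive1; apply: cvg_lim; first exact: norm_hausdorff.
have S : {for (0 : K), continuous (fun h => h + x0)}.
  by apply: continuousD; [exact: cvg_id|exact: cst_continuous].
have L : G (h + x0) @[h --> (0 : K)^'] --> G x0.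
  have cG' : {for 0 + x0, continuous G} by rewrite add0r.
  have := continuous_comp S cG'; rewrite /prop_for /continuous_at /= add0r.
  by apply: cvg_trans; apply: cvg_fmap2; exact: cvg_within.
apply: cvg_trans L; apply: near_eq_cvg.
rewrite near_withinE; apply: filterE => h h0.
by rewrite (fE x0) subrr mul0r subr0 /= fE addrK /GRing.scale /= mulKf.
Qed.

Lemma lim_ratio_eq1 Q G x0 : (forall z, z != x0 -> Q z = G z / G x0) ->
  G x0 != 0 -> {for x0, continuous G} -> lim (Q z @[z --> x0^']) = 1.
Proof.
move=> QE G0 cG; apply: cvg_lim; first exact: norm_hausdorff.
have L : G y / G x0 @[y --> x0^'] --> (1 : K).
  have := continuousM cG (@cst_continuous K K (G x0)^-1 x0).
  rewrite /prop_for /continuous_at /= divff //.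
  by apply: cvg_trans; apply: cvg_fmap2; exact: cvg_within.
apply: cvg_trans L; apply: near_eq_cvg.
by rewrite near_withinE; apply: filterE => y /QE.
Qed.

End LinearFactors.

(** * The Lebesgue constant of a phase of linear growth *)

Section LebesgueBound.
Variable R : realType.
Local Notation C := (Cplx R).
Local Notation normc := ComplexField.Normc.normc.
Local Open Scope complex_scope.
Variables (n : nat) (Phi : R -> R).
Hypothesis Phi_cont : continuous Phi.
Hypothesis Phi0 : Phi 0 = 0.
Hypothesis Phi_pi : Phi pi = n%:R * pi.
Hypothesis Phi_lip : forall a b : R, a <= b ->
  n%:R / 2 * (b - a) <= Phi b - Phi a <= 2 * n%:R * (b - a).
Local Notation th := (node_angle Phi_cont Phi0 Phi_pi).
Local Notation x := (node Phi_cont Phi0 Phi_pi).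
Variable a : 'I_n -> C.
Hypothesis a_slit : forall k (t : R), -1 <= t <= 1 -> 1 - a k * t%:C != 0.
Variable kappa : R.
Hypothesis kappa0 : 0 < kappa.
Hypothesis w_Phi : forall u, 0 <= u <= pi ->
  normc (wfun x a (cos u)%:C) = kappa * `|cos (Phi u)|.

(** [w_n] divided by its factor [z - x_k]; the denominators are all kept. *)
Definition cofac (k : 'I_n) (z : C) : C :=
  \prod_(i < n | i != k) ((z - cplx_of_real (x i)) / (1 - a i * z)) / (1 - a k * z).

Lemma wfun_cofac k z : wfun x a z = (z - cplx_of_real (x k)) * cofac k z.
Proof.
by rewrite /wfun (bigD1 k) //= /cofac; ring.
Qed.

Lemma cofac_cvg k (t : R) : -1 <= t <= 1 ->
  {for (t%:C : C), continuous (cofac k)}.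
Proof.
move=> ht; apply: (@continuous_linear_fractions C 'I_n (fun i => i != k)
  (fun i => cplx_of_real (x i)) a (a k) (t%:C : C)) => [i|]; exact: a_slit.
Qed.

Lemma x_itv k : -1 <= x k <= 1.
Proof. exact: node_itv. Qed.

Lemma derive1_wfun k :
  derive1 (wfun x a) (cplx_of_real (x k)) = cofac k (cplx_of_real (x k)).
Proof.
apply: (derive1_simple_zero (wfun_cofac k)).
by apply: cofac_cvg; exact: x_itv.
Qed.

(** Both numerator and derivative of [w_n] are expressed by the cofactor, and
    the value at the node itself, defined as a limit, follows the same
    formula. *)
Lemma ell_cofac k (t : R) : -1 <= t <= 1 -> cofac k (x k)%:C != 0 ->
  ell x a k t%:C = cofac k t%:C / cofac k (x k)%:C.
Proof.
move=> ht c0.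
have Q (z : C) : z != (x k)%:C -> ell_quotient x a k z = cofac k z / cofac k (x k)%:C.
  move=> zx; rewrite /ell_quotient derive1_wfun (wfun_cofac k).
  by rewrite [_ * cofac k z]mulrC -mulf_div divff ?mulr1 // subr_eq0.
rewrite /ell; case: eqVneq => [->|tx]; last exact: Q.
rewrite divff //; apply: (lim_ratio_eq1 Q c0).
by apply: cofac_cvg; exact: x_itv.
Qed.

Lemma normc_cofac k u : 0 <= u <= pi ->
  `|cos u - x k| * normc (cofac k (cos u)%:C) = kappa * `|cos (Phi u)|.
Proof.
move=> hu; rewrite -w_Phi // (wfun_cofac k).
rewrite [RHS]normcM; congr (_ * _).
by rewrite /cplx_of_real -rmorphB /= expr0n addr0 sqrtr_sqr.
Qed.

Lemma cvg_real_normc (T : Type) (F : set_system T) (FF : Filter F) (f : T -> C) (l : C) :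
  f q @[q --> F] --> l -> normc (f q) @[q --> F] --> normc l.
Proof.
move=> fl; apply/cvgrPdist_lt => e e0.
have N : nbhs l (fun w : C => `|normc l - normc w| < e).
  apply/nbhs_CplxP; exists e => // w h; apply: le_lt_trans h.
  have h1 := le_normcD (l - w) w; rewrite subrK in h1.
  have h2 := le_normcD (w - l) l; rewrite subrK in h2.
  rewrite -opprB normcN in h2.
  rewrite ler_norml; apply/andP; split; lra.
exact: (fl _ N).
Qed.

Lemma continuous_real_complex (t : R) : s%:C @[s --> t] --> (t%:C : C).
Proof.
move=> A /nbhs_CplxP[e e0 eA].
have N : nbhs t (ball t e) by exact: nbhsx_ballx.
apply: filterS N => s; rewrite -ball_normE /ball_ /= => h; apply: eA.
by rewrite -rmorphB /= expr0n addr0 sqrtr_sqr.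
Qed.

(** Let [u] approach the angle of the node in
    [|cofac| |cos u - x_k| = kappa |sin (Phi u - Phi th_k)|]: the right side is
    at least [kappa n / 4] times [|u - th_k|], while [|cos u - x_k|] is at most
    [sin ((u + th_k) / 2)] times it. The lower bound on the slope of [Phi] thus
    does the work of its derivative at the node. *)
Lemma cofac_lower k : kappa * n%:R / 4 <= normc (cofac k (x k)%:C) * sin (th k).
Proof.
have hk := node_angle_itv Phi_cont Phi0 Phi_pi k.
have p0 := pi_gt0 R.
pose g (u : R) := normc (cofac k (cos u)%:C) * sin ((u + th k) / 2).
have gk : g (th k) = normc (cofac k (x k)%:C) * sin (th k).
  by rewrite /g (_ : (th k + th k) / 2 = th k) //; field.
have gc : g u @[u --> th k] --> g (th k).
  apply: cvgM.
    apply: cvg_real_normc.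
    have S : (cos u)%:C @[u --> th k] --> ((x k)%:C : C).
      apply: (@cvg_comp _ _ _ (@cos R) (fun s : R => s%:C : C)).
        exact: continuous_cos.
      exact: continuous_real_complex.
    by apply: (cvg_comp _ (cofac k) S); apply: cofac_cvg; exact: x_itv.
  apply: (@cvg_comp _ _ _ (fun u : R => (u + th k) / 2) (@sin R)); last first.
    exact: continuous_sin.
  apply: cvgM; last exact: cvg_cst.
  by apply: cvgD; [exact: cvg_id|exact: cvg_cst].
rewrite -gk leNgt; apply/negP => lt.
have N1 : \forall u \near th k, g u < kappa * n%:R / 4 by exact: (cvgr_lt _ gc _ lt).
have N2 : \forall u \near th k, `|Phi u - Phi (th k)| < pi / 2.
  have p2 : 0 < pi / 2 :> R by rewrite divr_gt0.
  have /cvgrPdist_lt/(_ _ p2) N := @Phi_cont (th k).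
  by apply: filterS N => u; rewrite distrC.
have [e /= e0 H] := (nbhs_ballP (th k) _).1 (filterI N1 N2).
pose d : R := Num.min (e / 2) (pi / 2).
have d0 : 0 < d by rewrite lt_min !divr_gt0.
have de : d < e by rewrite gt_min ltr_pdivrMr // ltr_pMr // ltr1n.
have dp : d <= pi / 2 by rewrite ge_min lexx orbT.
(* The node may be close to an endpoint of [0, pi], so the point u is taken on
   the side of the midpoint. *)
have [u [hu uk]] : exists u, 0 <= u <= pi /\ `|u - th k| = d.
  have [h|h] := leP (th k) (pi / 2).
    exists (th k + d); rewrite addrAC subrr add0r gtr0_norm //; split=> //.
    by move/andP: hk => [h1 h2]; apply/andP; split; lra.
  exists (th k - d); rewrite addrAC subrr add0r normrN gtr0_norm //; split=> //.
  by move/andP: hk => [h1 h2]; apply/andP; split; lra.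
have [/= g1 g2] : g u < kappa * n%:R / 4 /\ `|Phi u - Phi (th k)| < pi / 2.
  by apply: H; rewrite -ball_normE /ball_ /= distrC uk.
have s1 := half_normr_le_sin (ltW g2).
have /andP[s2 _] := Phi_dist Phi_cont Phi0 Phi_pi Phi_lip u k.
have E := normc_cofac k hu.
rewrite (normr_cos_Phi_node Phi_cont Phi0 Phi_pi k) in E.
have cl := normr_cosB_le hu hk; rewrite -/(x k) uk in cl.
rewrite uk in s2.
have m0 := normc_ge0 (cofac k (cos u)%:C).
have : kappa * (n%:R / 2 * d / 2) <= g u * d.
  apply: (@le_trans _ _ (kappa * `|sin (Phi u - Phi (th k))|)).
    by rewrite ler_pM2l //; apply: le_trans s1; rewrite ler_pM2r.
  rewrite -E /g mulrC -mulrA; exact: ler_wpM2l.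
have -> : kappa * (n%:R / 2 * d / 2) = kappa * n%:R / 4 * d by field.
by rewrite ler_pM2r // leNgt g1.
Qed.

Hypothesis n0 : (0 < n)%N.

Lemma cofac_neq0 k : 0 < normc (cofac k (x k)%:C) /\ 0 < sin (th k).
Proof.
have hk := node_angle_itv Phi_cont Phi0 Phi_pi k.
have s0 := sin_ge0_pi hk; have m0 := normc_ge0 (cofac k (x k)%:C).
have : 0 < normc (cofac k (x k)%:C) * sin (th k).
  apply: lt_le_trans (cofac_lower k).
  by rewrite divr_gt0 // mulr_gt0 // ltr0n.
rewrite !lt_neqAle m0 s0 !andbT => /andP[+ _].
by rewrite eq_sym mulf_eq0 negb_or => /andP[h1 h2]; rewrite ![0 == _]eq_sym.
Qed.

(** [|l_k|] is a quotient of cofactors; the numerator is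
    [kappa |cos Phi| / |cos u - x_k|] and the denominator at least
    [kappa n / (4 sin th_k)]. *)
Lemma ell_dist_bound k u : 0 <= u <= pi ->
  `|u - th k| * (n%:R * normc (ell x a k (cos u)%:C)) <= 32 * `|cos (Phi u)|.
Proof.
move=> hu; have hk := node_angle_itv Phi_cont Phi0 Phi_pi k.
have [c0 s0] := cofac_neq0 k.
have cn : cofac k (x k)%:C != 0.
  by apply/eqP => E; move: c0; rewrite E /= expr0n addr0 sqrtr0 ltxx.
rewrite ell_cofac // ?cos_geN1 ?cos_le1 // normcM ComplexField.Normc.normcV.
set m := normc (cofac k (cos u)%:C); set mk := normc _ in c0 *.
have m0 : 0 <= m by exact: normc_ge0.
have low := cofac_lower k; rewrite -/mk in low.
have E := normc_cofac k hu; rewrite -/m in E.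
have cg := normr_cosB_ge hu hk; rewrite -/(x k) in cg.
have sm := sin_le_mid hu hk.
have S0 := sin_mid_ge0 hu hk.
set S := sin _ in S0 sm cg; set d := `|u - th k| in cg *.
have d0 : 0 <= d by exact: normr_ge0.
have n0' : 0 < n%:R :> R by rewrite ltr0n.
rewrite mulrA mulrCA !mulrA ler_pdivrMr //.
(* The sine at the node is replaced by twice the sine at the midpoint, which is
   the one that cos u - cos (th k) contains. *)
have h1 : sin (th k) * d <= 4 * `|cos u - x k|.
  by have := ler_wpM2r d0 sm; lra.
have h2 : sin (th k) * d * m <= 4 * (kappa * `|cos (Phi u)|).
  by have := ler_wpM2r m0 h1; rewrite -[4 * _ * m]mulrA E.
have h3 : kappa * n%:R * d * m <= 4 * mk * (sin (th k) * d * m).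
  have := ler_wpM2r (mulr_ge0 d0 m0) low; lra.
have h4 : 4 * mk * (sin (th k) * d * m) <= 4 * mk * (4 * (kappa * `|cos (Phi u)|)).
  by rewrite ler_wpM2l // mulr_ge0 // ltW.
have h5 := le_trans h3 h4.
rewrite -(ler_pM2l kappa0).
have c1 : 0 <= `|cos (Phi u)| by exact: normr_ge0.
have : 0 <= kappa * (mk * `|cos (Phi u)|) by rewrite !mulr_ge0 // ltW.
lra.
Qed.

(** [|u - th_k|] is at least [D / (2 n)] for [D = |Phi u - Phi th_k|], so
    [D |l_k| <= 64 |cos Phi u|]. Since [|cos Phi u| <= D], always [|l_k| <= 64];
    if moreover [k] differs from [j], then [D] is at least [|k - j|]. *)
Lemma ell_bound k u j : 0 <= u <= pi -> j = Num.truncn (Phi u / pi) ->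
  normc (ell x a k (cos u)%:C) <= 128 / ((j - k) + (k - j)).+1%:R.
Proof.
move=> hu jE; have E := ell_dist_bound k hu.
have /andP[_ D2] := Phi_dist Phi_cont Phi0 Phi_pi Phi_lip u k.
have [_ I] := Phi_dist_index Phi_cont Phi0 Phi_pi Phi_lip k hu.
rewrite -jE in I.
set e := normc _ in E *; set d := `|u - th k| in E D2.
have e0 : 0 <= e by exact: normc_ge0.
have n0' : 0 < n%:R :> R by rewrite ltr0n.
have d0 : 0 <= d by exact: normr_ge0.
set D := `|Phi u - Phi (th k)| in D2 I.
have E2 : D * e <= 64 * `|cos (Phi u)|.
  have := ler_wpM2r e0 D2; rewrite -mulrA [_ * e]mulrC.
  by move=> h; apply: le_trans h _; move: E; lra.
have c1 : `|cos (Phi u)| <= 1 by rewrite ler_norml cos_geN1 cos_le1.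
have b1 : e <= 64.
  have [D0|D0] := ltP 0 D.
    have c2 : `|cos (Phi u)| <= D.
      by rewrite (normr_cos_Phi_node Phi_cont Phi0 Phi_pi k) normr_sin_le.
    by rewrite -(ler_pM2l D0); apply: le_trans E2 _; rewrite mulrC ler_pM2r.
  have D1 : D = 0 by apply/eqP; rewrite eq_le D0 normr_ge0.
  have /andP[D3 _] := Phi_dist Phi_cont Phi0 Phi_pi Phi_lip u k.
  rewrite -/D D1 -/d in D3.
  have d1 : d = 0.
    apply/eqP; rewrite eq_le d0 andbT -(@pmulr_rle0 _ (n%:R / 2)) //.
    by rewrite divr_gt0.
  have uk : u = th k by apply/eqP; rewrite -subr_eq0 -normr_eq0 -/d d1.
  have [k0 _] := cofac_neq0 k.
  have cn : cofac k (x k)%:C != 0.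
    by apply/eqP => E'; move: k0; rewrite E' /= expr0n addr0 sqrtr0 ltxx.
  rewrite /e uk ell_cofac // ?x_itv // -/(x k) divff //=.
  by rewrite expr1n expr0n addr0 sqrtr1 ler1n.
have [jk|jk] := eqVneq (k%:R : R) j%:R.
  move: jk => /eqP; rewrite eqr_nat => /eqP jk.
  rewrite -jk subnn.
  by rewrite divr1; lra.
have := I jk; set q := (_ + _)%N => qD.
have q1 : (1 <= q)%N.
  by rewrite /q; move: jk; rewrite eqr_nat; clear; lia.
rewrite ler_pdivlMr ?ltr0n // -natr1.
have q1' : 1 <= q%:R :> R by rewrite ler1n.
have h1 : q%:R * e <= D * e by rewrite ler_wpM2r.
nra.
Qed.

Lemma lebesgue_constant_bound :
  (lebesgue_constant x a <= (256 * (1 + ln n%:R))%:E)%E.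
Proof.
apply: ge_ereal_sup => _ [t ht <-]; rewrite lee_fin.
have tI : -1 <= t <= 1 by move: ht; rewrite /= in_itv.
have hu : 0 <= acos t <= pi by rewrite acos_ge0 // acos_lepi.
have tE : t = cos (acos t) by rewrite acosK // in_itv.
rewrite tE; set u := acos t in hu *.
have [jn _] := Phi_dist_index Phi_cont Phi0 Phi_pi Phi_lip (Ordinal n0) hu.
apply: (@le_trans _ _ (\sum_(k < n) 128 / ((Num.truncn (Phi u / pi) - k) +
   (k - Num.truncn (Phi u / pi))).+1%:R)).
  by apply: ler_sum => k _; exact: ell_bound.
rewrite -mulr_sumr.
have := sum_dist_le R jn n0; lra.
Qed.

End LebesgueBound.

(** * One row of poles *)

Section Rows.
Variable R : realType.
Local Notation C := (Cplx R).
Local Notation Re := complex.Re.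
Local Notation Im := complex.Im.
Local Notation normc := ComplexField.Normc.normc.
Local Notation sphere := (riemann_sphere R).
Local Notation B := (@slit_sphere R).
Local Open Scope complex_scope.

Lemma Re_rt_conj (z : R[i]) : Re (rt z^*) = Re (rt z).
Proof.
case: z => u v; rewrite !Re_sqrtc /normsq /=.
by congr (Num.sqrt ((Num.sqrt (_ + _) + _) / 2)); ring.
Qed.

Lemma omega_conj (x : R) (z : R[i]) : omega x z^* = omega x z.
Proof. by rewrite /omega /omega_num Re_rt_conj; case: z. Qed.

Lemma Re_rt0 : 0 < Re (rt (0 : R[i])).
Proof. by rewrite /rt mulr0 subr0 sqrtc1 /= ltr01. Qed.

Lemma inv_pole_r0 (phi : R) : inv_pole 0 phi = 0.
Proof.
rewrite /inv_pole (_ : disc_pole 0 phi = 0) ?mulr0 ?mul0r //.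
by apply: eqC; rewrite /= mul0r.
Qed.

Lemma joukowski_phase_continuous (r phi : R) : 0 <= r < 1 ->
  continuous (joukowski_phase r phi).
Proof.
move=> hr th.
have E : joukowski_phase r phi =
   (fun u => 2^-1 * (blaschke_phase r (u - phi) + blaschke_phase r (u + phi))).
  by apply/funext => u; rewrite -joukowski_phaseE mulKf.
have cB : continuous (blaschke_phase r).
  move=> u; apply/differentiable_continuous/derivable1_diffP.
  by have [] := is_derive_blaschke_phase u hr.
rewrite E; apply: cvgM; first exact: cvg_cst.
apply: cvgD.
  apply: (@cvg_comp _ _ _ (fun u => u - phi) (blaschke_phase r)); last exact: cB.
  by apply: cvgB; [exact: cvg_id|exact: cvg_cst].
apply: (@cvg_comp _ _ _ (fun u => u + phi) (blaschke_phase r)); last exact: cB.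
by apply: cvgD; [exact: cvg_id|exact: cvg_cst].
Qed.

(** The conjugate pair occupies the first two places; 0 is the inverse of the
    pole at infinity. *)
Definition pole_row (r phi : R) (n : nat) (k : 'I_n) : C :=
  if (k == 0 :> nat)%N then inv_pole r phi
  else if (k == 1 :> nat)%N then (inv_pole r phi)^* else 0.

(** Each pole at infinity contributes [th], each of the two finite ones the
    Joukowski phase. *)
Definition row_phase (r phi : R) (n : nat) (th : R) : R :=
  n%:R * th + 2 * (joukowski_phase r phi th - th).

Section OneRow.
Variables (r phi : R) (n : nat).
Hypothesis hr : 0 <= r < 1.
(* The second alternative bounds the peak of the Poisson kernel by n / 2. *)
Hypothesis hn : r = 0 \/ (4 <= n)%N /\ 4 <= n%:R * (1 - r).
Local Notation a := (@pole_row r phi n).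
Local Notation Phi := (row_phase r phi n).

Lemma row_rt k : 0 < Re (rt (a k)).
Proof.
rewrite /pole_row; case: ifP => _; first exact: Re_rt_inv_pole_gt0.
case: ifP => _; last exact: Re_rt0.
by rewrite Re_rt_conj; exact: Re_rt_inv_pole_gt0.
Qed.

Lemma pole_row_slit k : B (sphere_inv (a k)).
Proof. by apply/slit_sphere_inv; exact: row_rt. Qed.

Lemma row_den k (t : R) : -1 <= t <= 1 -> 1 - a k * t%:C != 0.
Proof. by move=> ht; rewrite mulrC; apply: oneMxz_neq0_closed => //; exact: row_rt. Qed.

Lemma row_phase_continuous : continuous Phi.
Proof.
move=> th; apply: cvgD.
  by apply: cvgM; [exact: cvg_cst|exact: cvg_id].
apply: cvgM; first exact: cvg_cst.
by apply: cvgB; [exact: joukowski_phase_continuous|exact: cvg_id].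
Qed.

Lemma row_phase0 : Phi 0 = 0.
Proof. by rewrite /row_phase joukowski_phase0 subr0 !mulr0 addr0. Qed.

Lemma row_phase_pi : Phi pi = n%:R * pi.
Proof. by rewrite /row_phase joukowski_phase_pi subrr mulr0 addr0. Qed.

(** For [r = 0] the slope is [n]. Otherwise a pole at infinity contributes 1,
    the two finite poles contribute a nonnegative slope of at most
    [2 (1 + r) / (1 - r)], that is at most [n], and the remaining [n - 2] at
    least [n / 2]. *)
Lemma row_phase_lip (u v : R) : u <= v ->
  n%:R / 2 * (v - u) <= Phi v - Phi u <= 2 * n%:R * (v - u).
Proof.
move=> uv; have n0 : 0 <= n%:R :> R by [].
have d0 : 0 <= v - u by rewrite subr_ge0.
have nd := mulr_ge0 n0 d0.
rewrite /row_phase; case: hn => [r0|[n4 nr]].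
  rewrite r0 !joukowski_phase_r0 !subrr mulr0 !addr0 -mulrBr.
  by apply/andP; split; lra.
have /andP[j1 j2] := joukowski_phase_lip phi hr uv.
have n4' : 4 <= n%:R :> R by rewrite ler_nat.
have r1 : 0 < 1 - r by rewrite subr_gt0; case/andP: hr.
have k : (1 + r) / (1 - r) <= n%:R / 2.
  rewrite ler_pdivrMr // ; case/andP: hr => _ r1'; lra.
have j3 := le_trans j2 (ler_wpM2r d0 k).
have nd4 := ler_wpM2r d0 n4'.
by apply/andP; split; lra.
Qed.

(** The transposition of the first two places carries the row to its
    conjugate. *)
Lemma row_inverse_pole (c : C) : c \isn't Num.real ->
  #|[set k | a k == c]%SET| = #|[set k | a k == c^*%R]%SET|.
Proof.
move=> _.
have : exists2 s : 'I_n -> 'I_n, injective s & forall k, a (s k) = (a k)^*.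
  case: hn => [r0|[n4 _]].
    exists id => // k; rewrite /pole_row r0 inv_pole_r0.
    by rewrite conjc0 !if_same conjc0.
  have n0 : (0 < n)%N by lia.
  have n1 : (1 < n)%N by lia.
  pose s := tperm (Ordinal n0) (Ordinal n1).
  exists s; first exact: perm_inj.
  move=> k; rewrite /s; case: tpermP => [->|->|k0 k1].
  - by rewrite /pole_row /=.
  - by rewrite /pole_row /=; exact: (esym (conjcK (inv_pole r phi))).
  rewrite /pole_row; have -> : (k == 0 :> nat) = false.
    by apply/negP => /eqP k0'; apply: k0; exact: val_inj.
  have -> : (k == 1 :> nat) = false.
    by apply/negP => /eqP k1'; apply: k1; exact: val_inj.
  by rewrite conjc0.
case=> s sI sE; rewrite -(card_imset [set k | a k == c]%SET sI).
have sK : bijective s by exact: injF_bij.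
case: sK => t stK tsK.
apply: eq_card => k; rewrite !inE; apply/imsetP/eqP => [[j]|ak].
  by rewrite inE => /eqP <- ->; rewrite sE.
exists (t k); rewrite ?tsK // inE; apply/eqP.
have := sE (t k); rewrite tsK ak => h.
by apply: (can_inj (@conjcK R)); exact: esym h.
Qed.

Lemma slit_measure_row k (th : R) : 0 <= th <= pi ->
  slit_measure (cos th) (sphere_inv (a k)) =
  1 - (if (k < 2)%N then joukowski_phase r phi th else th) / pi.
Proof.
move=> ht.
have H0 : slit_measure (cos th) (sphere_inv 0) = 1 - th / pi.
  have h0 : 0 <= (0 : R) < 1 by rewrite lexx ltr01.
  rewrite (slit_measure_inv_pole h0 ht (phi := phi)) ?joukowski_phase_r0 //.
  by rewrite sphere_invK inv_pole_r0.
have H1 : slit_measure (cos th) (sphere_inv (inv_pole r phi)) =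
    1 - joukowski_phase r phi th / pi.
  by apply: slit_measure_inv_pole => //; rewrite sphere_invK.
have H2 : slit_measure (cos th) (sphere_inv (inv_pole r phi)^*) =
    1 - joukowski_phase r phi th / pi.
  by rewrite -H1 /slit_measure !sphere_invK omega_conj.
rewrite /pole_row; case: (nat_of_ord k) => [|[|m]] //=.
Qed.

Lemma sum_row_phase (th : R) :
  \sum_(k < n) (if (k < 2)%N then joukowski_phase r phi th else th) = Phi th.
Proof.
rewrite /row_phase; case: hn => [r0|[n4 _]].
  rewrite r0 joukowski_phase_r0 subrr mulr0 addr0.
  under eq_bigr => k _ do rewrite if_same.
  by rewrite sumr_const card_ord mulr_natl.
case: n n4 => [|[|m]] // _; rewrite !big_ord_recl /=.
by rewrite sumr_const card_ord -[m.+2%:R]natr1 -natr1 -mulr_natl; ring.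
Qed.

Lemma varpi_row (th : R) : 0 <= th <= pi -> varpi a (cos th) = cos (n%:R * pi - Phi th).
Proof.
move=> ht; rewrite /varpi; congr cos.
have ci : -1 <= cos th <= 1 by rewrite cos_geN1 cos_le1.
under eq_bigr => k _.
  rewrite (harmonic_measure_slit ci (@pole_row_slit k)) slit_measure_row //.
  over.
rewrite sumrB sumr_const card_ord -mulr_suml sum_row_phase mulrBr mulrC.
by rewrite mulrCA divff ?mulr1 // gt_eqF // pi_gt0.
Qed.

Lemma sin_mul_sin (m : nat) (u : R) : 
  2 * (sin (m.+1%:R * u) * sin u) = cos (m%:R * u) - cos (m.+2%:R * u).
Proof.
have e0 : m%:R * u = m.+1%:R * u - u by rewrite -natr1; ring.
have e2 : m.+2%:R * u = m.+1%:R * u + u by rewrite -[in LHS]natr1; ring.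
by rewrite e0 e2 cosB cosD; ring.
Qed.

(** [(jX + i jY)^2 = M^2 e^(2 i A)], so [M^2 cos Phi] is the real part of
    [e^(i (n - 2) th) (jX + i jY)^2]. There [jX] is affine in [cos th] and [jY]
    a multiple of [sin th]; the even powers of [sin th] are polynomials in
    [cos th], and the product [sin ((n - 2) th) sin th] is a difference of two
    cosines. *)
Lemma row_poly : exists2 q : {poly R}, (size q <= n.+1)%N &
  forall th, q.[cos th] = (jX r phi th ^+ 2 + jY r th ^+ 2) * cos (Phi th).
Proof.
case: hn => [r0|[n4 _]].
  exists (cheb R n); first exact: cheb_size.
  move=> th; rewrite chebE /row_phase /jX /jY r0 joukowski_phase_r0.
  rewrite subrr !mulr0 !mul0r addr0 expr0n addr0 !subr0 !mul1r.
  by rewrite cos2Dsin2 mul1r.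
case: n n4 => [|[|[|m]]] // _.
pose X : {poly R} := (1 + r ^+ 2)%:P * 'X - (2 * r * cos phi)%:P.
pose Y2 : {poly R} := ((1 - r ^+ 2) ^+ 2)%:P * (1 - 'X ^+ 2).
have sX : (size X <= 2)%N.
  rewrite /X (leq_trans (size_polyD _ _)) // size_polyN geq_max.
  rewrite (leq_trans (size_polyC_leq1 _)) // andbT.
  by rewrite (leq_trans (size_polyMleq _ _)) // size_polyX addn2 ltnS size_polyC_leq1.
have sM (p s : {poly R}) i j : (size p <= i.+1)%N -> (size s <= j.+1)%N ->
    (size (p * s)%R <= (i + j).+1)%N.
  move=> hp hs; rewrite (leq_trans (size_polyMleq _ _)) //.
  by move: hp hs; lia.
have sB (p s : {poly R}) i : (size p <= i)%N -> (size s <= i)%N ->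
    (size (p - s)%R <= i)%N.
  by move=> hp hs; rewrite (leq_trans (size_polyD _ _)) // size_polyN geq_max hp.
have sY : (size Y2 <= 3)%N.
  apply: (sM _ _ 0%N 2%N); first exact: size_polyC_leq1.
  by apply: (sB _ _ _); rewrite ?size_poly1 // size_polyXn.
exists (cheb R m.+1 * (X * X - Y2) - (1 - r ^+ 2)%:P * (X * (cheb R m - cheb R m.+2))).
  apply: (sB _ _ _).
    have -> : m.+4 = (m.+1 + 2).+1 by rewrite addn2.
    apply: (sM _ _ _ _); first exact: cheb_size.
    by apply: (sB _ _ _) => //; exact: (sM _ _ 1%N 1%N).
  apply: (@leq_trans (0 + m.+3).+1); last by [].
  apply: (sM _ _ 0%N); first exact: size_polyC_leq1.
  apply: (sM _ _ 1%N m.+2) => //.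
  apply: (sB _ _ _); last exact: cheb_size.
  by apply: leq_trans (cheb_size _ _) _; lia.
move=> th; rewrite /X /Y2 !(hornerD, hornerN, hornerM, hornerC, hornerX, hornerXn) !chebE.
have [M M0 [CM SM]] := joukowski_phase_cossin phi th hr.
have -> : row_phase r phi m.+3 th = m.+1%:R * th + 2 * joukowski_phase r phi th.
  by rewrite /row_phase -[m.+3%:R]natr1 -[m.+2%:R]natr1; ring.
set A := joukowski_phase r phi th in CM SM *.
have -> : jX r phi th ^+ 2 + jY r th ^+ 2 = M ^+ 2.
  rewrite -CM -SM; transitivity (M ^+ 2 * (cos A ^+ 2 + sin A ^+ 2)); first by ring.
  by rewrite cos2Dsin2 mulr1.
have -> : 2 * A = A + A by ring.
rewrite cosD [cos (A + A)]cosD [sin (A + A)]sinD.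
transitivity (cos (m.+1%:R * th) * ((cos A * M) ^+ 2 - (sin A * M) ^+ 2) -
  2 * (sin (m.+1%:R * th) * (sin A * M)) * (cos A * M)); last by ring.
rewrite CM SM.
have -> : 2 * (sin (m.+1%:R * th) * jY r th) =
   (1 - r ^+ 2) * (2 * (sin (m.+1%:R * th) * sin th)) by rewrite /jY; ring.
rewrite sin_mul_sin /jY exprMn sin2cos2 /jX.
by ring.
Qed.

Local Notation x := (node row_phase_continuous row_phase0 row_phase_pi).

(** The two conjugate linear factors have the same modulus on the real line. *)
Lemma row_den_prod : exists2 K : R, 0 < K & forall th,
  jX r phi th ^+ 2 + jY r th ^+ 2 =
  K * normc (\prod_(k < n) (1 - a k * (cos th)%:C)).
Proof.
case: hn => [r0|[n4 _]].
  exists 1 => // th; rewrite big1 => [|k _].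
    rewrite /= expr1n expr0n addr0 sqrtr1 mulr1 /jX /jY r0.
    by rewrite expr0n mulr0 mul0r !subr0 addr0 !mul1r cos2Dsin2.
  rewrite /pole_row r0 inv_pole_r0 conjc0.
  by rewrite !if_same mul0r subr0.
have [K K0 KE] := jXY_normsq phi hr; exists K => // th; rewrite KE; congr (_ * _).
rewrite (eq_bigr (fun k : 'I_n => if (k == 0 :> nat)%N then
  1 - inv_pole r phi * (cos th)%:C else if (k == 1 :> nat)%N then
  1 - (inv_pole r phi)^* * (cos th)%:C else 1)); last first.
  by move=> k _; rewrite /pole_row; case: ifP => // _; case: ifP; rewrite ?mul0r ?subr0.
case: n n4 => [|[|m]] // _; rewrite !big_ord_recl /= big1_eq mulr1.
rewrite -sqr_normc expr2 [RHS]normcM; congr (_ * _).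
have -> : 1 - (inv_pole r phi)^* * (cos th)%:C = (1 - inv_pole r phi * (cos th)%:C)^*.
  by case: (inv_pole r phi) => u v; apply: eqC => /=; ring.
by rewrite !normcE /normsq; case: (1 - _) => u v /=; rewrite sqrrN.
Qed.

(** The polynomial of degree at most [n] vanishes at the [n] distinct nodes, so
    it is a constant multiple of the product of the [cos th - x_k], the
    numerator of [w_n]. *)
Lemma wfun_row : exists2 kappa : R, 0 < kappa & forall u, 0 <= u <= pi ->
  normc (wfun x a (cos u)%:C) = kappa * `|cos (Phi u)|.
Proof.
have [q sq qE] := row_poly; have [K K0 KE] := row_den_prod.
have D0 th : 0 < jX r phi th ^+ 2 + jY r th ^+ 2.
  rewrite KE mulr_gt0 // normcE sqrtr_gt0 normsq_gt0; apply/prodf_neq0 => k _.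
  by apply: row_den; rewrite cos_geN1 cos_le1.
have q0 : q != 0.
  apply/eqP => q0; have := qE 0; rewrite q0 horner0 row_phase0 cos0 mulr1 => E.
  by have := D0 0; rewrite -E ltxx.
pose rs := [seq x k | k <- enum 'I_n].
have sz : size rs = n by rewrite size_map size_enum_ord.
have Urs : uniq rs.
  rewrite map_inj_uniq ?enum_uniq //.
  apply: node_inj; exact: row_phase_lip.
have Rrs : all (root q) rs.
  apply/allP => _ /mapP[k _ ->]; apply/rootP.
  by rewrite /node qE cos_Phi_node mulr0.
have sq' : size q = (size rs).+1.
  apply/eqP; rewrite eqn_leq sz sq /= -{1}sz.
  exact: max_poly_roots.
have qP : q = lead_coef q *: \prod_(z <- rs) ('X - z%:P).
  by apply: all_roots_prod_XsubC => //; rewrite uniq_rootsE.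
have c0 : lead_coef q != 0 by rewrite lead_coef_eq0.
exists (K / `|lead_coef q|); first by rewrite divr_gt0 // normr_gt0.
move=> u hu.
have E : K * normc (\prod_(k < n) (1 - a k * (cos u)%:C)) * cos (Phi u) =
   lead_coef q * \prod_(k < n) (cos u - x k).
  rewrite -KE -qE {1}qP hornerZ horner_prod big_map big_enum /=.
  by congr (_ * _); apply: eq_bigr => k _; rewrite hornerXsubC.
have P0 : 0 < normc (\prod_(k < n) (1 - a k * (cos u)%:C)).
  rewrite normcE sqrtr_gt0 normsq_gt0; apply/prodf_neq0 => k _.
  by apply: row_den; rewrite cos_geN1 cos_le1.
rewrite /wfun prodf_div [LHS]normcM [normc (_^-1)]ComplexField.Normc.normcV.
have -> : normc (\prod_(k < n) ((cos u)%:C - cplx_of_real (x k))) =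
   `|\prod_(k < n) (cos u - x k)|.
  rewrite /cplx_of_real (eq_bigr (fun k => (cos u - x k)%:C)); last first.
    by move=> k _; rewrite rmorphB.
  by rewrite -rmorph_prod /= expr0n addr0 sqrtr_sqr.
apply: (mulIf (lt0r_neq0 P0)); rewrite divfK ?gt_eqF //.
have c1 : `|lead_coef q| != 0 by rewrite normr_eq0.
apply: (mulfI c1); rewrite -normrM -E !normrM (gtr0_norm K0) (gtr0_norm P0).
by rewrite !mulrA [`|_| * K]mulrC mulfK //; ring.
Qed.

Lemma lebesgue_row : (0 < n)%N ->
  (lebesgue_constant x a <= (256 * (1 + ln n%:R))%:E)%E.
Proof.
move=> n0; have [kappa k0 kE] := wfun_row.
apply: (lebesgue_constant_bound row_phase_lip row_den k0 kE n0).
Qed.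

Lemma zero_row_pole_row : zero_row a x.
Proof. by apply: zero_row_node; [exact: row_phase_lip|exact: varpi_row]. Qed.

End OneRow.
End Rows.

(** * Convergence of the poles and the conclusion *)

Section PoleSequence.
Variable R : realType.
Local Notation C := (Cplx R).
Local Notation Re := complex.Re.
Local Notation Im := complex.Im.
Local Notation normc := ComplexField.Normc.normc.
Local Open Scope complex_scope.

(** For [n >= 4] this gives [n (1 - r) = 4], which keeps the slope of the phase
    of order [n] while the poles converge to the interval; shorter rows have all
    poles at infinity. *)
Definition radius (n : nat) : R := if (n < 4)%N then 0 else 1 - 4 / n%:R.

Lemma radius_itv n : 0 <= radius n < 1.
Proof.
rewrite /radius; case: ltnP => n4; first by rewrite lexx ltr01.
have n0 : 0 < n%:R :> R by rewrite ltr0n; exact: leq_trans n4.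
have n4' : 4 <= n%:R :> R by rewrite ler_nat.
by rewrite subr_ge0 ler_pdivrMr // mul1r n4' ltrBlDr ltrDl divr_gt0.
Qed.

Lemma radius_large n : radius n = 0 \/ (4 <= n)%N /\ 4 <= n%:R * (1 - radius n).
Proof.
rewrite /radius; case: ltnP => n4; [by left|right; split => //].
have n0 : n%:R != 0 :> R by rewrite pnatr_eq0 -lt0n; exact: leq_trans n4.
by rewrite opprB addrC subrK mulrC divfK.
Qed.

(** The pole is [cos phi (r + 1/r) / 2 + i sin phi (r - 1/r) / 2]. *)
Lemma pole_dist (r phi : R) : 2^-1 <= r -> r < 1 ->
  normc ((inv_pole r phi)^-1 - (cos phi)%:C) <= 3 * (1 - r).
Proof.
move=> r2 r1; have r0 : 0 < r by apply: lt_le_trans r2; rewrite invr_gt0.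
have r0' := lt0r_neq0 r0.
pose e : R[i] := cos phi +i* sin phi; pose e' : R[i] := cos phi -i* sin phi.
have cs := cos2Dsin2 phi.
have bE : disc_pole r phi = r%:C * e by rewrite /disc_pole; apply: eqC => /=; ring.
have eC : e * e' = 1.
  apply: eqC => /=; last by ring.
  by rewrite mulrN opprK -!expr2.
have e0 : e != 0.
  by apply/eqP => E; move: eC; rewrite E mul0r => /eqP; rewrite eq_sym oner_eq0.
have eV : e^-1 = e' by apply: (mulfI e0); rewrite mulfV.
have rC0 : r%:C != 0 :> R[i] by apply/eqP => -[/eqP]; rewrite (negbTE r0').
have -> : (inv_pole r phi)^-1 = (r^-1%:C * e' + r%:C * e) / 2%:C.
  have rV : (r^-1)%:C = (r%:C)^-1 :> R[i] by rewrite fmorphV.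
  rewrite /inv_pole bE -eV rV.
  have t0 : 2%:C != 0 :> R[i] by apply/eqP => -[/eqP]; rewrite pnatr_eq0.
  rewrite invf_div; move: (r%:C) rC0 (2%:C) t0 => s s0 t t0; field.
  by apply/and3P.
have -> : (r^-1%:C * e' + r%:C * e) / 2%:C - (cos phi)%:C =
  (cos phi * ((1 - r) ^+ 2 / (2 * r))) +i* (- sin phi * ((1 - r ^+ 2) / (2 * r))).
  have h : (2%:C)^-1 = (2^-1)%:C :> R[i] by rewrite fmorphV.
  by rewrite h; apply: eqC; rewrite /e /e' /=; field.
apply: le_trans (normc_le_ReIm _) _ => /=.
rewrite [`|cos phi * _|]normrM [`|- sin phi * _|]normrM normrN.
have c1 : `|cos phi| <= 1 by rewrite ler_norml cos_geN1 cos_le1.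
have s1 : `|sin phi| <= 1 by rewrite ler_norml sin_geN1 sin_le1.
have h1 : `|(1 - r) ^+ 2 / (2 * r)| <= 1 - r.
  rewrite ger0_norm; last by rewrite divr_ge0 ?sqr_ge0 // mulr_ge0 // ltW.
  by rewrite ler_pdivrMr ?mulr_gt0 //; nra.
have h2 : `|(1 - r ^+ 2) / (2 * r)| <= 2 * (1 - r).
  rewrite ger0_norm; last by rewrite divr_ge0 //; [nra|lra].
  by rewrite ler_pdivrMr ?mulr_gt0 //; nra.
have := ler_pM (normr_ge0 _) (normr_ge0 _) c1 h1.
have := ler_pM (normr_ge0 _) (normr_ge0 _) s1 h2.
lra.
Qed.

Lemma inv_pole_neq0 (r phi : R) : 0 < r < 1 -> inv_pole r phi != 0.
Proof.
move=> /andP[r0 r1]; apply/eqP => E.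
have hr : 0 <= r < 1 by rewrite ltW.
have [l l0 [_]] := inv_pole_lam phi hr; rewrite E.
have -> : Re (rt (0 : R[i])) = 1 by rewrite /rt mulr0 subr0 sqrtc1.
by rewrite expr1n expr0n addr0 mulr1 => ->; nra.
Qed.

End PoleSequence.

Theorem theorem5 (R : realType) (F : set R) (finF : finite_set F)
    (F_sub : F `<=` `[-1, 1]) :
  exists a : forall n, 'I_n -> Cplx R,
    [/\ inverse_pole_matrix a,
        forall t, F t -> limit_point (poles a) (Some (cplx_of_real t)) &
        exists x : forall n, 'I_n -> R,
          (forall n, zero_row (a n) (x n)) /\
          exists C : R, 0 < C /\
            forall n, (2 <= n)%N ->
              (lebesgue_constant (x n) (a n) <= (C * ln n%:R)%:E)%E].
Proof.
have [s sF] : exists s : seq R, F = [set` s] by apply/finite_seqP.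
pose f (n : nat) : R := nth 0 s (n %% size s).
have f_itv n : -1 <= f n <= 1.
  rewrite /f; have [h|h] := ltnP (n %% size s) (size s); last first.
    by rewrite nth_default // oppr_le0 ler01.
  have : F (nth 0 s (n %% size s)) by rewrite sF /= mem_nth.
  by move=> /F_sub; rewrite /= in_itv.
have cf n : cos (acos (f n)) = f n by rewrite acosK // in_itv /= f_itv.
have rI := @radius_itv R; have rL := @radius_large R.
exists (fun n => @pole_row R (radius R n) (acos (f n)) n); split.
- move=> n; split => [k|c]; first exact: pole_row_slit.
  exact: row_inverse_pole.
- move=> t Ft U /near_slit_point[e e0 eU].
  have ts : t \in s by move: Ft; rewrite sF.
  have s0 : (0 < size s)%N by move: ts; case: (s).
  (* The poles of row n are within 12 / n of their target; n > 8 makes the radius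
     at least 1/2, and n is congruent to the index of t modulo the size of s. *)
  pose N := (8 + Num.truncn (12 / e)).+1.
  pose n := (N * size s + index t s)%N.
  have nN : (N <= n)%N by rewrite /n; nia.
  have ft : f n = t by rewrite /f /n modnMDl modn_small ?index_mem // nth_index.
  have n0 : (0 < n)%N by exact: leq_trans nN.
  have n8 : (8 < n)%N by apply: leq_trans nN; rewrite /N; lia.
  exists (sphere_inv (@pole_row R (radius R n) (acos (f n)) n (Ordinal n0))).
  have sl := @pole_row_slit R _ (acos (f n)) n (rI n) (Ordinal n0).
  split.
  + apply/eqP => E; apply: sl; rewrite E; apply/segmentP; exists t => //.
    by have := F_sub _ Ft; rewrite /= in_itv.
  + by exists n, (Ordinal n0).
  + rewrite /pole_row /= /sphere_inv.
    have n0' : 0 < n%:R :> R by rewrite ltr0n.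
    have n8' : 8 <= n%:R :> R by rewrite ler_nat ltnW.
    have n4 : (4 <= n)%N by exact: leq_trans n8.
    have rE : radius R n = 1 - 4 / n%:R by rewrite /radius ltnNge n4.
    have r2 : 2^-1 <= radius R n.
      have : 4 / n%:R <= 2^-1 :> R by rewrite ler_pdivrMr //; lra.
      by rewrite rE; lra.
    have r1 : radius R n < 1 by case/andP: (rI n).
    have D := pole_dist (acos (f n)) r2 r1; rewrite cf ft in D.
    have De : 3 * (1 - radius R n) < e.
      have -> : 3 * (1 - radius R n) = 12 / n%:R.
        by rewrite rE; field; rewrite gt_eqF.
      rewrite ltr_pdivrMr // mulrC -ltr_pdivrMr //.
      apply: lt_le_trans (_ : (Num.truncn (12 / e)).+1%:R <= _); first exact: truncnS_gt.
      by rewrite ler_nat; apply: leq_trans nN; rewrite /N ltnS leq_addl.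
    have p0 : inv_pole (radius R n) (acos t) != 0.
      apply: inv_pole_neq0; rewrite r1 andbT; apply: lt_le_trans r2.
      by rewrite invr_gt0.
    rewrite ft (negbTE p0).
    case bE : (inv_pole _ _)^-1 D => [u v] D.
    have [d1 d2] := ReIm_le_normc (Complex u v - cplx_of_real t).
    apply: eU; apply: (le_lt_trans _ De); apply: le_trans D.
      by rewrite distrC; move: d1; rewrite /=.
    by move: d2; rewrite /= oppr0 addr0.
- pose Phi n := @row_phase_lip R _ (acos (f n)) n (rI n) (rL n).
  exists (fun n => node (@row_phase_continuous R _ (acos (f n)) n (rI n))
    (row_phase0 _ _ _) (row_phase_pi _ _ _)); split.
    by move=> n; apply: zero_row_pole_row.
  have ln2 : 0 < ln 2 :> R by apply: ln_gt0; rewrite ltr1n.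
  exists (256 * ((ln 2)^-1 + 1)); split.
    by apply: mulr_gt0; rewrite ?ltr0n // addr_gt0 // invr_gt0.
  move=> n n2.
  have n0 : (0 < n)%N by exact: leq_trans n2.
  apply: (le_trans (@lebesgue_row R (radius R n) (acos (f n)) n (rI n) (rL n) n0)).
  rewrite lee_fin -mulrA; apply: ler_wpM2l; first exact: ler0n.
  rewrite mulrDl mul1r lerD2r mulrC ler_pdivlMr // mul1r ler_ln ?posrE ?ltr0n //.
  by rewrite ler_nat.
Qed.
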